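(* Let $R$ be a Gorenstein ring. Then the triangulated category $R\text{-}\underline{\mathrm{GProj}}$ (the stable category of Gorenstein-projective left $R$-modules) is compactly generated, and its subcategory of compact objects $(R\text{-}\underline{\mathrm{GProj}})^c$ is the additive closure of $R\text{-}\underline{\mathrm{Gproj}}$ (i.e. the compact objects are exactly the direct summands, in $R\text{-}\underline{\mathrm{GProj}}$, of objects of $R\text{-}\underline{\mathrm{Gproj}}$).
   Context: A ring $R$ (with unit) is Gorenstein if it is two-sided noetherian and the regular module $R$ has finite injective dimension both as a left and as a right module. $R\text{-}\mathrm{Mod}$ is the category of left $R$-modules, $R\text{-}\mathrm{Proj}$ (resp. $R\text{-}\mathrm{proj}$) its full subcategory of projective (resp. finitely generated projective) modules. A complex $P^\bullet$ of projective modules is totally-acyclic if for each projective module $Q$ the Hom complexes $\mathrm{Hom}_R(Q,P^\bullet)$ and $\mathrm{Hom}_R(P^\bullet,Q)$ are exact. A module is Gorenstein-projective if it is the zeroth cocycle of a totally-acyclic complex of projectives; $R\text{-}\mathrm{GProj}$ is the full subcategory of these modules. It is a Frobenius category (with the short exact sequences of modules with terms in it) whose projective-injective objects are the projective modules. $R\text{-}\mathrm{Gproj}$ is the full subcategory of $R\text{-}\mathrm{Mod}$ of modules $M$ such that there is an exact sequence $\cdots\to Q^1\to Q^0\to M\to 0$ with all $Q^i\in R\text{-}\mathrm{proj}$, and there is an exact sequence $0\to M\xrightarrow{d^{-1}} P^0\xrightarrow{d^0}P^1\to\cdots$ with all $P^n\in R\text{-}\mathrm{proj}$ and all $\mathrm{Coker}\,d^n$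 satisfying $\mathrm{Ext}^i_R(\mathrm{Coker}\,d^n,P)=0$ for all $P\in R\text{-}\mathrm{proj}$, $i\ge1$. It is a Frobenius category with projective-injective objects $R\text{-}\mathrm{proj}$. $R\text{-}\underline{\mathrm{GProj}}$ and $R\text{-}\underline{\mathrm{Gproj}}$ are the corresponding stable categories (morphisms modulo those factoring through projective-injective objects), which are triangulated; since $R\text{-}\mathrm{Gproj}\subseteq R\text{-}\mathrm{GProj}$, the inclusion induces a fully faithful triangle-functor $R\text{-}\underline{\mathrm{Gproj}}\hookrightarrow R\text{-}\underline{\mathrm{GProj}}$, through which the former is viewed as a subcategory of the latter. In a triangulated category $\mathcal{C}$ with arbitrary small coproducts, an object $C$ is compact if $\mathrm{Hom}_{\mathcal{C}}(C,-)$ commutes with coproducts; $\mathcal{C}^c$ is the full subcategory of compact objects. $\mathcal{C}$ is compactly generated if there is a set $S$ of compact objects such that no proper triangulated subcategory of $\mathcal{C}$ contains $S$ and is closed under coproducts. The category $R\text{-}\underline{\mathrm{GProj}}$ has arbitrary coproducts. *)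

(* Defs.v *)
From HB Require Import structures.
From mathcomp Require Import all_boot all_algebra.
From mathcomp Require Import boolp classical_sets cardinality fsbigop.

Set Implicit Arguments.
Unset Strict Implicit.
Unset Printing Implicit Defensive.

Import GRing.Theory.
Local Open Scope ring_scope.

(* Modules are left modules.  A right R-module is a left module over the *)
(* converse ring R^c, and R^o is the regular left module. *)

Section Modules.
Variable R : pzRingType.
Implicit Types (A B C M E P Q : lmodType R).

Definition surjective A B (f : {linear A -> B}) : Prop :=
  forall y, exists x, f x = y.

Definition exact_at A B C (f : {linear A -> B}) (g : {linear B -> C}) : Prop :=
  forall y, g y = 0 <-> exists x, f x = y.

Definition short_exact A B C (i : {linear A -> B}) (p : {linear B -> C}) : Prop :=
  [/\ injective i, exact_at i p & surjective p].

Definition projective P : Prop :=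
  forall A B (p : {linear A -> B}) (f : {linear P -> B}),
    surjective p -> exists g : {linear P -> A}, forall x, p (g x) = f x.

Definition injective_module E : Prop :=
  forall A B (i : {linear A -> B}) (f : {linear A -> E}),
    injective i -> exists g : {linear B -> E}, forall x, g (i x) = f x.

Definition fin_gen M : Prop :=
  exists (n : nat) (e : 'I_n -> M),
    forall x, exists c : 'I_n -> R, x = \sum_(j < n) c j *: e j.

Definition fg_projective P : Prop := projective P /\ fin_gen P.

Definition left_ideal (I : R -> Prop) : Prop :=
  [/\ I 0, forall x y, I x -> I y -> I (x + y) & forall a x, I x -> I (a * x)].

Definition left_noetherian : Prop :=
  forall I, left_ideal I ->
    exists (n : nat) (e : 'I_n -> R), (forall j, I (e j)) /\
      forall x, I x -> exists c : 'I_n -> R, x = \sum_(j < n) c j * e j.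

(* exactness of ... -> Q 2 -> Q 1 -> Q 0 -> M -> 0 *)
Definition left_resolution M (Q : nat -> lmodType R)
    (d : forall n, {linear Q n.+1 -> Q n}) (e : {linear Q 0%N -> M}) : Prop :=
  [/\ surjective e, exact_at (d 0%N) e & forall n, exact_at (d n.+1) (d n)].

(* exactness of 0 -> M -> E 0 -> E 1 -> E 2 -> ... *)
Definition right_resolution M (E : nat -> lmodType R)
    (e : {linear M -> E 0%N}) (d : forall n, {linear E n -> E n.+1}) : Prop :=
  [/\ injective e, exact_at e (d 0%N) & forall n, exact_at (d n) (d n.+1)].

Definition finite_injective_dimension M : Prop :=
  exists (n : nat) (E : nat -> lmodType R) (e : {linear M -> E 0%N})
         (d : forall j, {linear E j -> E j.+1}),
    [/\ right_resolution e d, forall j, injective_module (E j)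
      & forall j, (n < j)%N -> forall x : E j, x = 0].

(* Ext^(j+1)(A, B) = 0: the cohomology of Hom(Q, B) vanishes in degree j+1, *)
(* for some (equivalently, any) projective resolution Q of A. *)
Definition ext_succ_vanishes (j : nat) A B : Prop :=
  exists (Q : nat -> lmodType R) (d : forall n, {linear Q n.+1 -> Q n})
         (e : {linear Q 0%N -> A}),
    [/\ left_resolution d e, forall n, projective (Q n)
      & forall f : {linear Q j.+1 -> B}, (forall x, f (d j.+1 x) = 0) ->
          exists g : {linear Q j -> B}, forall x, f x = g (d j x)].

(* Ext^i(Coker f, P) = 0 for all i >= 1 and all f.g. projective P *)
Definition coker_ext_vanishes A B (f : {linear A -> B}) : Prop :=
  exists (C : lmodType R) (q : {linear B -> C}),
    [/\ surjective q, exact_at f q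
      & forall P, fg_projective P -> forall j, ext_succ_vanishes j C P].

(* Exactness of Hom(Q, P) and Hom(P, Q) is expressed in degree n + 1, for all *)
(* integers n, so that no cast between the P n is needed. *)
Definition totally_acyclic (P : int -> lmodType R)
    (d : forall n, {linear P n -> P (n + 1)}) : Prop :=
  [/\ forall n, projective (P n),
      forall n x, d (n + 1) (d n x) = 0,
      forall Q, projective Q -> forall n (f : {linear Q -> P (n + 1)}),
        (forall x, d (n + 1) (f x) = 0) ->
        exists g : {linear Q -> P n}, forall x, f x = d n (g x)
    & forall Q, projective Q -> forall n (f : {linear P (n + 1) -> Q}),
        (forall x, f (d n x) = 0) ->
        exists g : {linear P (n + 1 + 1) -> Q}, forall x, f x = g (d (n + 1) x)].

Definition gorenstein_projective M : Prop :=
  exists (P : int -> lmodType R) (d : forall n, {linear P n -> P (n + 1)})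
         (k : {linear M -> P 0}),
    [/\ totally_acyclic d, injective k & exact_at k (d 0)].

Definition fg_gorenstein_projective M : Prop :=
  (exists (Q : nat -> lmodType R) (d : forall n, {linear Q n.+1 -> Q n})
          (e : {linear Q 0%N -> M}),
     left_resolution d e /\ forall n, fg_projective (Q n)) /\
  (exists (P : nat -> lmodType R) (e : {linear M -> P 0%N})
          (d : forall n, {linear P n -> P n.+1}),
     [/\ right_resolution e d, forall n, fg_projective (P n),
         coker_ext_vanishes e & forall n, coker_ext_vanishes (d n)]).

End Modules.

Definition gorenstein_ring (R : pzRingType) : Prop :=
  [/\ left_noetherian R, left_noetherian R^c,
      finite_injective_dimension (R^o : lmodType R)
    & finite_injective_dimension ((R^c : pzRingType)^o : lmodType R^c)].

(* The data of a triangulated category: a preadditive category, an additive *)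
(* endofunctor, and a class of triangles X -> Y -> Z -> shift X.  The axioms *)
(* on triangles are not recorded, as the notions below do not refer to them. *)

Record triangulated_data := TriangulatedData {
  obj :> Type;
  mor : obj -> obj -> zmodType;
  idm : forall X, mor X X;
  mcomp : forall X Y Z, mor Y Z -> mor X Y -> mor X Z;
  mcomp1m : forall X Y (f : mor X Y), mcomp (idm Y) f = f;
  mcompm1 : forall X Y (f : mor X Y), mcomp f (idm X) = f;
  mcompA : forall X Y Z W (h : mor Z W) (g : mor Y Z) (f : mor X Y),
    mcomp h (mcomp g f) = mcomp (mcomp h g) f;
  mcompDl : forall X Y Z (g g' : mor Y Z) (f : mor X Y),
    mcomp (g + g') f = mcomp g f + mcomp g' f;
  mcompDr : forall X Y Z (g : mor Y Z) (f f' : mor X Y),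
    mcomp g (f + f') = mcomp g f + mcomp g f';
  shift : obj -> obj;
  shiftm : forall X Y, mor X Y -> mor (shift X) (shift Y);
  shiftm1 : forall X, shiftm (idm X) = idm (shift X);
  shiftmM : forall X Y Z (g : mor Y Z) (f : mor X Y),
    shiftm (mcomp g f) = mcomp (shiftm g) (shiftm f);
  shiftmD : forall X Y (f g : mor X Y), shiftm (f + g) = shiftm f + shiftm g;
  triangle : forall X Y Z, mor X Y -> mor Y Z -> mor Z (shift X) -> Prop
}.

Arguments idm {_} X.
Arguments mcomp {_ X Y Z} g f.
Arguments shift {_} X.
Arguments shiftm {_ X Y} f.
Arguments triangle {_ X Y Z} u v w.

(* Small sets are the types of the universe of the carriers of modules. *)
Definition small : Type := Type@{GRing.Lmodule.axioms_.u0}.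

Section Triangulated.
Variable T : triangulated_data.
Implicit Types X Y Z : T.

Definition is_iso X Y (f : mor X Y) : Prop :=
  exists g : mor Y X, mcomp g f = idm X /\ mcomp f g = idm Y.

Definition direct_summand X Y : Prop :=
  exists X' (i : mor X Y) (i' : mor X' Y) (p : mor Y X) (p' : mor Y X'),
    [/\ mcomp p i = idm X, mcomp p' i' = idm X', mcomp p' i = 0, mcomp p i' = 0
      & mcomp i p + mcomp i' p' = idm Y].

Definition is_coproduct (I : small) (X : I -> T) Y (i : forall j, mor (X j) Y) : Prop :=
  forall Z (f : forall j, mor (X j) Z),
    exists! g : mor Y Z, forall j, mcomp g (i j) = f j.

Definition has_coproducts : Prop :=
  forall (I : small) (X : I -> T),
    exists Y (i : forall j, mor (X j) Y), is_coproduct i.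

(* The canonical map from the direct sum of the Hom(C, X j), whose elements *)
(* are the families of finite support, to Hom(C, Y) is bijective. *)
Definition compact_object C : Prop :=
  forall (I : small) (X : I -> T) Y (i : forall j, mor (X j) Y),
    is_coproduct i ->
    forall h : mor C Y, exists! f : forall j, mor C (X j),
      finite_set [set j | f j <> 0] /\
      \sum_(j \in [set: {classic I}]) mcomp (i j) (f j) = h.

(* full subcategories are given by their classes of objects *)
Definition triangulated_subcategory (S : T -> Prop) : Prop :=
  [/\ forall Z, idm Z = 0 -> S Z,
      forall X Y (f : mor X Y), is_iso f -> S X -> S Y,
      forall X, S X <-> S (shift X)
    & forall X Y Z (u : mor X Y) (v : mor Y Z) (w : mor Z (shift X)),
        triangle u v w -> S X -> S Y -> S Z].

Definition closed_under_coproducts (S : T -> Prop) : Prop :=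
  forall (I : small) (X : I -> T) Y (i : forall j, mor (X j) Y),
    is_coproduct i -> (forall j, S (X j)) -> S Y.

Definition compactly_generated : Prop :=
  has_coproducts /\
  exists (I : small) (G : I -> T), (forall j, compact_object (G j)) /\
    forall S : T -> Prop, triangulated_subcategory S -> closed_under_coproducts S ->
      (forall j, S (G j)) -> forall X, S X.

End Triangulated.

Section HomGroup.
Context {R : pzRingType} {U V W : lmodType R}.

HB.instance Definition _ := gen_eqMixin {linear U -> V}.
HB.instance Definition _ := gen_choiceMixin {linear U -> V}.

Lemma linear_ext (f g : {linear U -> V}) : f =1 g -> f = g.
Proof.
case: f g => [f [[fa] [fs]]] [g [[ga] [gs]]] /= /funext fg.
move: fa fs ga gs; rewrite fg => fa fs ga gs.
by rewrite (Prop_irrelevance fa ga) (Prop_irrelevance fs gs).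
Qed.

Definition lin_zero : {linear U -> V} := \0.
Definition lin_opp (f : {linear U -> V}) : {linear U -> V} := \- f.
Definition lin_add (f g : {linear U -> V}) : {linear U -> V} := f \+ g.
Definition lin_comp (g : {linear V -> W}) (f : {linear U -> V}) : {linear U -> W} :=
  g \o f.

Lemma lin_addA : associative lin_add.
Proof. by move=> f g h; apply: linear_ext => x /=; rewrite addrA. Qed.
Lemma lin_addC : commutative lin_add.
Proof. by move=> f g; apply: linear_ext => x /=; rewrite addrC. Qed.
Lemma lin_add0 : left_id lin_zero lin_add.
Proof. by move=> f; apply: linear_ext => x /=; rewrite add0r. Qed.
Lemma lin_addN : left_inverse lin_zero lin_opp lin_add.
Proof. by move=> f; apply: linear_ext => x /=; rewrite addNr. Qed.

HB.instance Definition _ :=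
  GRing.isZmodule.Build {linear U -> V} lin_addA lin_addC lin_add0 lin_addN.

Lemma lin_relP (r : U -> V -> Prop) :
  (forall x, exists y, r x y) -> (forall x y y', r x y -> r x y' -> y = y') ->
  (forall a x x' y y', r x y -> r x' y' -> r (a *: x + x') (a *: y + y')) ->
  exists f : {linear U -> V}, forall x, r x (f x).
Proof.
move=> tot fun_r lin_r; have [f rf] := choice tot.
have f_lin : linear f by move=> a x y; apply: fun_r (rf _) (lin_r _ _ _ _ _ _ _).
pose mf := GRing.isLinear.Build R U V _ f f_lin.
pose F : {linear U -> V} := HB.pack f mf.
by exists F.
Qed.

End HomGroup.

Definition lin_id (R : pzRingType) (U : lmodType R) : {linear U -> U} := idfun.

Section Kernel.
Variables (R : pzRingType) (A B : lmodType R) (f : {linear A -> B}).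

Definition ker_pred : {pred A} := fun x => f x == 0.

Lemma ker_pred_submod : submod_closed ker_pred.
Proof.
split=> [|a x y]; rewrite !unfold_in ?linear0 // => /eqP fx /eqP fy.
by rewrite linearP fx fy scaler0 addr0.
Qed.
HB.instance Definition _ := GRing.isSubmodClosed.Build R A ker_pred ker_pred_submod.

Definition ker_mod := {x : A | x \in ker_pred}.
HB.instance Definition _ := SubChoice.on ker_mod.
HB.instance Definition _ := [SubChoice_isSubLmodule of ker_mod by <:].

Definition ker_incl : {linear ker_mod -> A} := val.

Lemma ker_inclP x : f x = 0 <-> exists y, ker_incl y = x.
Proof.
split=> [/eqP fx|[[y /eqP fy] <-] //].
by exists (exist (fun x => x \in ker_pred) x fx).
Qed.

End Kernel.

Lemma addD_subD (V : zmodType) (a b c d : V) : a + b = c + d -> d - b = a - c.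
Proof. by move=> E; rewrite -(addKr c d) -E addrA addrK addrC. Qed.

Lemma subD_addD (V : zmodType) (a b c d : V) : d - b = a - c -> a + b = c + d.
Proof. by move=> E; rewrite -[a](subrK c) -E addrAC subrK addrC. Qed.

Section GorensteinProjective.
Variable R : pzRingType.
Implicit Types (A B C P Q X Y Z : lmodType R).

Lemma regular_projective : projective (R^o : lmodType R).
Proof.
move=> A B p f /(_ (f 1)) [a pa].
have [|||g gE] := @lin_relP R R^o A (fun x y => y = x *: a).
- by move=> x; exists (x *: a).
- by move=> x y y' -> ->.
- by move=> c x x' y y' -> ->; rewrite scalerDl -scalerA.
exists g => x; rewrite gE linearZ pa -linearZ; congr (f _).
exact: mulr1.
Qed.

Lemma totally_acyclic_exact (P : int -> lmodType R)
    (d : forall n, {linear P n -> P (n + 1)}) (n : int) :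
  totally_acyclic d -> exact_at (d n) (d (n + 1)).
Proof.
case=> _ dd /(_ _ regular_projective n) ex _ y; split=> [dy|[x <-]]; last exact: dd.
have [|||f fE] := @lin_relP R R^o (P (n + 1)) (fun x z => z = x *: y).
- by move=> x; exists (x *: y).
- by move=> x z z' -> ->.
- by move=> c x x' z z' -> ->; rewrite scalerDl -scalerA.
have [x|g gE] := ex f; first by rewrite fE linearZ dy; exact: scaler0.
by exists (g 1); rewrite -gE fE scale1r.
Qed.

Lemma zero_projective : projective ('rV[R]_0 : lmodType R).
Proof.
move=> A B p f _; exists lin_zero => x.
by rewrite (_ : x = 0) ?linear0 //; apply/rowP; case.
Qed.

Lemma pair_projective P Q :
  projective P -> projective Q -> projective ((P * Q)%type : lmodType R).
Proof.
move=> prP prQ A B p f ps.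
have [|||f1 f1E] := @lin_relP R P B (fun x y => y = f (x, 0)).
- by move=> x; exists (f (x, 0)).
- by move=> x y y' -> ->.
- move=> a x x' y y' -> ->; rewrite -linearP; congr (f _).
  by congr (_, _); rewrite /= scaler0 addr0.
have [|||f2 f2E] := @lin_relP R Q B (fun x y => y = f (0, x)).
- by move=> x; exists (f (0, x)).
- by move=> x y y' -> ->.
- move=> a x x' y y' -> ->; rewrite -linearP; congr (f _).
  by congr (_, _); rewrite /= scaler0 addr0.
have [g1 g1E] := prP A B p f1 ps; have [g2 g2E] := prQ A B p f2 ps.
have [|||g gE] := @lin_relP R (P * Q)%type A (fun x y => y = g1 x.1 + g2 x.2).
- by move=> x; exists (g1 x.1 + g2 x.2).
- by move=> x y y' -> ->.
- by move=> a x x' y y' -> ->; rewrite !linearP /= scalerDr addrACA.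
exists g => -[x y]; rewrite gE /= linearD g1E g2E f1E f2E -linearD; congr (f _).
by congr (_, _); rewrite /= ?addr0 ?add0r.
Qed.

Lemma gorenstein_projective_extend X Y Z (i : {linear X -> Y}) (p : {linear Y -> Z}) Q
    (f : {linear X -> Q}) :
  short_exact i p -> gorenstein_projective Z -> projective Q ->
  exists g : {linear Y -> Q}, forall x, g (i x) = f x.
Proof.
move=> [i_inj i_p p_surj] [P [d [k [tac k_inj k_ex]]]] prQ.
suff gen (m : int) (k' : {linear Z -> P (m + 1 + 1 + 1)}) : injective k' ->
    exact_at k' (d (m + 1 + 1 + 1)) ->
    exists g : {linear Y -> Q}, forall x, g (i x) = f x by exact: (gen (- 3%:Z) k).
move: k' => {k k_inj k_ex} k k_inj k_ex.
have [prP dd _ /(_ Q prQ m) ext] := tac.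
have ex n y : d (n + 1) y = 0 -> exists x, d n x = y.
  by case: (totally_acyclic_exact tac y).
have [|||c cE] := @lin_relP R (P (m + 1 + 1)) Z (fun x z => k z = d (m + 1 + 1) x).
- by move=> x; apply/k_ex; exact: dd.
- by move=> x z z' <- /k_inj.
- by move=> a x x' z z' e e'; rewrite !linearP e e'.
have [h hE] := prP _ _ _ p c p_surj.
have [|||t tE] := @lin_relP R (P (m + 1)) Q
    (fun x q => exists2 a, i a = h (d (m + 1) x) & q = f a).
- move=> x; have [a ia] : exists a, i a = h (d (m + 1) x).
    by apply/i_p; rewrite hE; apply: k_inj; rewrite cE dd linear0.
  by exists (f a), a.
- by move=> x q q' [a ia ->] [a' ia' ->]; congr (f _); apply: i_inj; rewrite ia.
- move=> b x x' q q' [a ia ->] [a' ia' ->]; exists (b *: a + a').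
    by rewrite !linearP ia ia'.
  by rewrite linearP.
have [x|g gE] := ext t.
  have [a ia ->] := tE (d m x); rewrite (_ : a = 0) ?linear0 //.
  by apply: i_inj; rewrite ia dd !linear0.
have tg a e : i a = h (d (m + 1) e) -> f a = g (d (m + 1) e).
  by move=> ia; rewrite -gE; have [a' ia' ->] := tE e; congr (f _); apply: i_inj; rewrite ia.
have [|||F FE] := @lin_relP R Y Q
    (fun y q => exists x c', y = i x + h c' /\ q = f x + g c').
- move=> y; have [c' dc'] : exists e, d (m + 1 + 1) e = k (p y).
    by apply/ex/k_ex; exists (p y).
  have [x ix] : exists x, i x = y - h c'.
    apply/i_p; rewrite linearB hE (_ : c c' = p y) ?subrr //.
    by apply: k_inj; rewrite cE.
  by exists (f x + g c'), x, c'; rewrite ix subrK.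
- move=> y q q' [x [e [-> ->]]] [x' [e' [yE ->]]].
  have [u du] : exists u, d (m + 1) u = e' - e.
    apply: ex; rewrite -cE -hE.
    suff -> : h (e' - e) = i (x - x').
      by rewrite (_ : p (i _) = 0) ?linear0 //; apply/i_p; exists (x - x').
    by rewrite !linearB; exact: addD_subD.
  have /tg : i (x - x') = h (d (m + 1) u).
    by rewrite du !linearB; apply/esym/addD_subD.
  by rewrite du !linearB => /esym/subD_addD.
- move=> a y y' q q' [x [e [-> ->]]] [x' [e' [-> ->]]].
  exists (a *: x + x'), (a *: e + e').
  by rewrite !linearP !scalerDr; split; rewrite addrACA.
exists F => x; have [x' [e [ixE ->]]] := FE (i x).
have he : h e = i (x - x') by rewrite linearB ixE [i x' + _]addrC addrK.
have [u du] : exists u, d (m + 1) u = e.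
  apply: ex; rewrite -cE -hE he.
  by rewrite (_ : p (i _) = 0) ?linear0 //; apply/i_p; exists (x - x').
by rewrite -du -(tg (x - x')) ?du // linearB addrC subrK.
Qed.

Lemma gorenstein_projective_embed X : gorenstein_projective X ->
  exists P Y (i : {linear X -> P}) (p : {linear P -> Y}),
    [/\ projective P, gorenstein_projective Y & short_exact i p].
Proof.
move=> [P [d [k [tac k_inj k_ex]]]]; have [prP dd hq hp] := tac.
pose Y : lmodType R := ker_mod (d (0 + 1)).
have [|||p pE] := @lin_relP R (P 0) Y (fun x y => ker_incl (d (0 + 1)) y = d 0 x).
- by move=> x; apply/ker_inclP.
- by move=> x y y' <- /val_inj.
- by move=> a x x' y y' e e'; rewrite !linearP e e'.
exists (P 0), Y, k, p; split=> //.
  exists (fun n => P (n + 1)), (fun n => d (n + 1)), (ker_incl (d (0 + 1))).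
  split.
  - split=> [n|n x|Q prQ n f|Q prQ n f]; [exact: prP|exact: dd|exact: hq|exact: hp].
  - exact: val_inj.
  - by move=> y; apply: ker_inclP.
split=> //.
- move=> y; split=> [py|/k_ex dy]; first by apply/k_ex; rewrite -pE py linear0.
  by apply: val_inj; rewrite -[LHS]/(ker_incl (d (0 + 1)) (p y)) pE dy.
- case=> y ky; have /eqP/(proj1 (totally_acyclic_exact tac _))[x dx] := ky.
  by exists x; apply: val_inj; rewrite -[LHS]/(ker_incl (d (0 + 1)) (p x)) pE.
Qed.

End GorensteinProjective.

Record gproj (R : pzRingType) := GProj {
  gproj_mod :> lmodType R;
  gprojP : gorenstein_projective gproj_mod
}.

Section StableCategory.
Local Open Scope quotient_scope.
Context {R : pzRingType}.

Section Def.
Variables X Y : lmodType R.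

Definition factors_through_projective (f : {linear X -> Y}) : Prop :=
  exists (P : lmodType R) (a : {linear X -> P}) (b : {linear P -> Y}),
    projective P /\ f = lin_comp b a.

Definition null_map : {pred {linear X -> Y}} :=
  fun f => `[< factors_through_projective f >].

Lemma null_map_zmod : zmod_closed null_map.
Proof.
split=> [|f g].
  apply/asboolP; exists 'rV[R]_0, lin_zero, lin_zero; split; first exact: zero_projective.
  exact: linear_ext.
move=> /asboolP[P [a [b [prP ->]]]] /asboolP[Q [a' [b' [prQ ->]]]]; apply/asboolP.
have [|||c cE] := @lin_relP R X (P * Q)%type (fun x y => y = (a x, a' x)).
- by move=> x; exists (a x, a' x).
- by move=> x y y' -> ->.
- by move=> r x x' y y' -> ->; rewrite !linearP.
have [|||e eE] := @lin_relP R (P * Q)%type Y (fun x y => y = b x.1 - b' x.2).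
- by move=> x; exists (b x.1 - b' x.2).
- by move=> x y y' -> ->.
- by move=> r x x' y y' -> ->; rewrite !linearP /= scalerDr addrACA.
exists (P * Q)%type, c, e; split; first exact: pair_projective.
by apply: linear_ext => x /=; rewrite eE cE.
Qed.
HB.instance Definition _ := GRing.isZmodClosed.Build {linear X -> Y} null_map null_map_zmod.

Definition stable_hom : zmodType := Quotient.quot null_map.

Definition stable (f : {linear X -> Y}) : stable_hom := \pi_(Quotient.quot null_map) f.
Definition stable_repr (f : stable_hom) : {linear X -> Y} :=
  repr (f : Quotient.quot null_map).

Lemma stable_reprK f : stable (stable_repr f) = f.
Proof. exact: reprK. Qed.

Lemma stable_eqP f g :
  stable f = stable g <-> factors_through_projective (f - g).
Proof.
have E := Quotient.idealrBE null_map f g.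
split=> [/eqP|h]; first by rewrite /stable -E => /asboolP.
by apply/eqP; rewrite /stable -E; apply/asboolP.
Qed.

Lemma stableD f g : stable (f + g) = stable f + stable g.
Proof. exact: (raddfD \pi_(Quotient.quot null_map)). Qed.

End Def.

Lemma lin_addE (U V : lmodType R) (f g : {linear U -> V}) x : (f + g) x = f x + g x.
Proof. by []. Qed.

Lemma lin_subE (U V : lmodType R) (f g : {linear U -> V}) x : (f - g) x = f x - g x.
Proof. by []. Qed.

Lemma null_add (X Y : lmodType R) (f g : {linear X -> Y}) :
  factors_through_projective f -> factors_through_projective g ->
  factors_through_projective (f + g).
Proof.
have mem (h : {linear X -> Y}) : (h \in @null_map X Y) = `[< factors_through_projective h >].
  by [].
by move=> /asboolP + /asboolP; rewrite -!mem => nf /(rpredD nf); rewrite mem => /asboolP.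
Qed.

Lemma null_compl (X Y Z : lmodType R) (g : {linear Y -> Z}) (f : {linear X -> Y}) :
  factors_through_projective f -> factors_through_projective (lin_comp g f).
Proof.
move=> [P [a [b [prP ->]]]]; exists P, a, (lin_comp g b); split=> //.
exact: linear_ext.
Qed.

Lemma null_compr (X Y Z : lmodType R) (g : {linear Y -> Z}) (f : {linear X -> Y}) :
  factors_through_projective g -> factors_through_projective (lin_comp g f).
Proof.
move=> [P [a [b [prP ->]]]]; exists P, (lin_comp a f), b; split=> //.
exact: linear_ext.
Qed.

Definition stable_comp (X Y Z : lmodType R) (g : stable_hom Y Z) (f : stable_hom X Y) :
    stable_hom X Z :=
  stable (lin_comp (stable_repr g) (stable_repr f)).

Lemma stable_compE (X Y Z : lmodType R) (g : {linear Y -> Z}) (f : {linear X -> Y}) :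
  stable_comp (stable g) (stable f) = stable (lin_comp g f).
Proof.
apply/stable_eqP; set g' := stable_repr _; set f' := stable_repr _.
have -> : lin_comp g' f' - lin_comp g f = lin_comp g' (f' - f) + lin_comp (g' - g) f.
  apply: linear_ext => x; rewrite lin_subE [RHS]lin_addE /= linearB.
  by rewrite addrA subrK.
apply: null_add; [apply: null_compl|apply: null_compr]; apply/stable_eqP;
  exact: stable_reprK.
Qed.

Definition stable_id (X : lmodType R) : stable_hom X X := stable (lin_id X).

Definition stable_iso (X Y : lmodType R) (f : stable_hom X Y) : Prop :=
  exists g : stable_hom Y X,
    stable_comp g f = stable_id X /\ stable_comp f g = stable_id Y.

Lemma stable_comp1m (X Y : lmodType R) (f : stable_hom X Y) :
  stable_comp (stable_id Y) f = f.
Proof.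
rewrite -(stable_reprK f) stable_compE; congr stable; exact: linear_ext.
Qed.

Lemma stable_compm1 (X Y : lmodType R) (f : stable_hom X Y) :
  stable_comp f (stable_id X) = f.
Proof.
rewrite -(stable_reprK f) stable_compE; congr stable; exact: linear_ext.
Qed.

Lemma stable_compA (X Y Z W : lmodType R) (h : stable_hom Z W) (g : stable_hom Y Z)
    (f : stable_hom X Y) :
  stable_comp h (stable_comp g f) = stable_comp (stable_comp h g) f.
Proof.
rewrite -(stable_reprK f) -(stable_reprK g) -(stable_reprK h) !stable_compE.
congr stable; exact: linear_ext.
Qed.

Lemma stable_compDl (X Y Z : lmodType R) (g g' : stable_hom Y Z) (f : stable_hom X Y) :
  stable_comp (g + g') f = stable_comp g f + stable_comp g' f.
Proof.
rewrite -(stable_reprK f) -(stable_reprK g) -(stable_reprK g') -stableD !stable_compE.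
rewrite -stableD; congr stable; exact: linear_ext.
Qed.

Lemma stable_compDr (X Y Z : lmodType R) (g : stable_hom Y Z) (f f' : stable_hom X Y) :
  stable_comp g (f + f') = stable_comp g f + stable_comp g f'.
Proof.
rewrite -(stable_reprK f) -(stable_reprK g) -(stable_reprK f') -stableD !stable_compE.
rewrite -stableD; congr stable; apply: linear_ext => x /=; exact: linearD.
Qed.

(* A chosen conflation 0 -> X -> P -> Y -> 0 with P projective; the suspension *)
(* of X is Y. *)
Record suspension (X : gproj R) := Suspension {
  susp_proj : lmodType R;
  susp_obj : gproj R;
  susp_in : {linear X -> susp_proj};
  susp_out : {linear susp_proj -> susp_obj};
  susp_projP : projective susp_proj;
  susp_exact : short_exact susp_in susp_out
}.

Arguments susp_in {X} s.
Arguments susp_out {X} s.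
Arguments susp_exact {X} s.
Arguments susp_projP {X} s _ _ _ _ _.

Lemma suspension_exists (X : gproj R) : exists s : suspension X, True.
Proof.
have [P [Y [i [p [prP gY ex]]]]] := gorenstein_projective_embed (gprojP X).
by exists (@Suspension X P (GProj gY) i p prP ex).
Qed.

Definition susp (X : gproj R) : suspension X := sval (cid (suspension_exists X)).
Definition Sigma (X : gproj R) : gproj R := susp_obj (susp X).

(* g : Sigma X -> Sigma Y is induced by f : X -> Y *)
Definition induced (X Y : gproj R) (f : {linear X -> Y}) (g : {linear Sigma X -> Sigma Y}) :
    Prop :=
  exists F : {linear susp_proj (susp X) -> susp_proj (susp Y)},
    (forall x, F (susp_in (susp X) x) = susp_in (susp Y) (f x)) /\
    (forall x, g (susp_out (susp X) x) = susp_out (susp Y) (F x)).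

Lemma short_exact_descend (A B C D : lmodType R) (i : {linear A -> B})
    (p : {linear B -> C}) (f : {linear B -> D}) :
  short_exact i p -> (forall x, f (i x) = 0) ->
  exists g : {linear C -> D}, forall x, g (p x) = f x.
Proof.
move=> [_ ex p_surj] fi.
have uniq x x' : p x = p x' -> f x = f x'.
  move=> /eqP; rewrite -subr_eq0 -linearB => /eqP/ex[a ia]; apply/eqP.
  by rewrite -subr_eq0 -linearB -ia fi.
have [|||g gE] := @lin_relP R C D (fun y z => exists2 x, p x = y & f x = z).
- by move=> y; have [x px] := p_surj y; exists (f x), x.
- by move=> y z z' [x <- <-] [x' /uniq -> <-].
- by move=> r y y' z z' [x <- <-] [x' <- <-]; exists (r *: x + x'); rewrite linearP.
by exists g => x; have [x' /uniq -> <-] := gE (p x).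
Qed.

Lemma induced_exists (X Y : gproj R) (f : {linear X -> Y}) : exists g, induced f g.
Proof.
have [F FE] := gorenstein_projective_extend (lin_comp (susp_in (susp Y)) f)
  (susp_exact (susp X)) (gprojP _) (susp_projP (susp Y)).
have [|g gE] := short_exact_descend (f := lin_comp (susp_out (susp Y)) F)
  (susp_exact (susp X)).
  move=> x; rewrite /= FE; have [_ ex _] := susp_exact (susp Y).
  by apply/ex; exists (f x).
by exists g, F; split=> x; [rewrite FE | rewrite gE].
Qed.

Lemma induced_null (X Y : gproj R) (f : {linear X -> Y}) g :
  induced f g -> factors_through_projective f -> factors_through_projective g.
Proof.
move=> [F [FE gE]] [Q [a [b [prQ fE]]]].
have exX := susp_exact (susp X); have [_ exY _] := susp_exact (susp Y).
have [A AE] := gorenstein_projective_extend a exX (gprojP _) prQ.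
pose B : {linear susp_proj (susp X) -> susp_proj (susp Y)} :=
  lin_comp (susp_in (susp Y)) (lin_comp b A).
have [|t tE] := short_exact_descend (f := F - B) exX.
  by move=> x; rewrite lin_subE FE /= AE fE subrr.
exists (susp_proj (susp Y)), t, (susp_out (susp Y)); split; first exact: susp_projP.
apply: linear_ext => y; have [_ _ /(_ y)[x <-]] := exX.
rewrite gE /= tE lin_subE linearB; apply/eqP; rewrite eq_sym subr_eq addrC.
rewrite -subr_eq subrr eq_sym; apply/eqP/exY; by exists (b (A x)).
Qed.

Definition stable_shift (X Y : gproj R) (f : stable_hom X Y) :
    stable_hom (Sigma X) (Sigma Y) :=
  stable (sval (cid (induced_exists (stable_repr f)))).

Lemma induced_id (X : gproj R) : induced (lin_id X) (lin_id (Sigma X)).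
Proof. by exists (lin_id _). Qed.

Lemma induced_comp (X Y Z : gproj R) (f : {linear X -> Y}) (f' : {linear Y -> Z}) g g' :
  induced f g -> induced f' g' -> induced (lin_comp f' f) (lin_comp g' g).
Proof.
move=> [F [FE gE]] [F' [FE' gE']]; exists (lin_comp F' F).
by split=> x /=; [rewrite FE FE' | rewrite gE gE'].
Qed.

Lemma induced_add (X Y : gproj R) (f f' : {linear X -> Y}) g g' :
  induced f g -> induced f' g' -> induced (f + f') (g + g').
Proof.
move=> [F [FE gE]] [F' [FE' gE']]; exists (F + F').
by split=> x; rewrite !lin_addE linearD ?FE ?FE' ?gE ?gE'.
Qed.

Lemma induced_opp (X Y : gproj R) (f : {linear X -> Y}) g :
  induced f g -> induced (- f) (- g).
Proof.
move=> [F [FE gE]]; exists (- F).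
by split=> x; rewrite -[LHS]/(- _) ?FE ?gE -linearN.
Qed.

Lemma stable_shiftE (X Y : gproj R) (f : {linear X -> Y}) g :
  induced f g -> stable_shift (stable f) = stable g.
Proof.
move=> fg; rewrite /stable_shift; case: cid => /= g' fg'; apply/stable_eqP.
apply: induced_null (induced_add fg' (induced_opp fg)) _.
by apply/stable_eqP; exact: stable_reprK.
Qed.

Lemma stable_shift1 (X : gproj R) : stable_shift (stable_id X) = stable_id (Sigma X).
Proof. exact: stable_shiftE (induced_id X). Qed.

Lemma stable_shiftM (X Y Z : gproj R) (g : stable_hom Y Z) (f : stable_hom X Y) :
  stable_shift (stable_comp g f) = stable_comp (stable_shift g) (stable_shift f).
Proof.
rewrite -(stable_reprK f) -(stable_reprK g) stable_compE.
have [f' ff'] := induced_exists (stable_repr f).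
have [g' gg'] := induced_exists (stable_repr g).
by rewrite (stable_shiftE ff') (stable_shiftE gg') (stable_shiftE (induced_comp ff' gg'))
  stable_compE.
Qed.

Lemma stable_shiftD (X Y : gproj R) (f g : stable_hom X Y) :
  stable_shift (f + g) = stable_shift f + stable_shift g.
Proof.
rewrite -(stable_reprK f) -(stable_reprK g) -stableD.
have [f' ff'] := induced_exists (stable_repr f).
have [g' gg'] := induced_exists (stable_repr g).
by rewrite (stable_shiftE ff') (stable_shiftE gg') (stable_shiftE (induced_add ff' gg'))
  stableD.
Qed.

(* The triangle of a conflation 0 -> X -> Y -> Z -> 0: the last morphism is *)
(* induced on cokernels by an extension F of X -> P along X -> Y, where *)
(* 0 -> X -> P -> Sigma X -> 0 is the chosen conflation. *)
Definition standard_triangle (X Y Z : gproj R) (u : stable_hom X Y) (v : stable_hom Y Z)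
    (w : stable_hom Z (Sigma X)) : Prop :=
  exists (i : {linear X -> Y}) (p : {linear Y -> Z})
         (F : {linear Y -> susp_proj (susp X)}) (e : {linear Z -> Sigma X}),
    [/\ short_exact i p, forall x, F (i x) = susp_in (susp X) x
      & forall y, e (p y) = susp_out (susp X) (F y)] /\
    [/\ u = stable i, v = stable p & w = stable e].

Definition stable_triangle (X Y Z : gproj R) (u : stable_hom X Y) (v : stable_hom Y Z)
    (w : stable_hom Z (Sigma X)) : Prop :=
  exists (X' Y' Z' : gproj R) (u' : stable_hom X' Y') (v' : stable_hom Y' Z')
         (w' : stable_hom Z' (Sigma X'))
         (a : stable_hom X X') (b : stable_hom Y Y') (c : stable_hom Z Z'),
    [/\ standard_triangle u' v' w', stable_iso a, stable_iso b & stable_iso c] /\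
    [/\ stable_comp b u = stable_comp u' a, stable_comp c v = stable_comp v' b
      & stable_comp (stable_shift a) w = stable_comp w' c].

End StableCategory.

Definition stable_GProj (R : pzRingType) : triangulated_data :=
  @TriangulatedData (gproj R) (fun X Y => stable_hom X Y)
    (fun X => stable_id X) (fun X Y Z => @stable_comp R X Y Z)
    (fun X Y => @stable_comp1m R X Y) (fun X Y => @stable_compm1 R X Y)
    (fun X Y Z W => @stable_compA R X Y Z W)
    (fun X Y Z => @stable_compDl R X Y Z) (fun X Y Z => @stable_compDr R X Y Z)
    (@Sigma R) (@stable_shift R) (@stable_shift1 R) (@stable_shiftM R) (@stable_shiftD R)
    (@stable_triangle R).

(* Main.v *)
(* Generation.  Let C run over the finitely generated Gorenstein-projective modules, and
   let P ->> T be a surjection from a projective module onto a Gorenstein-projective one.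
   Attaching cells C >-> Q (Q projective) along all pairs of compatible maps C -> Y,
   C -> P over T, countably often and starting from Y = 0, yields L -> T such that every
   map C -> E into E = L x_T P factors through a projective module.  Now E is
   Gorenstein-projective, and such a module is projective: n-th syzygies of cyclic modules
   are finitely generated Gorenstein-projective for n large (by duality with right
   modules), so Ext^(n+1)(R/I, E) = 0 for every left ideal I, the n-th cosyzygy of E in an
   injective resolution is injective by Baer's criterion, hence Ext^1 from any
   Gorenstein-projective module to E vanishes.  With K the kernel of P ->> T, the conflation
   K >-> E ->> L puts K into the localizing subcategory generated by the C; take K = X,
   T = Sigma X.

   Compact objects.  For T = X the map L -> X has a stable section.  If X is compact, the
   section factors through a finite stage of the tower, and then (Neeman's argument, by
   induction on the stage: pass to the fibre over a finite part of the cells and push out)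
   through a finitely generated Gorenstein-projective module, so X is a direct summand of
   it. *)
From HB Require Import structures.
Require Import Defs.
From mathcomp Require Import all_boot all_algebra.
From mathcomp Require Import boolp classical_sets cardinality fsbigop.

Set Implicit Arguments.
Unset Strict Implicit.
Unset Printing Implicit Defensive.

Import GRing.Theory.
Local Open Scope ring_scope.

(** * Linear maps and extensions *)


(** Ext is used only through its vanishing: Ext^1 is an extension property of maps, and higher Ext
    is reached by shifting along syzygies and cosyzygies. Triangles, too, are handled as conflations
    of modules: subcategories are given as closed under cones and shifts, and rotation is done by
    adding a projective summand. Complexes indexed by all integers are hard to modify, so the
    closure properties of Gorenstein-projective modules come from a coinduction principle: a class
    that contains syzygies and cosyzygies of its members and has no Ext^1 into projectives consists
    of such modules. Countably many attachments suffice because a map from a finitely generated C to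
    L lands in a finite stage and is made null by the cells attached next. That L is
    Gorenstein-projective is not automatic, being a cokernel; it rests on solving an extension
    problem stage by stage. The number n bounds the injective coresolution of R as a left module.
    The injective dimension on the right enters through duality: it makes a finitely generated C
    with Ext^i(C, R) = 0 for i >= 1 embed in a free module. *)

Section Linear.
Variable R : pzRingType.
Implicit Types (A B C D E K M N P Q X Y Z U V W : lmodType R).

Definition lin_of U V (f : U -> V) (hf : linear f) : {linear U -> V} :=
  HB.pack f (GRing.isLinear.Build R U V _ f hf).

Fact fst_linear U V : linear (fst : (U * V)%type -> U).
Proof. by []. Qed.
Definition lin_fst U V : {linear (U * V)%type -> U} := lin_of (@fst_linear U V).

Fact snd_linear U V : linear (snd : (U * V)%type -> V).
Proof. by []. Qed.
Definition lin_snd U V : {linear (U * V)%type -> V} := lin_of (@snd_linear U V).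

Fact pair_linear U V W (f : {linear W -> U}) (g : {linear W -> V}) :
  linear (fun x => (f x, g x) : (U * V)%type).
Proof. by move=> a x y; rewrite !linearP. Qed.
Definition lin_pair U V W (f : {linear W -> U}) (g : {linear W -> V}) :
  {linear W -> (U * V)%type} := lin_of (pair_linear f g).

Fact copair_linear U V W (f : {linear U -> W}) (g : {linear V -> W}) :
  linear (fun x : (U * V)%type => f x.1 + g x.2).
Proof. by move=> a x y; rewrite !linearP /= scalerDr addrACA. Qed.
Definition lin_copair U V W (f : {linear U -> W}) (g : {linear V -> W}) :
  {linear (U * V)%type -> W} := lin_of (copair_linear f g).

Definition lin_inl U V : {linear U -> (U * V)%type} := lin_pair (lin_id U) lin_zero.
Definition lin_inr U V : {linear V -> (U * V)%type} := lin_pair lin_zero (lin_id V).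

Fact scale_by_linear M (m : M) : linear (fun x : R^o => (x : R) *: m).
Proof. by move=> a x y; rewrite scalerDl -scalerA. Qed.
Definition lin_scale_by M (m : M) : {linear R^o -> M} := lin_of (scale_by_linear m).

Lemma inj0P A B (f : {linear A -> B}) : injective f <-> (forall x, f x = 0 -> x = 0).
Proof.
split=> [fi x fx|h x y /eqP]; first by apply: fi; rewrite fx linear0.
by rewrite -subr_eq0 -linearB => /eqP/h/eqP; rewrite subr_eq0 => /eqP.
Qed.

Lemma factor_inj A B X (i : {linear A -> B}) (f : {linear X -> B}) :
  injective i -> (forall x, exists a, i a = f x) ->
  exists g : {linear X -> A}, forall x, i (g x) = f x.
Proof.
move=> ii ex; have [|||g gE] := @lin_relP R X A (fun x a => i a = f x); first exact: ex.
- by move=> x y y' <- /ii.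
- by move=> a x x' y y' e e'; rewrite !linearP e e'.
by exists g.
Qed.

Lemma quotient_exists M (U : M -> Prop) :
  U 0 -> (forall a x y, U x -> U y -> U (a *: x + y)) ->
  exists (C : lmodType R) (q : {linear M -> C}),
    surjective q /\ forall x, q x = 0 <-> U x.
Proof.
move=> U0 UP.
pose S : {pred M} := fun x => `[< U x >].
have Sz : zmod_closed S.
  split=> [|x y /asboolP Ux /asboolP Uy]; apply/asboolP => //.
  by rewrite addrC -scaleN1r; apply: UP.
pose SS : zmodClosed M := HB.pack S (GRing.isZmodClosed.Build M S Sz).
pose T : zmodType := Quotient.quot SS.
pose pi : M -> T := (\pi_(Quotient.quot SS))%qT.
have piB : {morph pi : x y / x - y} by exact: raddfB.
have piD : {morph pi : x y / x + y} by exact: raddfD.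
have piE x y : pi x = pi y <-> U (x - y).
  have E := Quotient.idealrBE SS x y.
  split=> [/eqP h|h].
    have : (x == y %[mod Quotient.quot SS])%qT by [].
    by rewrite -E => /asboolP.
  by apply/eqP; rewrite /pi -E; apply/asboolP.
have reprK (x : T) : pi (repr x) = x by rewrite /pi reprK.
have UZ a x : U x -> U (a *: x) by move=> Ux; rewrite -[_ *: _]addr0; apply: UP.
(* The quotient is one of additive groups; scalars act through representatives, and [scE] shows that
   their choice is immaterial. *)
pose sc (a : R) (x : T) : T := pi (a *: repr x).
have scE a x : sc a (pi x) = pi (a *: x).
  by apply/piE; rewrite -scalerBr; apply/UZ/piE.
have scA a b v : sc a (sc b v) = sc (a * b) v.
  by rewrite -(reprK v) !scE scalerA.
have sc1 : left_id 1 sc by move=> v; rewrite -(reprK v) scE scale1r.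
have scDr : right_distributive sc +%R.
  by move=> a u v; rewrite -(reprK u) -(reprK v) -piD !scE -piD scalerDr.
have scDl v : {morph sc^~ v : a b / a + b}.
  by move=> a b; rewrite -(reprK v) !scE -piD scalerDl.
pose C : lmodType R := HB.pack T (GRing.Zmodule_isLmodule.Build R T scA sc1 scDr scDl).
have pil : linear (pi : M -> C) by move=> a x y; rewrite piD -scE.
exists C, (lin_of pil); split=> [y|x]; first by exists (repr (y : T)); apply: reprK.
have pi0 : pi 0 = 0 by have := piB 0 0; rewrite !subrr.
by rewrite -[_ = _]/(pi x = 0) -pi0 piE subr0.
Qed.

Lemma coker_exists A B (i : {linear A -> B}) : injective i ->
  exists (C : lmodType R) (p : {linear B -> C}), short_exact i p.
Proof.
move=> ii; have [||C [q [qs qE]]] := @quotient_exists B (fun y => exists x, i x = y).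
- by exists 0; rewrite linear0.
- by move=> a x y [u <-] [v <-]; exists (a *: u + v); rewrite linearP.
by exists C, q.
Qed.

Lemma ker_ses A B (f : {linear A -> B}) : surjective f -> short_exact (ker_incl f) f.
Proof. by split=> //; [apply: val_inj | move=> y; apply: ker_inclP]. Qed.

Lemma ses_comp A B C (i : {linear A -> B}) (p : {linear B -> C}) x :
  short_exact i p -> p (i x) = 0.
Proof. by case=> _ ex _; apply/ex; exists x. Qed.

Lemma id_ses A : short_exact (lin_id A) (@lin_zero R A 'rV[R]_0).
Proof.
split=> // [y|y]; first by split=> // _; exists y.
by exists 0; apply/rowP; case.
Qed.

Lemma zero_ses A : short_exact (@lin_zero R 'rV[R]_0 A) (lin_id A).
Proof.
split=> [x y _|y|y]; first by apply/rowP; case.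
  by split=> [/= ->|[x <-] //]; exists 0.
by exists y.
Qed.

Lemma prod_ses A B : short_exact (lin_inl A B) (lin_snd A B).
Proof.
split=> [x y [] //|[a b]|b]; last by exists (0, b).
by split=> [/= ->|[x [_ <-]] //]; exists a.
Qed.

(** This is Ext^1(N, M) = 0: pushing the sequence out along [f] gives an extension of [N] by [M],
    and extending [f] to [B] amounts to splitting it. *)
Definition ext1 N M : Prop :=
  forall A B (i : {linear A -> B}) (p : {linear B -> N}) (f : {linear A -> M}),
    short_exact i p -> exists g : {linear B -> M}, forall x, g (i x) = f x.

Lemma ext1_injective N M : injective_module M -> ext1 N M.
Proof. by move=> iM A B i p f [ii _ _]; apply: iM. Qed.

(** One projective presentation suffices. Lift [p] to [l : P -> B]; then B = i(A) + l(P), and [f]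
    extends by i a + l x |-> f a + g x, where [g] extends [f] composed with [t : K -> A], the
    restriction of [l]. *)
Lemma ext1_ses K P N M (k : {linear K -> P}) (p : {linear P -> N}) :
  short_exact k p -> projective P ->
  (forall f : {linear K -> M}, exists g : {linear P -> M}, forall x, g (k x) = f x) ->
  ext1 N M.
Proof.
move=> [ki kex ps] prP ext A B i q f [ii iex qs].
have [l lE] := prP _ _ q p qs.
have [t tE] : exists t : {linear K -> A}, forall x, i (t x) = l (k x).
  apply: (@factor_inj _ _ _ i (lin_comp l k) ii) => x; apply/iex.
  by rewrite /= lE; apply/kex; exists x.
have [g gE] := ext (lin_comp f t).
have wd a a' x x' : i a + l x = i a' + l x' -> f a + g x = f a' + g x'.
  move=> /addD_subD e; apply: subD_addD; rewrite -!linearB.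
  have : p (x' - x) = 0 by rewrite -lE linearB e -linearB; apply/iex; eexists.
  move=> /kex[y yE]; rewrite -yE gE /=; congr (f _); apply: ii.
  by rewrite tE yE !linearB e.
have [|||h hE] := @lin_relP R B M (fun b m => exists a x, b = i a + l x /\ m = f a + g x).
- move=> b; have [x px] := ps (q b).
  have /iex[a ia] : q (b - l x) = 0 by rewrite linearB lE px subrr.
  by exists (f a + g x), a, x; rewrite ia subrK.
- by move=> b m m' [a [x [-> ->]]] [a' [x' [/wd -> ->]]].
- move=> c b b' m m' [a [x [-> ->]]] [a' [x' [-> ->]]].
  exists (c *: a + a'), (c *: x + x').
  by rewrite !linearP; split; rewrite scalerDr addrACA.
exists h => x; have [a [y [e ->]]] := hE (i x).
by rewrite -(wd x a 0 y) ?linear0 ?addr0 // -e.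
Qed.

(** The pullback of [q] along [g] is realised as the kernel of g - q on K + E; its projection to [K]
    has the same kernel [M] as [q]. *)
Lemma pullback_ses K M E Z (g : {linear K -> Z}) (j : {linear M -> E}) (q : {linear E -> Z}) :
  short_exact j q -> let d := lin_copair g (- q) in
  exists (i : {linear M -> ker_mod d}) (r : {linear ker_mod d -> K}),
    [/\ short_exact i r, forall x, ker_incl d (i x) = (0, j x)
      , forall x, r x = (ker_incl d x).1 & forall x, g (r x) = q (ker_incl d x).2].
Proof.
move=> ses_jq d; have [ji jex qs] := ses_jq; have dE x : d x = g x.1 - q x.2 by [].
have d0 x : d (ker_incl d x) = 0 by apply/ker_inclP; exists x.
have [|i iE] := @factor_inj _ _ M (ker_incl d) (lin_comp (lin_inr K E) j) val_inj.
  by move=> x; apply/ker_inclP; rewrite dE /= linear0 (ses_comp _ ses_jq) subrr.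
exists i, (lin_comp (lin_fst K E) (ker_incl d)); split=> // [|x]; last first.
  by apply/eqP; rewrite -subr_eq0 -dE d0.
split=> [x y e|y|y].
- by have := congr1 (ker_incl d) e; rewrite !iE => -[/ji].
- split=> [/= y0|[x <-]]; last by rewrite -[LHS]/((ker_incl d (i x)).1) iE.
  have := d0 y; rewrite dE /= y0 linear0 sub0r => /eqP; rewrite oppr_eq0 => /eqP/jex[x xE].
  by exists x; apply: val_inj; rewrite -[LHS]/(ker_incl d _) iE /= xE -y0; case: (val y).
- have [e eE] := qs (g y).
  have /ker_inclP[z zE] : d (y, e) = 0 by rewrite dE /= eE subrr.
  by exists z; rewrite /= -[val z]/(ker_incl d z) zE.
Qed.

Section DimensionShift.
Variables (K P N M E Z : lmodType R).
Variables (k : {linear K -> P}) (p : {linear P -> N}).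
Variables (j : {linear M -> E}) (q : {linear E -> Z}).
Hypotheses (ses_kp : short_exact k p) (prP : projective P) (ses_jq : short_exact j q).

(** As Ext^1(K, E) = 0, it suffices that every K -> Z lifts to [E]: it extends to [P] because
    Ext^1(N, Z) = 0, and from the projective [P] it lifts along [q]. *)
Lemma ext1_shift_syzygy : ext1 K E -> ext1 N Z -> ext1 K M.
Proof.
move=> extE extZ A B i r f ses_ir; have [ji jex qs] := ses_jq.
have [F FE] := extE _ _ i r (lin_comp j f) ses_ir.
have [|u uE] := short_exact_descend (f := lin_comp q F) ses_ir.
  by move=> x /=; rewrite FE /= (ses_comp _ ses_jq).
have [v vE] := extZ _ _ k p u ses_kp.
have [t tE] := prP v qs.
have [|g gE] := @factor_inj _ _ _ j (F - lin_comp t (lin_comp k r)) ji.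
  move=> b; apply/jex; rewrite lin_subE linearB /= tE vE uE.
  by rewrite -[X in X - _]/(lin_comp q F b) subrr.
exists g => x; apply: ji; rewrite gE lin_subE /= FE /=.
by rewrite (ses_comp _ ses_ir) !linear0 addr0.
Qed.

(** A map [g : K -> Z] lifts to [E] because the pullback along it, an extension of [K] by [M],
    splits; the lift extends to [P] because Ext^1(N, E) = 0. *)
Lemma ext1_shift_cosyzygy : ext1 N E -> ext1 K M -> ext1 N Z.
Proof.
move=> extE extM; apply: (ext1_ses ses_kp prP) => g.
pose d := lin_copair g (- q).
have [i [r [ses_ir iE rE grE]]] := pullback_ses g ses_jq.
have [s sE] := extM _ _ i r (lin_id M) ses_ir.
have [|t tE] := short_exact_descend
    (f := lin_comp (lin_snd K E) (ker_incl d) - lin_comp j s) ses_ir.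
  by move=> x; rewrite lin_subE /= sE /= -[val _]/(ker_incl d _) iE subrr.
have [u uE] := extE _ _ k p t ses_kp.
exists (lin_comp q u) => x /=; rewrite uE; have [_ _ /(_ x)[y <-]] := ses_ir.
by rewrite tE lin_subE linearB (ses_comp _ ses_jq) subr0 grE.
Qed.

End DimensionShift.

(** [V] is the quotient of Y + B by all (- f x, i x). The clause that [a] and [b] are jointly onto
    stands for uniqueness in the universal property. *)
Lemma pushout A B D Y (i : {linear A -> B}) (p : {linear B -> D}) (f : {linear A -> Y}) :
  short_exact i p ->
  exists (V : lmodType R) (a : {linear Y -> V}) (b : {linear B -> V}) (q : {linear V -> D}),
    [/\ short_exact a q, forall x, b (i x) = a (f x), forall x, q (b x) = p x
      , forall v, exists y x, v = a y + b x
      & forall Z (u : {linear Y -> Z}) (v : {linear B -> Z}),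
          (forall x, v (i x) = u (f x)) ->
          exists t : {linear V -> Z}, (forall y, t (a y) = u y) /\ forall x, t (b x) = v x].
Proof.
move=> ses; have [ii ex ps] := ses.
pose m : {linear A -> (Y * B)%type} := lin_pair (- f) i.
have mE x : m x = (- f x, i x) by [].
have mi : injective m by move=> x y [_ /ii].
have [V [c cses]] := coker_exists mi; have [_ cex cs] := cses.
exists V, (lin_comp c (lin_inl Y B)), (lin_comp c (lin_inr Y B)).
have cE y x : c (y, x) = c (y, 0) + c (0, x).
  by rewrite -linearD; congr (c _); congr (_, _); rewrite /= ?addr0 ?add0r.
have [|q qE] := short_exact_descend (f := lin_comp p (lin_snd Y B)) cses.
  by move=> x; rewrite /= (ses_comp _ ses).
exists q; split.
- split=> [y y' /= e|v|d].
  + have /cex[x [e1 e2]] : c (y - y', 0) = 0.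
      have -> : (y - y', 0) = (y, 0) - (y', 0) :> (Y * B)%type by congr (_, _); rewrite /= subrr.
      by rewrite linearB; apply/eqP; rewrite subr_eq0; apply/eqP.
    move: e1; have -> : x = 0 by apply: ii; rewrite e2 linear0.
    by rewrite !linear0 => /esym/eqP; rewrite subr_eq0 => /eqP.
  + have [[y x] <-] := cs v; rewrite qE /=; split=> [/ex[z <-]|[z]].
      exists (y + f z) => /=; apply/eqP; rewrite -subr_eq0 -linearB; apply/eqP/cex.
      exists (- z); rewrite mE !linearN opprK; congr (_, _); rewrite /= ?sub0r //.
      by rewrite addrAC subrr add0r.
    by move=> /(congr1 q); rewrite /= !qE /= linear0.
  + by have [x <-] := ps d; exists (c (0, x)); rewrite qE.
- move=> x /=; apply/eqP; rewrite eq_sym -subr_eq0 -linearB; apply/eqP/cex.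
  by exists (- x); rewrite mE !linearN opprK; congr (_, _); rewrite /= ?subr0 ?sub0r.
- by move=> x /=; rewrite qE.
- by move=> v; have [[y x] <-] := cs v; exists y, x; rewrite cE.
- move=> Z u v e; have [|t tE] := short_exact_descend (f := lin_copair u v) cses.
    by move=> x; rewrite mE /= e linearN addNr.
  by exists t; split=> x; rewrite tE /= linear0 ?addr0 ?add0r.
Qed.

(** The module E / A contains B / A, with quotient E / B. *)
Lemma ses_third A B C E Z (i : {linear A -> B}) (p : {linear B -> C})
    (e : {linear B -> E}) (q : {linear E -> Z}) :
  short_exact i p -> short_exact e q ->
  exists W (c : {linear E -> W}) (a : {linear C -> W}) (b : {linear W -> Z}),
    short_exact (lin_comp e i) c /\ short_exact a b.
Proof.
move=> ses1 ses2; have [ii iex ps] := ses1; have [ei eex qs] := ses2.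
have ji : injective (lin_comp e i) by move=> x y /= /ei /ii.
have [W [c cses]] := coker_exists ji; have [_ cex cs] := cses.
have [|a aE] := short_exact_descend (f := lin_comp c e) ses1.
  by move=> x; exact: ses_comp cses.
have [|b bE] := short_exact_descend (f := q) cses.
  by move=> x; exact: (ses_comp _ ses2).
exists W, c, a, b; split=> //; split=> [|w|z].
- apply/inj0P => z; have [y <-] := ps z; rewrite aE => /cex[x /ei <-].
  exact: ses_comp ses1.
- have [x <-] := cs w; rewrite bE; split=> [/eex[y <-]|[z]]; first by exists (p y); rewrite aE.
  have [y <-] := ps z; rewrite aE => /(congr1 b); rewrite /= !bE => <-.
  exact: ses_comp ses2.
- by have [x <-] := qs z; exists (c x); rewrite bE.
Qed.

(** The extension [F] of [s] is an argument because it has two sources: injectivity of [U], or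
    Ext^1(C, U) = 0 for a Gorenstein-projective [C] and a projective [U]. *)
Lemma horseshoe_embed A B C U V Z1 Z2 (i : {linear A -> B}) (q : {linear B -> C})
    (s : {linear A -> U}) (r : {linear U -> Z1}) (u : {linear C -> V}) (v : {linear V -> Z2})
    (F : {linear B -> U}) :
  short_exact i q -> short_exact s r -> short_exact u v -> (forall x, F (i x) = s x) ->
  exists (Z : lmodType R) (c : {linear (U * V)%type -> Z})
         (a : {linear Z1 -> Z}) (b : {linear Z -> Z2}),
    short_exact (lin_pair F (lin_comp u q)) c /\ short_exact a b.
Proof.
move=> ses1 ses2 ses3 FE; have [ii iex qs] := ses1.
have [si sex rs] := ses2; have [ui uex vs] := ses3.
pose m := lin_pair F (lin_comp u q).
have mi : injective m.
  apply/inj0P => x [/= Fx]; rewrite -[0](linear0 u) => /ui/iex[y yx].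
  by move: Fx; rewrite -yx FE -[0](linear0 s) => /si ->; rewrite linear0.
have [Z [c cses]] := coker_exists mi; have [_ cex cs] := cses.
have [|a aE] := short_exact_descend (f := lin_comp c (lin_inl U V)) ses2.
  move=> x /=; apply/cex; exists (i x); rewrite /= FE (ses_comp _ ses1).
  by rewrite linear0.
have [|b bE] := short_exact_descend (f := lin_comp v (lin_snd U V)) cses.
  by move=> x /=; rewrite (ses_comp _ ses3).
exists Z, c, a, b; split=> //; split.
- apply/inj0P => z; have [x <-] := rs z; rewrite aE /= => /cex[y [/= yx]].
  rewrite -[0](linear0 u) => /ui/iex[w wy].
  by rewrite -yx -wy FE (ses_comp _ ses2).
- move=> z; have [[x y] <-] := cs z; rewrite bE /=; split=> [/uex[w wy]|[t]].
    have [w' ww'] := qs w; exists (r (x - F w')); rewrite aE /=.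
    apply/eqP; rewrite -subr_eq0 -linearB; apply/eqP/cex; exists (- w').
    rewrite /= !linearN ww' wy; congr (_, _) => /=; last by rewrite sub0r.
    by rewrite addrAC subrr add0r.
  have [x' <-] := rs t; rewrite aE => /(congr1 b); rewrite !bE /=.
  by rewrite linear0 => /esym.
- by move=> z; have [y <-] := vs z; exists (c (0, y)); rewrite bE.
Qed.

End Linear.

(** * Direct sums, free modules, finite generation *)


Lemma fsumE (I : Type) (V : zmodType) (f : I -> V) (s : seq {classic I}) :
  uniq s -> (forall i : {classic I}, i \notin s -> f i = 0) ->
  \sum_(i \in [set: {classic I}]) f i = \sum_(i <- s) f i.
Proof.
move=> us f0; rewrite (@fsbigE _ _ _ _ _ s) //; last by move=> i _; exact: f0.
by apply: eq_bigl => i; rewrite in_setT.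
Qed.

Lemma dependent_choice (I : Type) (T : I -> Type) (P : forall i, T i -> Prop) :
  (forall i, exists y, P i y) -> exists f : forall i, T i, forall i, P i (f i).
Proof. by move=> ex; exists (fun i => sval (cid (ex i))) => i; case: cid. Qed.

Section DirectSum.
Variables (R : pzRingType) (I : small) (X : I -> lmodType R).
Implicit Types (W Z : lmodType R).

(** The list contains the support and may be larger; [{classic I}] makes membership decidable. *)
Definition finite_family (f : forall i, X i) : Prop :=
  exists s : seq {classic I}, forall i : {classic I}, i \notin s -> f i = 0.

Definition dsum_carrier := {f : forall i, X i | finite_family f}.

Lemma dsum_carrier_ext (f g : dsum_carrier) : (forall i, sval f i = sval g i) -> f = g.
Proof.
case: f g => [f ff] [g fg] /= fgE.
have E : f = g by exact: functional_extensionality_dep.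
by move: ff fg; rewrite E => ff fg; rewrite (Prop_irrelevance ff fg).
Qed.

Fact dsum_zero_subproof : finite_family (fun i => 0 : X i).
Proof. by exists [::]. Qed.
Definition dsum_zero : dsum_carrier := exist _ _ dsum_zero_subproof.

Fact dsum_add_subproof (f g : dsum_carrier) : finite_family (fun i => sval f i + sval g i).
Proof.
have [s sP] := svalP f; have [t tP] := svalP g; exists (s ++ t) => i.
by rewrite mem_cat negb_or => /andP[/sP -> /tP ->]; rewrite addr0.
Qed.
Definition dsum_add f g : dsum_carrier := exist _ _ (dsum_add_subproof f g).

Fact dsum_opp_subproof (f : dsum_carrier) : finite_family (fun i => - sval f i).
Proof. by have [s sP] := svalP f; exists s => i /sP ->; rewrite oppr0. Qed.
Definition dsum_opp f : dsum_carrier := exist _ _ (dsum_opp_subproof f).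

Fact dsum_scale_subproof a (f : dsum_carrier) : finite_family (fun i => a *: sval f i).
Proof. by have [s sP] := svalP f; exists s => i /sP ->; rewrite scaler0. Qed.
Definition dsum_scale a f : dsum_carrier := exist _ _ (dsum_scale_subproof a f).

Fact dsum_addA : associative dsum_add.
Proof. by move=> f g h; apply: dsum_carrier_ext => i /=; rewrite addrA. Qed.
Fact dsum_addC : commutative dsum_add.
Proof. by move=> f g; apply: dsum_carrier_ext => i /=; rewrite addrC. Qed.
Fact dsum_add0 : left_id dsum_zero dsum_add.
Proof. by move=> f; apply: dsum_carrier_ext => i /=; rewrite add0r. Qed.
Fact dsum_addN : left_inverse dsum_zero dsum_opp dsum_add.
Proof. by move=> f; apply: dsum_carrier_ext => i /=; rewrite addNr. Qed.

HB.instance Definition _ := gen_eqMixin dsum_carrier.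
HB.instance Definition _ := gen_choiceMixin dsum_carrier.
HB.instance Definition _ :=
  GRing.isZmodule.Build dsum_carrier dsum_addA dsum_addC dsum_add0 dsum_addN.

Fact dsum_scaleA a b v : dsum_scale a (dsum_scale b v) = dsum_scale (a * b) v.
Proof. by apply: dsum_carrier_ext => i /=; rewrite scalerA. Qed.
Fact dsum_scale1 : left_id 1 dsum_scale.
Proof. by move=> v; apply: dsum_carrier_ext => i /=; rewrite scale1r. Qed.
Fact dsum_scaleDr : right_distributive dsum_scale +%R.
Proof. by move=> a u v; apply: dsum_carrier_ext => i /=; rewrite scalerDr. Qed.
Fact dsum_scaleDl v : {morph dsum_scale^~ v : a b / a + b}.
Proof. by move=> a b; apply: dsum_carrier_ext => i /=; rewrite scalerDl. Qed.

HB.instance Definition _ := GRing.Zmodule_isLmodule.Build R dsum_carrier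
  dsum_scaleA dsum_scale1 dsum_scaleDr dsum_scaleDl.

Definition dsum : lmodType R := dsum_carrier.

Fact dproj_linear i : linear (fun f : dsum => sval (f : dsum_carrier) i).
Proof. by []. Qed.
Definition dproj i : {linear dsum -> X i} := lin_of (dproj_linear i).

Lemma dsum_ext (f g : dsum) : (forall i, dproj i f = dproj i g) -> f = g.
Proof. exact: dsum_carrier_ext. Qed.

Lemma dproj_support (f : dsum) :
  exists s : seq {classic I}, forall i : {classic I}, i \notin s -> dproj i f = 0.
Proof. exact: svalP f. Qed.

Lemma dsum_tuple W (h : forall i, {linear W -> X i}) :
  (forall w, exists s : seq {classic I}, forall i : {classic I}, i \notin s -> h i w = 0) ->
  exists g : {linear W -> dsum}, forall i w, dproj i (g w) = h i w.
Proof.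
move=> fin_h.
have [|||g gE] := @lin_relP R W dsum (fun w f => forall i, dproj i f = h i w).
- by move=> w; exists (exist finite_family (h^~ w) (fin_h w)).
- by move=> w f f' e e'; apply: dsum_ext => i; rewrite e e'.
- by move=> a w w' f f' e e' i; rewrite !linearP e e'.
by exists g => i w; exact: gE.
Qed.

Definition single (i : I) (x : X i) (j : I) : X j :=
  if pselect (i = j) is left e then ecast k (X k) e x else 0.

Fact single_finite (i : I) (x : X i) : finite_family (single x).
Proof.
exists [:: i : {classic I}] => j; rewrite inE => /eqP ij.
by rewrite /single; case: pselect => // e; case: ij.
Qed.

Fact dinj_linear (i : I) : linear (fun x : X i => exist _ _ (single_finite x) : dsum).
Proof.
move=> a x y; apply: dsum_carrier_ext => j /=; rewrite /single.
by case: pselect => [e|]; [case: _ / e | rewrite scaler0 addr0].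
Qed.
Definition dinj (i : I) : {linear X i -> dsum} := lin_of (@dinj_linear i).

Lemma dproj_dinj (i : I) (x : X i) : dproj i (dinj i x) = x.
Proof.
rewrite /= /single; case: pselect => // e; by rewrite (Prop_irrelevance e erefl).
Qed.

Lemma dproj_dinj_neq (i j : I) (x : X i) : i <> j -> dproj j (dinj i x) = 0.
Proof. by move=> ij; rewrite /= /single; case: pselect. Qed.

Lemma dsum_sum (f : dsum) (s : seq {classic I}) : uniq s ->
  (forall i : {classic I}, i \notin s -> dproj i f = 0) ->
  f = \sum_(i <- s) dinj i (dproj i f).
Proof.
move=> us f0; apply: dsum_ext => i; rewrite linear_sum.
have [si|/[dup] nsi /f0 ->] := boolP ((i : {classic I}) \in s).
  rewrite (bigD1_seq (i : {classic I})) //= big1 ?addr0 => [|j /eqP ji].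
    by rewrite -[RHS]/(dproj i (dinj i (dproj i f))) dproj_dinj.
  exact: dproj_dinj_neq.
rewrite big_seq big1 // => j sj; apply: dproj_dinj_neq => ji.
by move: nsi; rewrite -ji sj.
Qed.

Lemma dsum_decomp (f : dsum) :
  exists2 s : seq {classic I}, uniq s & f = \sum_(i <- s) dinj i (dproj i f).
Proof.
have [s sP] := dproj_support f; exists (undup s); first exact: undup_uniq.
by apply: dsum_sum => [|i]; rewrite ?undup_uniq ?mem_undup //; exact: sP.
Qed.

Lemma dsum_copair Z (g : forall i, {linear X i -> Z}) :
  exists h : {linear dsum -> Z}, forall i x, h (dinj i x) = g i x.
Proof.
pose h (f : dsum) := \sum_(i \in [set: {classic I}]) g i (dproj i f).
have hE (f : dsum) (s : seq {classic I}) : uniq s ->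
    (forall i : {classic I}, i \notin s -> dproj i f = 0) ->
    h f = \sum_(i <- s) g i (dproj i f).
  by move=> us f0; apply: fsumE => // i si; rewrite f0 ?linear0.
have h_lin : linear h.
  move=> a f f'; have [s sP] := dproj_support f; have [t tP] := dproj_support f'.
  have u : uniq (undup (s ++ t)) by exact: undup_uniq.
  have nin i : i \notin undup (s ++ t) -> dproj i f = 0 /\ dproj i f' = 0.
    by rewrite mem_undup mem_cat negb_or => /andP[/sP ? /tP ?].
  rewrite !(hE _ _ u) ?scaler_sumr -?big_split; first last.
  - by move=> i /nin[e e']; rewrite linearP e e' scaler0 addr0.
  - by move=> i /nin[].
  - by move=> i /nin[].
  by apply: eq_bigr => i _; rewrite !linearP.
exists (lin_of h_lin) => i x; rewrite -[LHS]/(h (dinj i x)).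
rewrite (hE _ [:: i : {classic I}]) // => [|j]; first by rewrite big_seq1 dproj_dinj.
by rewrite inE => /eqP ji; apply: dproj_dinj_neq => ij; apply: ji.
Qed.

Lemma dsum_lin_ext Z (f g : {linear dsum -> Z}) :
  (forall i x, f (dinj i x) = g (dinj i x)) -> forall x, f x = g x.
Proof.
move=> fg x; have [s _ ->] := dsum_decomp x; rewrite !linear_sum.
by apply: eq_bigr => i _; exact: fg.
Qed.

Lemma dsum_mask (P : I -> Prop) :
  exists m : {linear dsum -> dsum},
    (forall i x, P i -> dproj i (m x) = dproj i x) /\
    (forall i x, ~ P i -> dproj i (m x) = 0).
Proof.
have [|m mE] := @dsum_tuple dsum (fun i => if `[< P i >] then dproj i else lin_zero).
  move=> f; have [s sP] := dproj_support f; exists s => i /sP f0.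
  by case: ifP => // _; rewrite f0.
by exists m; split=> i x Pi; rewrite mE; case: asboolP.
Qed.

Lemma dsum_projective : (forall i, projective (X i)) -> projective dsum.
Proof.
move=> prX A B p f ps.
have [g gE] := dependent_choice (fun i => prX i _ _ p (lin_comp f (dinj i)) ps).
have [h hE] := dsum_copair g; exists h.
by apply: (@dsum_lin_ext _ (lin_comp p h) f) => i x /=; rewrite hE gE.
Qed.

End DirectSum.
Arguments dproj {R I X} i.
Arguments dinj {R I X} i.

Section DirectSumMap.
Variables (R : pzRingType) (I : small).
Implicit Types X Y Z : I -> lmodType R.

Lemma dsum_map X Y (f : forall i, {linear X i -> Y i}) :
  exists h : {linear dsum X -> dsum Y}, (forall i x, h (dinj i x) = dinj i (f i x)) /\
    forall i x, dproj i (h x) = f i (dproj i x).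
Proof.
have [h hE] := dsum_copair (fun i => lin_comp (dinj i) (f i)); exists h; split=> // i.
apply: (@dsum_lin_ext _ _ _ _ (lin_comp (dproj i) h) (lin_comp (f i) (dproj i))) => j x.
rewrite -[LHS]/(dproj i (h (dinj j x))) hE -[lin_comp _ _ x]/(dinj j (f j x)) -[RHS]/(f i (dproj i (dinj j x))).
have [ij|ji] := pselect (j = i); last by rewrite !dproj_dinj_neq ?linear0.
by move: x; case: _ / ij => x; rewrite !dproj_dinj.
Qed.

Lemma dsum_ses X Y Z (i : forall j, {linear X j -> Y j}) (p : forall j, {linear Y j -> Z j}) :
  (forall j, short_exact (i j) (p j)) ->
  exists (m : {linear dsum X -> dsum Y}) (q : {linear dsum Y -> dsum Z}),
    [/\ short_exact m q, forall j x, m (dinj j x) = dinj j (i j x)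
      , forall j x, q (dinj j x) = dinj j (p j x)
      , forall j x, dproj j (m x) = i j (dproj j x)
      & forall j x, dproj j (q x) = p j (dproj j x)].
Proof.
move=> ses; have [m [mi mp]] := dsum_map i; have [q [qi qp]] := dsum_map p.
exists m, q; split=> //; split.
- move=> x y e; apply: dsum_ext => j; have [ij _ _] := ses j.
  by apply: ij; rewrite -!mp e.
- move=> y; split=> [qy|[x <-]]; last first.
    by apply: dsum_ext => j; rewrite qp mp (ses_comp _ (ses j)) linear0.
  have /dependent_choice[x xE] : forall j, exists x, i j x = dproj j y.
    by move=> j; have [_ ex _] := ses j; apply/ex; rewrite -qp qy linear0.
  (* Injectivity of the [i j] makes the chosen preimages vanish wherever [y] does. *)
  have fx : finite_family x.
    have [s sP] := dproj_support y; exists s => j /sP y0.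
    by have [ij _ _] := ses j; apply: ij; rewrite xE y0 linear0.
  by exists (exist _ x fx : dsum X); apply: dsum_ext => j; rewrite mp -xE.
- move=> z; have [s us ->] := dsum_decomp z.
  have /dependent_choice[x xE] : forall j, exists x, p j x = dproj j z.
    by move=> j; have [_ _ ps] := ses j.
  exists (\sum_(j <- s) dinj j (x j)); rewrite linear_sum; apply: eq_bigr => j _.
  by rewrite qi xE.
Qed.

End DirectSumMap.

Section Free.
Variable R : pzRingType.
Implicit Types (A B C D E K M N P Q X Y Z U V W : lmodType R).

Definition free_mod (I : small) : lmodType R := dsum (fun _ : I => R^o : lmodType R).

Lemma free_mod_projective I : projective (free_mod I).
Proof. by apply: dsum_projective => i; exact: regular_projective. Qed.

Lemma free_mod_map I M (m : I -> M) :
  exists f : {linear free_mod I -> M}, forall i, f (dinj i (1 : R^o)) = m i.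
Proof.
have [f fE] := dsum_copair (fun i => lin_scale_by (m i)).
by exists f => i; rewrite fE /= scale1r.
Qed.

(** [small] is the universe of carriers, so [M] can index its own free cover. *)
Lemma projective_cover_exists M :
  exists (P : lmodType R) (p : {linear P -> M}), projective P /\ surjective p.
Proof.
exists (free_mod M); have [f fE] := @free_mod_map M M id; exists f.
by split; [exact: free_mod_projective | move=> m; exists (dinj m (1 : R^o)); rewrite fE].
Qed.

Lemma projective_retract_free P : projective P ->
  exists (I : small) (s : {linear P -> free_mod I}) (r : {linear free_mod I -> P}),
    forall x, r (s x) = x.
Proof.
move=> prP; have [f fE] := @free_mod_map P P id; exists P.
have [|s sE] := prP _ _ f (lin_id P).
  by move=> m; exists (dinj m (1 : R^o)); rewrite fE.
by exists s, f.
Qed.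

Definition row_map m M (e : 'I_m -> M) : {linear 'rV[R]_m -> M}.
Proof.
apply: (@lin_of R _ _ (fun v : 'rV[R]_m => \sum_j v 0 j *: e j)) => a u v.
rewrite scaler_sumr -big_split; apply: eq_bigr => j _.
by rewrite !mxE scalerDl scalerA.
Defined.

Lemma row_mapE m M (e : 'I_m -> M) v : row_map e v = \sum_j v 0 j *: e j.
Proof. by []. Qed.

Lemma row_map_delta m M (e : 'I_m -> M) j : row_map e (delta_mx 0 j) = e j.
Proof.
rewrite row_mapE (bigD1 j) //= big1 ?addr0 => [|i ij]; rewrite mxE !eqxx ?scale1r //.
by rewrite (negPf ij) scale0r.
Qed.

Lemma row_sum m (v : 'rV[R]_m) : v = \sum_j v 0 j *: delta_mx 0 j.
Proof.
apply/rowP => i; rewrite summxE (bigD1 i) //= big1 => [|j ji].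
  by rewrite !mxE !eqxx mulr1 addr0.
by rewrite !mxE eqxx eq_sym (negPf ji) mulr0.
Qed.

Lemma row_lin_ext m M (f g : {linear 'rV[R]_m -> M}) :
  (forall j, f (delta_mx 0 j) = g (delta_mx 0 j)) -> forall v, f v = g v.
Proof.
move=> fg v; rewrite [v]row_sum !linear_sum; apply: eq_bigr => j _.
by rewrite !linearZ /= fg.
Qed.

Lemma row_projective m : projective ('rV[R]_m : lmodType R).
Proof.
move=> A B p f ps; have [a aE] := choice (fun j => ps (f (delta_mx 0 j))).
exists (row_map a); apply: (@row_lin_ext _ _ (lin_comp p (row_map a)) f) => j.
by rewrite /= -[X in p X]/(row_map a _) row_map_delta aE.
Qed.

Lemma fin_gen_rowP M :
  fin_gen M <-> exists m (p : {linear 'rV[R]_m -> M}), surjective p.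
Proof.
split=> [[m [e eE]]|[m [p ps]]].
  exists m, (row_map e) => x; have [c ->] := eE x.
  exists (\row_j c j); rewrite row_mapE; apply: eq_bigr => j _; by rewrite mxE.
exists m, (fun j => p (delta_mx 0 j)) => x; have [v <-] := ps x.
exists (fun j => v 0 j); rewrite {1}[v]row_sum linear_sum; apply: eq_bigr => j _.
by rewrite linearZ.
Qed.

Lemma fin_gen_row m : fin_gen ('rV[R]_m : lmodType R).
Proof. by apply/fin_gen_rowP; exists m, (lin_id _) => x; exists x. Qed.

Lemma row_fg_projective m : fg_projective ('rV[R]_m : lmodType R).
Proof. by split; [exact: row_projective | exact: fin_gen_row]. Qed.

Lemma fin_gen_surj M N (p : {linear M -> N}) : surjective p -> fin_gen M -> fin_gen N.
Proof.
move=> ps [m [e eE]]; exists m, (p \o e) => y; have [x <-] := ps y.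
have [c ->] := eE x; exists c; rewrite linear_sum; apply: eq_bigr => j _.
by rewrite linearZ.
Qed.

Lemma fin_gen_extension A B C (i : {linear A -> B}) (p : {linear B -> C}) :
  short_exact i p -> fin_gen A -> fin_gen C -> fin_gen B.
Proof.
move=> [_ ex ps] /fin_gen_rowP[m [a as_]] /fin_gen_rowP[n [c cs]].
have [l lE] := row_projective c ps.
apply/fin_gen_rowP; exists (m + n)%N.
have lin_f : linear (fun v : 'rV[R]_(m + n) => i (a (lsubmx v)) + l (rsubmx v)).
  by move=> r u v; rewrite !linearP scalerDr addrACA.
exists (lin_of lin_f) => y; have [v vE] := cs (p y).
have /ex[x xE] : p (y - l v) = 0 by rewrite linearB lE vE subrr.
by have [u uE] := as_ x; exists (row_mx u v); rewrite /= row_mxKl row_mxKr uE xE subrK.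
Qed.

Lemma fin_gen_lands_dsum I (X : I -> lmodType R) M (f : {linear M -> dsum X}) : fin_gen M ->
  exists s : seq {classic I}, forall (i : {classic I}) x, i \notin s -> dproj i (f x) = 0.
Proof.
move=> [m [e eE]]; have [s sP] := choice (fun j => dproj_support (f (e j))).
exists (flatten [seq s j | j <- enum 'I_m]) => i x si.
have [c ->] := eE x; rewrite !linear_sum big1 // => j _; rewrite !linearZ_LR /=.
rewrite -[X in _ *: X]/(dproj i (f (e j))) sP ?scaler0 //; apply: contra si => sij.
by apply/flattenP; exists (s j) => //; apply/map_f; rewrite mem_enum.
Qed.

(** In a free module that has [Q] as a retract, the image of a finitely generated module involves
    finitely many coordinates. *)
Lemma fin_gen_factor_row M Q (f : {linear M -> Q}) : fin_gen M -> projective Q ->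
  exists m (u : {linear M -> 'rV[R]_m}) (v : {linear 'rV[R]_m -> Q}), forall x, v (u x) = f x.
Proof.
move=> fgM /projective_retract_free[I [s [r rs]]].
have [t tP] := fin_gen_lands_dsum (lin_comp s f) fgM.
have ut := undup_uniq t.
pose S := undup t.
have linu : linear (fun x => \row_(j < size S) (dproj (tnth (in_tuple S) j) (s (f x)) : R)).
  by move=> a x y; apply/rowP => j; rewrite !mxE !linearP.
exists (size S), (lin_of linu).
exists (row_map (fun j => r (dinj (tnth (in_tuple S) j) (1 : R^o)))) => x.
rewrite row_mapE -[RHS]rs (@dsum_sum _ _ _ (s (f x)) S) // => [|i]; last first.
  by rewrite mem_undup => /tP ->.
rewrite linear_sum [RHS]big_tnth; apply: eq_bigr => j _; rewrite mxE -!linearZ_LR.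
congr (r (dinj _ _)); exact: mulr1.
Qed.


Lemma ext1_projective N M : projective N -> ext1 N M.
Proof.
move=> prN; apply: (ext1_ses (zero_ses N) prN) => f; exists lin_zero => x.
by rewrite (_ : x = 0) ?linear0 //; apply/rowP; case.
Qed.

Lemma ext1_section A B N (i : {linear A -> B}) (p : {linear B -> N}) :
  short_exact i p -> ext1 N A -> exists s : {linear N -> B}, forall x, p (s x) = x.
Proof.
move=> ses ext; have [g gE] := ext _ _ i p (lin_id A) ses.
have [|s sE] := short_exact_descend (f := lin_id B - lin_comp i g) ses.
  by move=> x; rewrite lin_subE /= gE subrr.
exists s => x; have [_ _ /(_ x)[y <-]] := ses.
by rewrite sE lin_subE /= linearB (ses_comp _ ses) subr0.
Qed.

(** The map is extended in two steps: from [K] to the preimage [PA] of [A], with quotient [A], and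
    from there to [P], with quotient [C]. *)
Lemma ext1_extension A B C M (i : {linear A -> B}) (p : {linear B -> C}) :
  short_exact i p -> ext1 A M -> ext1 C M -> ext1 B M.
Proof.
move=> ses extA extC K P k q f [ki kex qs]; have [ii iex ps] := ses.
pose PA := ker_mod (lin_comp p q); pose inc := ker_incl (lin_comp p q).
have [|k' k'E] := @factor_inj _ _ _ K inc k val_inj.
  by move=> x; apply/ker_inclP; rewrite /= (_ : q (k x) = 0) ?linear0 //; apply/kex; exists x.
have [|q' q'E] := @factor_inj _ _ _ PA i (lin_comp q inc) ii.
  by move=> x; apply/iex; have /ker_inclP : exists y, inc y = inc x by exists x.
have [|g gE] := extA _ _ k' q' f.
  split=> [x y e|y|a].
  - by apply: ki; rewrite -!k'E e.
  - split=> [/(congr1 i)|[x <-]]; last first.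
      by apply: ii; rewrite q'E linear0 -[LHS]/(q (inc (k' x))) k'E; apply/kex; exists x.
    rewrite q'E linear0 => /kex[x xE]; exists x; apply: val_inj.
    by rewrite -[LHS]/(inc _) k'E.
  - have [y yE] := qs (i a).
    have /ker_inclP[z zE] : lin_comp p q y = 0 by rewrite /= yE (ses_comp _ ses).
    by exists z; apply: ii; rewrite q'E /= -[val z]/(inc z) zE.
have sPA : surjective (lin_comp p q).
  by move=> c; have [b <-] := ps c; have [y <-] := qs b; exists y.
have [h hE] := extC _ _ inc (lin_comp p q) g (ker_ses sPA).
by exists h => x; rewrite -k'E hE gE.
Qed.

End Free.

(** * Finite generation over a left noetherian ring *)

Section Noetherian.
Variables (R : pzRingType) (noethR : left_noetherian R).
Implicit Types (A B C K M N : lmodType R).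

Lemma fin_gen_of_image_kernel A (f : {linear A -> R^o}) : fin_gen (ker_mod f) -> fin_gen A.
Proof.
move=> /fin_gen_rowP[k [g gs]].
have [|n [e [ef eP]]] := noethR (I := fun r => exists a, f a = r).
  split=> [|_ _ [a <-] [b <-]|c _ [a <-]]; first by exists 0; rewrite linear0.
    by exists (a + b); rewrite linearD.
  by exists (c *: a); rewrite linearZ.
have [a aE] := choice ef.
apply/fin_gen_rowP; exists (n + k)%N.
have lin_h : linear (fun v : 'rV[R]_(n + k) =>
    row_map a (lsubmx v) + ker_incl f (g (rsubmx v))).
  by move=> r u v; rewrite !linearP scalerDr addrACA.
exists (lin_of lin_h) => x; have [c cE] := eP (f x) (ex_intro _ x erefl).
pose v := \row_j c j.
have /ker_inclP[y yE] : f (x - row_map a v) = 0.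
  rewrite linearB row_mapE linear_sum cE; apply/eqP; rewrite subr_eq0; apply/eqP.
  by apply: eq_bigr => j _; rewrite linearZ aE mxE.
have [u uE] := gs y; exists (row_mx v u).
by rewrite -[LHS]/(row_map a (lsubmx _) + ker_incl f (g (rsubmx _))) row_mxKl row_mxKr
  uE yE addrC subrK.
Qed.

(** Induction on [m]: the first coordinate has a left ideal as image, and its kernel embeds in a
    free module of smaller rank. *)
Lemma fin_gen_sub_row m A (i : {linear A -> 'rV[R]_m}) : injective i -> fin_gen A.
Proof.
elim: m A i => [|m IH] A i ii.
  exists 0%N, (fun _ => 0) => x; exists (fun _ => 0); rewrite big_ord0.
  by apply: ii; rewrite linear0; apply/rowP; case.
have lin_f : linear (fun x => i x 0 ord0 : R^o) by move=> a x y; rewrite linearP !mxE.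
pose f : {linear A -> R^o} := lin_of lin_f.
apply: (@fin_gen_of_image_kernel A f).
have lin_g : linear (fun x : ker_mod f => \row_j i (ker_incl f x) 0 (lift ord0 j)).
  by move=> a x y; apply/rowP => j; rewrite !linearP !mxE.
apply: (IH _ (lin_of lin_g)) => x y e; apply: val_inj; apply: ii; apply/rowP => j.
have kerf z : i (ker_incl f z) 0 ord0 = 0.
  by apply: (ker_inclP f _).2; exists z.
case: (unliftP ord0 j) => [j' ->|->]; last by rewrite -!/(ker_incl f _) (kerf x) (kerf y).
by have /rowP/(_ j') := e; rewrite !mxE.
Qed.

(** The pullback of [A] and R^m over [B] embeds in R^m and maps onto [A]. *)
Lemma fin_gen_sub A B (i : {linear A -> B}) : injective i -> fin_gen B -> fin_gen A.
Proof.
move=> ii /fin_gen_rowP[m [p ps]].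
pose d : {linear (A * 'rV[R]_m)%type -> B} := lin_copair i (- p).
have dE x : d x = i x.1 - p x.2 by [].
have dK (z : ker_mod d) : i (val z).1 = p (val z).2.
  have /(ker_inclP d) : exists y, ker_incl d y = val z by exists z.
  by rewrite dE => /eqP; rewrite subr_eq0 => /eqP.
apply: (@fin_gen_surj _ _ _ (lin_comp (lin_fst _ _) (ker_incl d))) => [a|].
  have [v vE] := ps (i a); have /ker_inclP[z zE] : d (a, v) = 0 by rewrite dE /= vE subrr.
  by exists z; rewrite /= -[val z]/(ker_incl d z) zE.
apply: (@fin_gen_sub_row m _ (lin_comp (lin_snd _ _) (ker_incl d))) => x y /= e.
apply: val_inj; have E (u v : (A * 'rV[R]_m)%type) : u.1 = v.1 -> u.2 = v.2 -> u = v.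
  by case: u v => [? ?] [? ?] /= -> ->.
by apply: E => //; apply: ii; rewrite !dK e.
Qed.

Lemma fin_gen_cover M : fin_gen M ->
  exists m (K : lmodType R) (k : {linear K -> 'rV[R]_m}) (p : {linear 'rV[R]_m -> M}),
    short_exact k p /\ fin_gen K.
Proof.
move=> /fin_gen_rowP[m [p ps]]; exists m, (ker_mod p), (ker_incl p), p.
split; first exact: ker_ses.
by apply: (@fin_gen_sub_row m _ (ker_incl p)); exact: val_inj.
Qed.

End Noetherian.

(** * Closure properties of Gorenstein-projective modules *)


Section GorensteinProjectiveClosure.
Variable R : pzRingType.
Implicit Types (A B C D E K L M N P Q X Y Z U V W : lmodType R).

(* The cosyzygies and syzygies are spliced into a complex indexed by int. *)
Lemma gorenstein_projective_coind (G : lmodType R -> Prop) :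
  (forall X, G X -> exists P Y (i : {linear X -> P}) (p : {linear P -> Y}),
     [/\ projective P, G Y & short_exact i p]) ->
  (forall X, G X -> exists P Y (i : {linear Y -> P}) (p : {linear P -> X}),
     [/\ projective P, G Y & short_exact i p]) ->
  (forall X Q, G X -> projective Q -> ext1 X Q) ->
  forall M, G M -> gorenstein_projective M.
Proof.
move=> emb cov ext M GM.
pose rel A B := exists P (i : {linear A -> P}) (p : {linear P -> B}),
  projective P /\ short_exact i p.
pose st := {X : lmodType R | G X}.
have [F FE] : exists F : st -> st, forall s, rel (sval s) (sval (F s)).
  apply: (@dependent_choice _ _ (fun s t => rel (sval s) (sval t))) => -[X GX]; have [P [Y [i [p [prP GY ses]]]]] := emb X GX.
  by exists (exist _ Y GY), P, i, p.
have [B BE] : exists B : st -> st, forall s, rel (sval (B s)) (sval s).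
  apply: (@dependent_choice _ _ (fun s t => rel (sval t) (sval s))) => -[X GX]; have [P [Y [i [p [prP GY ses]]]]] := cov X GX.
  by exists (exist _ Y GY), P, i, p.
pose m : st := exist _ M GM.
(* Degrees >= 0 hold iterated cosyzygies; [Negz k] is -(k + 1), hence holds a syzygy of order k +
   1. *)
pose S (n : int) : st :=
  match n with Posz k => iter k F m | Negz k => iter k.+1 B m end.
pose Z n := sval (S n).
have relZ n : rel (Z n) (Z (n + 1)).
  case: n => [n|[|n]]; last 2 first.
  - exact: BE.
  - have -> : Negz n.+1 + 1 = Negz n by rewrite !NegzE -addn1 PoszD opprD addrNK.
    exact: BE.
  - have -> : Posz n + 1 = Posz n.+1 by rewrite -PoszD addn1.
    exact: FE.
have [P /dependent_choice[i /dependent_choice[p pE]]] := dependent_choice relZ.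
have prP n := (pE n).1; have ses n := (pE n).2.
pose d n : {linear P n -> P (n + 1)} := lin_comp (i (n + 1)) (p n).
exists P, d, (i 0); split.
- split=> // [n x|Q prQ n f df|Q prQ n f fd].
  + by rewrite /= (ses_comp _ (ses (n + 1))) linear0.
  + have [ii _ _] := ses (n + 1 + 1); have [ji jex _] := ses (n + 1).
    have [g gE] : exists g : {linear Q -> Z (n + 1)}, forall x, i (n + 1) (g x) = f x.
      apply: factor_inj ji _ => x; apply/jex; apply: ii.
      by rewrite linear0; exact: df.
    have [_ _ ps] := ses n; have [h hE] := prQ _ _ _ g ps.
    by exists h => x; rewrite /= hE gE.
  (* [f] kills the image [Z (n + 1)] of [d n], so it factors through [Z (n + 1 + 1)]; it then
     extends to [P (n + 1 + 1)], where the cokernel [Z (n + 1 + 1 + 1)] has no Ext^1 into [Q]. *)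
  + have [_ _ ps] := ses n.
    have [|g gE] := short_exact_descend (f := f) (ses (n + 1)).
      by move=> z; have [x <-] := ps z; exact: fd.
    have [h hE] := ext _ _ (svalP (S (n + 1 + 1 + 1))) prQ _ _ _ _ g (ses (n + 1 + 1)).
    by exists h => x; rewrite /= hE gE.
- by have [] := ses 0.
- have [ii ex _] := ses 0; have [ji _ _] := ses (0 + 1).
  move=> y; split=> [/= dy|/ex dy]; last by rewrite /= dy linear0.
  by apply/ex/ji; rewrite linear0.
Qed.

Lemma gorenstein_projective_ext1 M Q :
  gorenstein_projective M -> projective Q -> ext1 M Q.
Proof. by move=> gM prQ A B i p f ses; exact: gorenstein_projective_extend ses gM prQ. Qed.

(** Cocycles in any degree form a class that is closed under syzygies and cosyzygies at once; moving
    them to degree 0 would need casts between the [P n]. *)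
Definition cocycle_module M : Prop :=
  exists (P : int -> lmodType R) (d : forall n, {linear P n -> P (n + 1)}) (n : int)
         (k : {linear M -> P n}),
    [/\ totally_acyclic d, injective k & exact_at k (d n)].

Lemma cocycle_module_gproj M : cocycle_module M -> gorenstein_projective M.
Proof.
apply: gorenstein_projective_coind => {M} [M [P [d [n [k [tac ki kex]]]]]|
    M [P [d [n [k [tac ki kex]]]]]|M Q [P [d [n [k [tac ki kex]]]]]].
- have [prP dd _ _] := tac; pose i := ker_incl (d (n + 1)).
  have [|p pE] := @factor_inj _ _ _ (P n) i (d n) val_inj.
    by move=> x; apply/ker_inclP.
  exists (P n), (ker_mod (d (n + 1))), k, p; split=> //.
    by exists P, d, (n + 1), i; split=> //; [exact: val_inj | exact: ker_inclP].
  split=> // y.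
    split=> [py|/kex dy]; first by apply/kex; rewrite -pE py linear0.
    by apply: val_inj; rewrite -[LHS]/(i (p y)) pE dy.
  have /(proj1 (totally_acyclic_exact tac _))[x xE] : d (n + 1) (i y) = 0.
    by apply/ker_inclP; exists y.
  by exists x; apply: val_inj; rewrite -[LHS]/(i (p x)) pE xE.
- have [m nE] : exists m, n = m + 1 by exists (n - 1); rewrite subrK.
  subst n; have [prP dd _ _] := tac.
  have [|p pE] := @factor_inj _ _ _ (P m) k (d m) ki.
    by move=> x; apply/kex.
  exists (P m), (ker_mod (d m)), (ker_incl (d m)), p; split=> //.
    by exists P, d, m, (ker_incl (d m)); split=> //; [exact: val_inj | exact: ker_inclP].
  split=> [x y /val_inj //|y|x].
    rewrite -ker_inclP -pE; split=> [->|]; first by rewrite linear0.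
    by move=> e; apply: ki; rewrite e linear0.
  have /(proj1 (totally_acyclic_exact tac _))[y yE] : d (m + 1) (k x) = 0.
    by apply/kex; exists x.
  by exists y; apply: ki; rewrite pE.
(* Exactness of Hom(P, Q) is stated at [P (m + 1)], which maps onto the cocycles of [P (m + 1 + 1)].
   These are the syzygy of [M], so [M] sits in degree m + 3. *)
- have [m nE] : exists m, n = m + 1 + 1 + 1 by exists (n - 1 - 1 - 1); rewrite !subrK.
  subst n; move=> prQ; have [prP dd _ hp] := tac.
  have [|p pE] := @factor_inj _ _ _ (P (m + 1 + 1)) k (d (m + 1 + 1)) ki.
    by move=> x; apply/kex.
  have ses : short_exact (ker_incl (d (m + 1 + 1))) p.
    split=> [x y /val_inj //|y|x].
      rewrite -ker_inclP -pE; split=> [->|]; first by rewrite linear0.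
      by move=> e; apply: ki; rewrite e linear0.
    have /(proj1 (totally_acyclic_exact tac _))[y yE] : d (m + 1 + 1 + 1) (k x) = 0.
      by apply/kex; exists x.
    by exists y; apply: ki; rewrite pE.
  apply: (ext1_ses ses) => // f.
  have [|q qE] := @factor_inj _ _ _ (P (m + 1)) (ker_incl (d (m + 1 + 1))) (d (m + 1)) val_inj.
    by move=> x; apply/ker_inclP.
  have [|g gE] := hp Q prQ m (lin_comp f q).
    move=> x /=; rewrite (_ : q _ = 0) ?linear0 //.
    by apply: val_inj; rewrite -[LHS]/(ker_incl _ (q _)) qE dd.
  exists g => x.
  have /(proj1 (totally_acyclic_exact tac _))[y yE] :
    d (m + 1 + 1) (ker_incl (d (m + 1 + 1)) x) = 0 by apply/ker_inclP; exists x.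
  rewrite -yE -gE /=; congr (f _); apply: val_inj.
  by rewrite -[LHS]/(ker_incl _ (q _)) qE yE.
Qed.

Lemma gorenstein_projective_cover M : gorenstein_projective M ->
  exists P Y (i : {linear Y -> P}) (p : {linear P -> M}),
    [/\ projective P, gorenstein_projective Y & short_exact i p].
Proof.
move=> [P [d [k [tac ki kex]]]]; move: k ki kex.
(* Degree 0 is written as (0 - 1) + 1 so that the differential arriving there has the required
   type. *)
rewrite -[0](subrK 1); set m := 0 - 1; move: m => m k ki kex.
have [prP dd _ _] := tac.
have [|p pE] := @factor_inj _ _ _ (P m) k (d m) ki.
  by move=> x; apply/kex.
exists (P m), (ker_mod (d m)), (ker_incl (d m)), p; split=> //.
  apply: cocycle_module_gproj; exists P, d, m, (ker_incl (d m)).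
  by split=> //; [exact: val_inj | exact: ker_inclP].
split=> [x y /val_inj //|y|x].
  rewrite -ker_inclP -pE; split=> [->|]; first by rewrite linear0.
  by move=> e; apply: ki; rewrite e linear0.
have /(proj1 (totally_acyclic_exact tac _))[y yE] : d (m + 1) (k x) = 0.
  by apply/kex; exists x.
by exists y; apply: ki; rewrite pE.
Qed.

Lemma projective_gproj P : projective P -> gorenstein_projective P.
Proof.
apply: gorenstein_projective_coind => {P} [P prP|P prP|P Q prP _].
- exists P, 'rV[R]_0, (lin_id P), lin_zero; split=> //; last exact: id_ses.
  exact: zero_projective.
- exists P, 'rV[R]_0, lin_zero, (lin_id P); split=> //; last exact: zero_ses.
  exact: zero_projective.
- exact: ext1_projective.
Qed.

Lemma horseshoe_cover A B C U V K1 K2 (i : {linear A -> B}) (q : {linear B -> C})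
    (s : {linear K1 -> U}) (r : {linear U -> A}) (u : {linear K2 -> V}) (v : {linear V -> C})
    (l : {linear V -> B}) :
  short_exact i q -> short_exact s r -> short_exact u v -> (forall x, q (l x) = v x) ->
  exists K (k : {linear K -> (U * V)%type}) (a : {linear K1 -> K}) (b : {linear K -> K2}),
    short_exact k (lin_copair (lin_comp i r) l) /\ short_exact a b.
Proof.
move=> ses1 ses2 ses3 lE; have [ii iex qs] := ses1.
have [si sex rs] := ses2; have [ui uex vs] := ses3.
pose d := lin_copair (lin_comp i r) l; have dE x : d x = i (r x.1) + l x.2 by [].
have ds : surjective d.
  move=> b; have [y yE] := vs (q b).
  have /iex[a aE] : q (b - l y) = 0 by rewrite linearB lE yE subrr.
  by have [x xE] := rs a; exists (x, y); rewrite dE /= xE aE subrK.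
have [|a aE] := @factor_inj _ _ _ K1 (ker_incl d) (lin_comp (lin_inl U V) s) val_inj.
  move=> x; apply/ker_inclP; rewrite dE -[_.2]/0 linear0 addr0.
  by rewrite -[(_ x).1]/(s x) (ses_comp _ ses2) linear0.
have [|b bE] := @factor_inj _ _ _ (ker_mod d) u (lin_comp (lin_snd U V) (ker_incl d)) ui.
  move=> x; apply/uex; have : d (ker_incl d x) = 0 by apply/ker_inclP; exists x.
  move=> /(congr1 q); rewrite dE linearD lE linear0 => <-.
  by rewrite (ses_comp _ ses1) add0r.
have pairE (x y : (U * V)%type) : x.1 = y.1 -> x.2 = y.2 -> x = y.
  by case: x y => [? ?] [? ?] /= -> ->.
exists (ker_mod d), (ker_incl d), a, b; split; first exact: ker_ses.
split=> [x y e|x|y].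
- by have := congr1 (ker_incl d) e; rewrite !aE => -[/si].
- split=> [bx|[y <-]]; last first.
    by apply: ui; rewrite bE linear0 -[LHS]/((ker_incl d (a y)).2) aE.
  have x2 : (ker_incl d x).2 = 0 by have := bE x; rewrite bx linear0.
  have : d (ker_incl d x) = 0 by apply/ker_inclP; exists x.
  rewrite dE x2 linear0 addr0 => e.
  have /sex[y yE] : r (ker_incl d x).1 = 0 by apply: ii; rewrite e linear0.
  by exists y; apply: val_inj; rewrite -[LHS]/(ker_incl d (a y)) aE; apply: pairE.
- have /iex[x xE] : q (- l (u y)) = 0.
    by rewrite linearN lE (ses_comp _ ses3) oppr0.
  have [x' x'E] := rs x.
  have /ker_inclP[z zE] : d (x', u y) = 0 by rewrite dE /= x'E xE addNr.
  by exists z; apply: ui; rewrite bE -[LHS]/((ker_incl d z).2) zE.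
Qed.

(** The two horseshoe lemmas make the class of all such extensions closed under syzygies and
    cosyzygies, as the coinduction principle demands. *)
Lemma gorenstein_projective_extension A B C (i : {linear A -> B}) (p : {linear B -> C}) :
  short_exact i p -> gorenstein_projective A -> gorenstein_projective C ->
  gorenstein_projective B.
Proof.
move=> ses gA gC.
apply: (@gorenstein_projective_coind (fun B => exists A C (i : {linear A -> B})
  (p : {linear B -> C}), [/\ short_exact i p, gorenstein_projective A
    & gorenstein_projective C])); last by exists A, C, i, p.
- move=> {A B C i p ses gA gC} B [A [C [i [p [ses gA gC]]]]].
  have [U [Z1 [s [r [prU gZ1 ses1]]]]] := gorenstein_projective_embed gA.
  have [V [Z2 [u [v [prV gZ2 ses2]]]]] := gorenstein_projective_embed gC.
  have [F FE] := gorenstein_projective_extend s ses gC prU.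
  have [Z [c [a [b [ses3 ses4]]]]] := horseshoe_embed ses ses1 ses2 FE.
  exists (U * V)%type, Z, (lin_pair F (lin_comp u p)), c.
  by split=> //; [exact: pair_projective | exists Z1, Z2, a, b].
- move=> {A B C i p ses gA gC} B [A [C [i [p [ses gA gC]]]]].
  have [U [K1 [s [r [prU gK1 ses1]]]]] := gorenstein_projective_cover gA.
  have [V [K2 [u [v [prV gK2 ses2]]]]] := gorenstein_projective_cover gC.
  have [_ _ ps] := ses; have [l lE] := prV _ _ p v ps.
  have [K [k [a [b [ses3 ses4]]]]] := horseshoe_cover ses ses1 ses2 lE.
  exists (U * V)%type, K, k, (lin_copair (lin_comp i r) l).
  by split=> //; [exact: pair_projective | exists K1, K2, a, b].
- move=> X Q [A' [C' [i' [p' [ses' gA' gC']]]]] prQ.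
  by apply: ext1_extension ses' _ _; exact: gorenstein_projective_ext1.
Qed.

Lemma gorenstein_projective_pair A B : gorenstein_projective A -> gorenstein_projective B ->
  gorenstein_projective (A * B)%type.
Proof. by move=> gA gB; exact: gorenstein_projective_extension (prod_ses A B) gA gB. Qed.

Lemma ses_iso A B (f : {linear A -> B}) (g : {linear B -> A}) :
  (forall x, g (f x) = x) -> (forall x, f (g x) = x) ->
  short_exact f (@lin_zero R B 'rV[R]_0).
Proof.
move=> gf fg; split=> [x y /(congr1 g)|y|y]; first by rewrite !gf.
- by split=> // _; exists (g y); rewrite fg.
- by exists 0; apply/rowP; case.
Qed.

Lemma gorenstein_projective_iso A B (f : {linear A -> B}) (g : {linear B -> A}) :
  (forall x, g (f x) = x) -> (forall x, f (g x) = x) ->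
  gorenstein_projective A -> gorenstein_projective B.
Proof.
move=> gf fg gA; apply: gorenstein_projective_extension (ses_iso gf fg) gA _.
by apply: projective_gproj; exact: zero_projective.
Qed.

(* A Gorenstein-projective A = B + P yields, from A >-> Q ->> Z, the conflations *)
(* B >-> Q ->> Q / B with P >-> Q / B ->> Z, and dually. *)
Lemma gorenstein_projective_cancel B P :
  projective P -> gorenstein_projective (B * P)%type -> gorenstein_projective B.
Proof.
move=> prP gBP.
apply: (@gorenstein_projective_coind (fun B => exists P, projective P /\
  gorenstein_projective (B * P)%type)); last by exists P.
- move=> {B P prP gBP} B [P [prP gBP]].
  have [Q [Z [s [r [prQ gZ ses]]]]] := gorenstein_projective_embed gBP.
  have [Y [c [a [b [cses abses]]]]] := ses_third (prod_ses B P) ses.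
  exists Q, Y, (lin_comp s (lin_inl B P)), c; split=> //.
  exists 'rV[R]_0; split; first exact: zero_projective.
  apply: gorenstein_projective_pair; last by apply: projective_gproj; exact: zero_projective.
  exact: gorenstein_projective_extension abses (projective_gproj prP) gZ.
- move=> {B P prP gBP} B [P [prP gBP]].
  have [Q [Z [s [r [prQ gZ ses]]]]] := gorenstein_projective_cover gBP.
  have [si sex rs] := ses.
  pose c := lin_comp (lin_fst B P) r.
  have cs : surjective c by move=> x; have [y yE] := rs (x, 0); exists y; rewrite /= yE.
  exists Q, (ker_mod c), (ker_incl c), c; split=> //; last exact: ker_ses.
  exists 'rV[R]_0; split; first exact: zero_projective.
  apply: gorenstein_projective_pair; last by apply: projective_gproj; exact: zero_projective.
  have [|a aE] := @factor_inj _ _ _ Z (ker_incl c) s val_inj.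
    by move=> x; apply/ker_inclP; rewrite /= (ses_comp _ ses).
  apply: (@gorenstein_projective_extension Z (ker_mod c) P a
    (lin_comp (lin_comp (lin_snd B P) r) (ker_incl c))) => //; last exact: projective_gproj.
  have c0 x : (r (ker_incl c x)).1 = 0.
    by have : c (ker_incl c x) = 0 by apply/ker_inclP; exists x.
  split=> [x y e|x|y].
  + by apply: si; rewrite -!aE e.
  + split=> [x2|[y <-]]; last first.
      by rewrite -[LHS]/((r (ker_incl c (a y))).2) aE (ses_comp _ ses).
    have /sex[y yE] : r (ker_incl c x) = 0.
      move: x2 (c0 x) => /=; rewrite -[val x]/(ker_incl c x).
      by case: (r _) => [? ?] /= -> ->.
    by exists y; apply: val_inj; rewrite -[LHS]/(ker_incl c (a y)) aE.
  + have [x xE] := rs (0, y).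
    have /ker_inclP[z zE] : c x = 0 by rewrite /= xE.
    by exists z; rewrite /= -[val z]/(ker_incl c z) zE xE.
(* Adding the identity of [P'] to the sequence turns its quotient [X] into X + P'. *)
- move=> X Q [P' [prP' gXP]] prQ A B' i p f ses.
  have [|g gE] := gorenstein_projective_ext1 gXP prQ (i := lin_comp (lin_inl B' P') i)
      (p := lin_pair (lin_comp p (lin_fst B' P')) (lin_snd B' P')) f.
    have [ii iex ps] := ses; split=> [x y /= [/ii] //|[b x]|[x y]].
      split=> [/= [/iex[a <-] ->]|[a [<- <-]]]; first by exists a.
      by rewrite /= (ses_comp _ ses).
    by have [b <-] := ps x; exists (b, y).
  by exists (lin_comp g (lin_inl B' P')).
Qed.

(* M is the mapping cone of A -> B: it is both an extension of the cosyzygy of A by B *)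
(* and isomorphic to C + P. *)
Lemma gorenstein_projective_coker A B C (i : {linear A -> B}) (p : {linear B -> C}) :
  short_exact i p -> gorenstein_projective A -> gorenstein_projective B ->
  (forall Q (f : {linear A -> Q}), projective Q ->
    exists g : {linear B -> Q}, forall x, g (i x) = f x) ->
  gorenstein_projective C.
Proof.
move=> ses gA gB ext.
have [P [Z [s [r [prP gZ ses1]]]]] := gorenstein_projective_embed gA.
have [M [a [b [q [ses2 ab qb MP univ]]]]] := pushout i ses1.
have gM := gorenstein_projective_extension ses2 gB gZ.
(* This extension of [s] to [B] is what splits [P] off the mapping cone. *)
have [F FE] := ext P s prP.
have [|t [ta tb]] := univ C p lin_zero; first by move=> x; rewrite (ses_comp _ ses).
have [|t' [ta' tb']] := univ P F (lin_id P); first by move=> x; rewrite FE.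
have [|g gE] := short_exact_descend (f := a - lin_comp b F) ses.
  by move=> x; rewrite lin_subE /= FE ab subrr.
apply: (gorenstein_projective_cancel prP).
apply: (@gorenstein_projective_iso M (C * P)%type (lin_pair t t') (lin_copair g b)) => //.
  move=> x; have [y [z ->]] := MP x.
  have tE : t (a y + b z) = p y by rewrite linearD ta tb addr0.
  have tE' : t' (a y + b z) = F y + z by rewrite linearD ta' tb'.
  by rewrite /= tE tE' gE lin_subE /= linearD addrA subrK.
move=> [x y]; have [_ _ /(_ x)[z <-]] := ses.
rewrite /= gE lin_subE !linearD !linearN /= ta tb ta' tb' tb tb'.
by congr (_, _); rewrite /= ?oppr0 ?addr0 // subrr add0r.
Qed.

(** The module form of a rotated triangle, from the syzygy [K] of [C] through [A] to [B]; adding [P]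
    turns it into a conflation. *)
Lemma rotate_cover A B C K P (i : {linear A -> B}) (p : {linear B -> C})
    (k : {linear K -> P}) (r : {linear P -> C}) :
  short_exact i p -> short_exact k r -> projective P ->
  exists (m : {linear K -> (A * P)%type}) (q : {linear (A * P)%type -> B}), short_exact m q.
Proof.
move=> ses ses1 prP; have [ii iex ps] := ses.
have [ki kex rs] := ses1; have [l lE] := prP _ _ p r ps.
have [|t tE] := @factor_inj _ _ _ K i (lin_comp l k) ii.
  by move=> x; apply/iex; rewrite /= lE (ses_comp _ ses1).
exists (lin_pair (- t) k), (lin_copair i l); split=> [x y [_ /ki] //|[a x]|b].
- split=> [/= e|[y [<- <-]]]; last by rewrite /= linearN tE addNr.
  have /kex[y yE] : r x = 0.
    have := congr1 p e; by rewrite linearD (ses_comp _ ses) add0r lE linear0.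
  exists y; rewrite -yE; congr (_, _); apply: ii; rewrite linearN tE /= yE.
  by apply/eqP; rewrite -subr_eq0 -opprD oppr_eq0 addrC e.
- have [x xE] := rs (p b); have /iex[a aE] : p (b - l x) = 0.
    by rewrite linearB lE xE subrr.
  by exists (a, x); rewrite /= aE subrK.
Qed.

(** The opposite rotation, from [B] through [C] to the cokernel [Z] of [A -> P]. *)
Lemma rotate_embed A B C P Z (i : {linear A -> B}) (p : {linear B -> C})
    (s : {linear A -> P}) (r : {linear P -> Z}) :
  short_exact i p -> short_exact s r -> ext1 C P ->
  exists (m : {linear B -> (C * P)%type}) (q : {linear (C * P)%type -> Z}), short_exact m q.
Proof.
move=> ses ses1 ext; have [ii iex ps] := ses; have [si sex rs] := ses1.
have [F FE] := ext _ _ i p s ses.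
have [|e eE] := short_exact_descend (f := lin_comp r F) ses.
  by move=> x; rewrite /= FE (ses_comp _ ses1).
exists (lin_pair p F), (lin_copair (- e) r); split=> [|[c x]|z].
- apply/inj0P => b [/iex[a <-]]; rewrite FE -[0](linear0 s) => /si ->.
  by rewrite linear0.
- rewrite -[lin_copair _ _ _]/((- e) c + r x) -[(- e) c]/(- e c).
  split=> [|[b [<- <-]]]; last by rewrite eE addNr.
  have [b <-] := ps c; rewrite eE addrC -linearB => /sex[a aE].
  exists (b + i a); rewrite /= !linearD (ses_comp _ ses) FE aE.
  by congr (_, _); rewrite /= ?addr0 // addrC subrK.
- have [x xE] := rs z; exists (0, x).
  by rewrite -[lin_copair _ _ _]/((- e) 0 + r x) linear0 add0r.
Qed.

(** A + P is an extension of [B] by a syzygy of [C], and [P] cancels. *)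
Lemma gorenstein_projective_kernel A B C (i : {linear A -> B}) (p : {linear B -> C}) :
  short_exact i p -> gorenstein_projective B -> gorenstein_projective C ->
  gorenstein_projective A.
Proof.
move=> ses gB gC; have [P [K [k [r [prP gK ses1]]]]] := gorenstein_projective_cover gC.
have [m [q ses2]] := rotate_cover ses ses1 prP.
exact: gorenstein_projective_cancel prP (gorenstein_projective_extension ses2 gK gB).
Qed.

Lemma ext1_dsum (I : small) (X : I -> lmodType R) M :
  (forall i, ext1 (X i) M) -> ext1 (dsum X) M.
Proof.
move=> ext.
have [P /dependent_choice[p pE]] := dependent_choice (fun i => projective_cover_exists (X i)).
have [m [q [ses mE _ _ _]]] := dsum_ses (fun i => ker_ses (pE i).2).
apply: (ext1_ses ses) => [|f]; first by apply: dsum_projective => i; have [] := pE i.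
have [g gE] := dependent_choice (fun i =>
  ext i _ _ _ _ (lin_comp f (dinj i)) (ker_ses (pE i).2)).
have [h hE] := dsum_copair g; exists h.
by apply: (@dsum_lin_ext _ _ _ _ (lin_comp h m) f) => i x /=; rewrite mE hE gE.
Qed.

Lemma gorenstein_projective_dsum (I : small) (X : I -> lmodType R) :
  (forall i, gorenstein_projective (X i)) -> gorenstein_projective (dsum X).
Proof.
move=> gX; apply: (@gorenstein_projective_coind (fun M => exists (I : small)
  (X : I -> lmodType R), M = dsum X /\ forall i, gorenstein_projective (X i)));
  last by exists I, X.
- move=> {I X gX} _ [I [X [-> gX]]].
  have [P /dependent_choice[Y /dependent_choice[i /dependent_choice[p pE]]]] :=
    dependent_choice (fun j => gorenstein_projective_embed (gX j)).
  have [|m [q [ses _ _ _ _]]] := @dsum_ses _ _ _ _ _ i p; first by move=> j; have [] := pE j.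
  exists (dsum P), (dsum Y), m, q; split=> //.
    by apply: dsum_projective => j; have [] := pE j.
  by exists I, Y; split=> // j; have [] := pE j.
- move=> {I X gX} _ [I [X [-> gX]]].
  have [P /dependent_choice[Y /dependent_choice[i /dependent_choice[p pE]]]] :=
    dependent_choice (fun j => gorenstein_projective_cover (gX j)).
  have [|m [q [ses _ _ _ _]]] := @dsum_ses _ _ _ _ _ i p; first by move=> j; have [] := pE j.
  exists (dsum P), (dsum Y), m, q; split=> //.
    by apply: dsum_projective => j; have [] := pE j.
  by exists I, Y; split=> // j; have [] := pE j.
- move=> _ Q [J [Y [-> gY]]] prQ; apply: ext1_dsum => i.
  exact: gorenstein_projective_ext1.
Qed.

End GorensteinProjectiveClosure.

(** * Countable telescopes *)


Section Telescope.
Variables (R : pzRingType) (Y : nat -> lmodType R) (a : forall n, {linear Y n -> Y n.+1}).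
Hypothesis inj_a : forall n, injective (a n).
Implicit Types (M Q T : lmodType R).

(** [tele_shift] is the identity minus the shift by [a], and its cokernel is the colimit of [Y].
    This presentation by direct sums is a conflation when the modules are Gorenstein-projective, so
    the stable category can handle it. *)
Record telescope := Telescope {
  tele_shift : {linear dsum Y -> dsum Y};
  tele_lim : lmodType R;
  tele_proj : {linear dsum Y -> tele_lim};
  tele_ses : short_exact tele_shift tele_proj;
  tele_shift0 : forall x, dproj 0%N (tele_shift x) = dproj 0%N x;
  tele_shiftS : forall n x,
    dproj n.+1 (tele_shift x) = dproj n.+1 x - a n (dproj n x);
  tele_shift_inj : forall n y,
    tele_shift (dinj n y) = dinj n y - dinj n.+1 (a n y)
}.

Lemma telescope_exists : exists t : telescope, True.
Proof.
have [s sE] := dsum_copair (fun n => dinj n - lin_comp (dinj n.+1) (a n)).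
have sE' n y : s (dinj n y) = dinj n y - dinj n.+1 (a n y) by rewrite sE.
have s0 x : dproj 0%N (s x) = dproj 0%N x.
  apply: (@dsum_lin_ext _ _ _ _ (lin_comp (dproj 0%N) s) (dproj 0%N)) => n y.
  rewrite -[LHS]/(dproj 0%N (s (dinj n y))) sE' linearB.
  by rewrite [X in _ - X]dproj_dinj_neq ?subr0.
have sS n x : dproj n.+1 (s x) = dproj n.+1 x - a n (dproj n x).
  apply: (@dsum_lin_ext _ _ _ _ (lin_comp (dproj n.+1) s)
    (dproj n.+1 - lin_comp (a n) (dproj n))) => m y.
  rewrite -[LHS]/(dproj n.+1 (s (dinj m y))) sE' linearB lin_subE; congr (_ - _).
  rewrite -[RHS]/(a n (dproj n (dinj m y))).
  have [mn|mn] := pselect (m = n); last first.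
    by rewrite !dproj_dinj_neq ?linear0 // => -[].
  by move: y; rewrite mn => y; rewrite !dproj_dinj.
have si : injective s.
  apply/inj0P => x sx; apply: dsum_ext => n; rewrite linear0.
  elim: n => [|n IH]; first by rewrite -s0 sx linear0.
  by have := sS n x; rewrite sx linear0 IH linear0 subr0 => <-.
by have [L [l ses]] := coker_exists si; exists (Telescope ses s0 sS sE').
Qed.

Lemma dproj_bounded (x : dsum Y) : exists m, forall n, (m < n)%N -> dproj n x = 0.
Proof.
have [s sP] := dproj_support x; exists (\max_(i <- s) i) => n mn.
apply: sP; apply/negP => ns.
by have := @leq_bigmax_seq {classic nat} s xpredT (fun i => i) n ns isT; rewrite leqNgt mn.
Qed.

Variable t : telescope.
Local Notation L := (tele_lim t).

Definition tele_in n : {linear Y n -> L} := lin_comp (tele_proj t) (dinj n).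

Lemma tele_inS n y : tele_in n.+1 (a n y) = tele_in n y.
Proof.
apply/esym/eqP; rewrite -subr_eq0 -[tele_in n y]/(tele_proj t (dinj n y)).
rewrite -[tele_in n.+1 _]/(tele_proj t (dinj n.+1 (a n y))) -linearB -(tele_shift_inj t).
by apply/eqP; exact: ses_comp (tele_ses t).
Qed.

(** If [dinj n y] is the image of [z] under [tele_shift], then [z] is zero below n, is [y] at n, and
    continues with the successive images of [y]; finite support makes one of these vanish. *)
Lemma tele_in_inj n : injective (tele_in n).
Proof.
have [_ ex _] := tele_ses t; apply/inj0P => y /(ex (dinj n y))[z zE].
have z0 j : (j < n)%N -> dproj j z = 0.
  elim: j => [|j IH] jn.
    by rewrite -(tele_shift0 t) zE dproj_dinj_neq // => n0; rewrite n0 in jn.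
  have := tele_shiftS t j z; rewrite zE IH ?(ltnW jn) // linear0 subr0 => <-.
  by rewrite dproj_dinj_neq // => nj; rewrite nj ltnn in jn.
have zn : dproj n z = y.
  case: n y zE z0 => [|n] y zE z0.
    by rewrite -(tele_shift0 t) zE dproj_dinj.
  by have := tele_shiftS t n z; rewrite zE (z0 n) // linear0 subr0 dproj_dinj.
have zS j : (n <= j)%N -> dproj j.+1 z = a j (dproj j z).
  move=> nj; apply/eqP; rewrite -subr_eq0 -(tele_shiftS t) zE.
  by rewrite dproj_dinj_neq // => e; rewrite e ltnn in nj.
have zk : exists k, dproj (k + n)%N z = 0.
  by have [m mP] := dproj_bounded z; exists m.+1; apply: mP; rewrite addSn ltnS leq_addr.
rewrite -zn; case: zk => k; elim: k => [|k IH] //.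
by rewrite addSn zS ?leq_addl // => e; apply: IH; apply: inj_a; rewrite e linear0.
Qed.

Lemma tele_transition n m : (n <= m)%N ->
  exists u : {linear Y n -> Y m}, forall y, tele_in m (u y) = tele_in n y.
Proof.
elim: m => [|m IH]; first by case: n => // _; exists (lin_id _).
rewrite leq_eqVlt => /orP[/eqP ->|/IH[u uE]]; first by exists (lin_id _).
by exists (lin_comp (a m) u) => y; rewrite -uE; exact: tele_inS.
Qed.

(** Degrees up to [m] are pushed forward to [Y m]; on higher degrees [u] is zero, whence the bound
    on the support of [x]. *)
Lemma tele_bounded m : exists u : {linear dsum Y -> Y m}, forall x,
  (forall n, (m < n)%N -> dproj n x = 0) -> tele_in m (u x) = tele_proj t x.
Proof.
have /dependent_choice[v vE] n : exists v : {linear Y n -> Y m},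
    (n <= m)%N -> forall y, tele_in m (v y) = tele_in n y.
  by have [/tele_transition[v vE]|_] := leqP n m; [exists v | exists lin_zero].
have [u uE] := dsum_copair v; exists u => x x0.
have [s us ->] := dsum_decomp x; rewrite !linear_sum; apply: eq_bigr => n _.
rewrite uE; have [nm|/x0 ->] := leqP n m; first by rewrite vE.
by rewrite !linear0.
Qed.

Lemma tele_in_surj x : exists n y, tele_in n y = x.
Proof.
have [_ _ /(_ x)[z <-]] := tele_ses t; have [m mP] := dproj_bounded z.
by have [u uE] := tele_bounded m; exists m, (u z); exact: uE.
Qed.

Lemma tele_copair T (w : forall n, {linear Y n -> T}) :
  (forall n y, w n.+1 (a n y) = w n y) ->
  exists v : {linear L -> T}, forall n y, v (tele_in n y) = w n y.
Proof.
move=> wS; have [h hE] := dsum_copair w.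
have [|v vE] := short_exact_descend (f := h) (tele_ses t).
  apply: (@dsum_lin_ext _ _ _ _ (lin_comp h (tele_shift t)) lin_zero) => n y /=.
  by rewrite tele_shift_inj linearB !hE wS subrr.
by exists v => n y; rewrite /= vE hE.
Qed.

(** The images of the generators come from a common stage [N], and injectivity of [tele_in N] makes
    the lift linear. *)
Lemma fin_gen_lands_tele M (h : {linear M -> L}) : fin_gen M ->
  exists n (h' : {linear M -> Y n}), forall x, tele_in n (h' x) = h x.
Proof.
move=> [m [e eE]]; have [n nE] := dependent_choice (fun j => tele_in_surj (h (e j))).
pose N := \max_j n j.
have /dependent_choice[y yE] j : exists y : Y N, tele_in N y = h (e j).
  have [y <-] := nE j; have [|u uE] := @tele_transition (n j) N; first exact: leq_bigmax.
  by exists (u y).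
exists N; apply: factor_inj; first exact: tele_in_inj.
move=> x; have [c ->] := eE x; exists (\sum_j c j *: y j).
by rewrite !linear_sum; apply: eq_bigr => j _; rewrite !linearZ_LR /= -yE.
Qed.

(** Every f on [dsum Y] must extend along [tele_shift]. This asks for maps g_n on [Y n] with g_n -
    g_(n+1) a_n = f_n; starting from g_0 = 0, they exist because the cokernel of [a n] has no Ext^1
    into [Q]. *)
Lemma gorenstein_projective_telescope :
  (forall n, gorenstein_projective (Y n)) ->
  (forall n, exists (D : lmodType R) (q : {linear Y n.+1 -> D}),
    short_exact (a n) q /\ gorenstein_projective D) ->
  gorenstein_projective L.
Proof.
move=> gY ses; apply: gorenstein_projective_coker (tele_ses t) _ _ _;
  try exact: gorenstein_projective_dsum.
move=> Q f prQ.
have step n (g : {linear Y n -> Q}) : exists g' : {linear Y n.+1 -> Q},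
    forall y, g' (a n y) = g y - f (dinj n y).
  have [D [q [sesn gD]]] := ses n.
  exact: gorenstein_projective_ext1 gD prQ _ _ _ _ (g - lin_comp f (dinj n)) sesn.
have [G GE] := dependent_choice (fun n => dependent_choice (step n)).
pose g := nat_rect (fun n => {linear Y n -> Q}) lin_zero G.
have gE n y : g n.+1 (a n y) = g n y - f (dinj n y) by exact: GE.
have [h hE] := dsum_copair g; exists h.
apply: (@dsum_lin_ext _ _ _ _ (lin_comp h (tele_shift t)) f) => n y /=.
by rewrite tele_shift_inj linearB !hE gE opprB addrC subrK.
Qed.

End Telescope.

(** * Duality and finitely generated Gorenstein-projective modules *)


Section Dual.
Variable R : pzRingType.
Implicit Types (A B C M Q : lmodType R).

Section DualModule.
Variable M : lmodType R.

Fact dual_scale_subproof (a : R^c) (f : {linear M -> R^o}) :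
  linear (fun x => (f x : R) * a : R^o).
Proof. by move=> c x y; rewrite linearP mulrDl -mulrA. Qed.
Definition dual_scale (a : R^c) (f : {linear M -> R^o}) : {linear M -> R^o} :=
  lin_of (dual_scale_subproof a f).

Fact dual_scaleA a b f : dual_scale a (dual_scale b f) = dual_scale (a * b) f.
Proof. by apply: linear_ext => x /=; rewrite -mulrA. Qed.
Fact dual_scale1 : left_id 1 dual_scale.
Proof. by move=> f; apply: linear_ext => x /=; rewrite mulr1. Qed.
Fact dual_scaleDr : right_distributive dual_scale +%R.
Proof. by move=> a f g; apply: linear_ext => x /=; rewrite mulrDl. Qed.
Fact dual_scaleDl f : {morph dual_scale^~ f : a b / a + b}.
Proof. by move=> a b; apply: linear_ext => x /=; rewrite mulrDr. Qed.

Definition dual : lmodType R^c := HB.pack {linear M -> R^o}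
  (GRing.Zmodule_isLmodule.Build R^c {linear M -> R^o}
    dual_scaleA dual_scale1 dual_scaleDr dual_scaleDl).

Definition app (f : dual) (x : M) : R := (f : {linear M -> R^o}) x.

Lemma dual_ext (f g : dual) : (forall x, app f x = app g x) -> f = g.
Proof. by move=> fg; exact: (@linear_ext R M R^o f g fg). Qed.

Lemma appD f g x : app (f + g) x = app f x + app g x.
Proof. by []. Qed.

Lemma app_sum I (r : seq I) (F : I -> dual) x :
  app (\sum_(i <- r) F i) x = \sum_(i <- r) app (F i) x.
Proof.
by elim: r => [|i r IH]; rewrite ?big_nil // !big_cons appD IH.
Qed.

Fact eval_linear x : linear (fun f : dual => app f x : R^c^o).
Proof. by []. Qed.
Definition eval x : {linear dual -> R^c^o} := lin_of (eval_linear x).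

End DualModule.

Fact dual_map_linear A B (i : {linear A -> B}) :
  linear (fun f : dual B => lin_comp (f : {linear B -> R^o}) i : dual A).
Proof. by move=> a f g; apply: linear_ext. Qed.
Definition dual_map A B (i : {linear A -> B}) : {linear dual B -> dual A} :=
  lin_of (dual_map_linear i).

Lemma app_dual_map A B (i : {linear A -> B}) f x : app (dual_map i f) x = app f (i x).
Proof. by []. Qed.

Lemma dual_ses A B C (i : {linear A -> B}) (p : {linear B -> C}) :
  short_exact i p -> ext1 C (R^o : lmodType R) -> short_exact (dual_map p) (dual_map i).
Proof.
move=> ses ext; have [ii iex ps] := ses; split=> [f g e|f|f].
- by apply: dual_ext => z; have [y <-] := ps z; rewrite -!app_dual_map e.
- split=> [fi|[g <-]]; last first.
    apply: dual_ext => x; rewrite !app_dual_map (ses_comp _ ses).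
    exact: (linear0 (g : {linear _ -> _})).
  have [|g gE] := short_exact_descend (f := (f : {linear B -> R^o})) ses.
    by move=> x; rewrite -[LHS]/(app (dual_map i f) x) fi.
  by exists g; apply: dual_ext => x; exact: gE.
- have [g gE] := ext _ _ i p f ses; exists g; apply: dual_ext; exact: gE.
Qed.

Definition coord m (j : 'I_m) : dual 'rV[R]_m.
Proof. by apply: (@lin_of R _ _ (fun v : 'rV[R]_m => v 0 j : R^o)) => a u v; rewrite !mxE. Defined.

Lemma app_coord m (j : 'I_m) v : app (coord j) v = v 0 j.
Proof. by []. Qed.

Lemma dual_row_sum m (f : dual 'rV[R]_m) :
  f = \sum_j (app f (delta_mx 0 j) : R^c) *: coord j.
Proof.
apply: dual_ext => v; rewrite app_sum {1}[v]row_sum /app linear_sum.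
by apply: eq_bigr => j _; rewrite linearZ_LR.
Qed.

Lemma dual_row_fin_gen m : fin_gen (dual 'rV[R]_m).
Proof. by exists m, (@coord m) => f; exists (fun j => app f (delta_mx 0 j)); exact: dual_row_sum. Qed.

Lemma dual_row_projective m : projective (dual 'rV[R]_m).
Proof.
move=> A B p f ps; have [a aE] := choice (fun j => ps (f (coord j))).
have lin_g : linear (fun u : dual 'rV[R]_m =>
    \sum_j (eval (delta_mx 0 j) u : R^c) *: a j).
  move=> c u v; rewrite scaler_sumr -big_split; apply: eq_bigr => j _.
  by rewrite linearP scalerDl scalerA.
exists (lin_of lin_g) => u; rewrite {2}[u]dual_row_sum !linear_sum.
by apply: eq_bigr => j _; rewrite !linearZ aE.
Qed.

Lemma dual_row_reflexive m (f : {linear dual 'rV[R]_m -> R^c^o}) :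
  exists v, forall u, f u = app u v.
Proof.
exists (\row_j (f (coord j) : R)) => u; rewrite {1}[u]dual_row_sum linear_sum.
rewrite [X in app u X]row_sum /app linear_sum; apply: eq_bigr => j _.
by rewrite !linearZ mxE.
Qed.

Lemma dual_fin_gen M : left_noetherian R^c -> fin_gen M -> fin_gen (dual M).
Proof.
move=> noeth /fin_gen_rowP[m [p ps]].
apply: (@fin_gen_sub _ noeth _ _ (dual_map p)); last exact: dual_row_fin_gen.
by move=> f g e; apply: dual_ext => z; have [y <-] := ps z; rewrite -!app_dual_map e.
Qed.

(** The coordinates of [phi] generate the dual of [M]. A map to a projective module factors through
    some R^k, and its coordinates there are combinations of those of [phi]. *)
Lemma left_approximation M : left_noetherian R^c -> fin_gen M ->
  exists m (phi : {linear M -> 'rV[R]_m}), forall Q (f : {linear M -> Q}), projective Q ->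
    exists g : {linear 'rV[R]_m -> Q}, forall x, g (phi x) = f x.
Proof.
move=> noeth fgM; have [m [e eE]] := dual_fin_gen noeth fgM.
have lin_phi : linear (fun x => \row_j app (e j) x).
  by move=> a x y; apply/rowP => j; rewrite !mxE /app linearP.
exists m, (lin_of lin_phi) => Q f prQ.
have [k [u [v uv]]] := fin_gen_factor_row f fgM prQ.
have /dependent_choice[c cE] (i : 'I_k) : exists c : 'I_m -> R, forall x,
    u x 0 i = \sum_j app (e j) x * c j.
  have [c cE] := eE (dual_map u (coord i)); exists c => x.
  by rewrite -app_coord -app_dual_map cE app_sum.
exists (lin_comp v (row_map (fun j => \row_i c i j))) => x /=; rewrite -uv; congr (v _).
apply/rowP => i; rewrite cE summxE; apply: eq_bigr => j _.
by rewrite !mxE.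
Qed.

End Dual.
Arguments coord {R m} j.

Section Syzygies.
Variable R : pzRingType.
Implicit Types (A B C D E K L M N P Q X Y U V W : lmodType R).

(** Along such a chain, Ext^1(C, Z j) is Ext^(j+1)(C, Z 0). *)
Definition cosyzygy_chain (Z : nat -> lmodType R) : Prop :=
  forall j, exists E (i : {linear Z j -> E}) (q : {linear E -> Z j.+1}),
    injective_module E /\ short_exact i q.

Lemma finite_injective_dimension_chain M : finite_injective_dimension M ->
  exists n (Z : nat -> lmodType R),
    [/\ Z 0%N = M, cosyzygy_chain Z & forall j, (n <= j)%N -> injective_module (Z j)].
Proof.
move=> [n [E [e [d [[ei eex dex] injE E0]]]]].
(* For j > 0 the cosyzygy is the kernel of [d j] in [E j]. As [E j] is zero for j > n, injectivity
   is guaranteed from n + 1 on. *)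
exists n.+1, (fun j => if j is j'.+1 then ker_mod (d j'.+1) else M); split=> //.
- case=> [|j].
    have [|q qE] := @factor_inj _ _ _ (E 0%N) (ker_incl (d 1%N)) (d 0%N) val_inj.
      by move=> x; apply/ker_inclP/dex; exists x.
    exists (E 0%N), e, q; split=> //; split=> // y.
      split=> [qy|/eex dy]; first by apply/eex; rewrite -qE qy linear0.
      by apply: val_inj; rewrite -[LHS]/(ker_incl (d 1%N) (q y)) qE dy.
    have /dex[x xE] : d 1%N (ker_incl (d 1%N) y) = 0 by apply/ker_inclP; exists y.
    by exists x; apply: val_inj; rewrite -[LHS]/(ker_incl (d 1%N) (q x)) qE xE.
  have [|q qE] := @factor_inj _ _ _ (E j.+1) (ker_incl (d j.+2)) (d j.+1) val_inj.
    by move=> x; apply/ker_inclP/dex; exists x.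
  exists (E j.+1), (ker_incl (d j.+1)), q; split=> //; split=> [x y /val_inj //|y|y].
    rewrite -ker_inclP -qE; split=> [->|e0]; first by rewrite linear0.
    by apply: val_inj; rewrite -[LHS]/(ker_incl (d j.+2) (q y)) e0.
  have /dex[x xE] : d j.+2 (ker_incl (d j.+2) y) = 0 by apply/ker_inclP; exists y.
  by exists x; apply: val_inj; rewrite -[LHS]/(ker_incl (d j.+2) (q x)) qE xE.
- case=> // j nj A B i f _; exists lin_zero => x.
  by apply: val_inj; exact: etrans (E0 _ nj _) (esym (E0 _ nj _)).
Qed.

(** The recursion removes the step next to [K], the one along which Ext^1 is shifted first. *)
Fixpoint syzygy n K N : Prop :=
  if n is n'.+1 then exists K' P (k : {linear K -> P}) (p : {linear P -> K'}),
    [/\ projective P, short_exact k p & syzygy n' K' N]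
  else K = N.

Lemma ext1_syzygy (Z : nat -> lmodType R) n j K N : cosyzygy_chain Z ->
  syzygy n K N -> ext1 N (Z (n + j)%N) -> ext1 K (Z j).
Proof.
move=> chainZ; elim: n j K => [|n IH] j K; first by move=> ->.
move=> [K' [P [k [p [prP ses sK']]]]] ext.
have [E [i [q [injE ses']]]] := chainZ j.
apply: (ext1_shift_syzygy ses prP ses'); first exact: ext1_injective.
by apply: IH sK' _; rewrite addnS.
Qed.

(** A map from the finitely generated kernel [K] to [Q] passes through some R^l, and its coordinates
    extend one by one. *)
Lemma ext1_fin_gen_projective C Q : left_noetherian R -> fin_gen C ->
  ext1 C (R^o : lmodType R) -> projective Q -> ext1 C Q.
Proof.
move=> noeth fgC ext prQ.
have [m [K [k [p [ses fgK]]]]] := fin_gen_cover noeth fgC.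
apply: (ext1_ses ses) => [|f]; first exact: row_projective.
have [l [u [v uv]]] := fin_gen_factor_row f fgK prQ.
have [g gE] := dependent_choice (fun j => ext _ _ k p
  (lin_comp (coord j : {linear 'rV[R]_l -> R^o}) u) ses).
have lin_h : linear (fun x => \row_(j < l) (g j x : R)).
  by move=> a x y; apply/rowP => j; rewrite !mxE linearP.
exists (lin_comp v (lin_of lin_h)) => x; rewrite -uv /=; congr (v _).
by apply/rowP => j; rewrite mxE gE.
Qed.

End Syzygies.

(** * Embedding finitely generated modules orthogonal to R into free modules *)

Section TorsionlessSyzygies.
Variable R : pzRingType.
Hypotheses (noethR : left_noetherian R) (noethRc : left_noetherian R^c).
Variables (Z : nat -> lmodType R) (Zc : nat -> lmodType R^c) (nc : nat).
Hypotheses (Z0 : Z 0%N = R^o) (chainZ : cosyzygy_chain Z).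
Hypotheses (Zc0 : Zc 0%N = R^c^o) (chainZc : cosyzygy_chain Zc).
Hypothesis injZc : forall j, (nc <= j)%N -> injective_module (Zc j).
Implicit Types (C K M N Q : lmodType R).

(** As the [Z j] are the cosyzygies of R, the second condition says Ext^i(C, R) = 0 for all i >=
    1. *)
Definition fg_ext_perp C : Prop := fin_gen C /\ forall j, ext1 C (Z j).

Lemma fg_ext_perp_cover C : fg_ext_perp C ->
  exists m K (k : {linear K -> 'rV[R]_m}) (p : {linear 'rV[R]_m -> C}),
    short_exact k p /\ fg_ext_perp K.
Proof.
move=> [fgC extC]; have [m [K [k [p [ses fgK]]]]] := fin_gen_cover noethR fgC.
exists m, K, k, p; split=> //; split=> // j.
have [E [i [q [injE ses']]]] := chainZ j.
by apply: (ext1_shift_syzygy ses _ ses'); [exact: row_projective|exact: ext1_injective|].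
Qed.

(** Dualising a free cover of [C] with kernel [K] makes the dual of [C] a syzygy of the dual of [K].
    This trades [Zc j] for [Zc j.+1], and after enough steps [Zc] is injective. *)
Lemma fg_ext_perp_dual C j : fg_ext_perp C -> ext1 (dual C) (Zc j).
Proof.
have [i ij] : exists i, (nc <= i + j)%N by exists nc; exact: leq_addr.
elim: i j C ij => [|i IH] j C ij perpC; first by apply: ext1_injective; exact: injZc.
have [m [K [k [p [ses perpK]]]]] := fg_ext_perp_cover perpC.
have extC : ext1 C (R^o : lmodType R) by rewrite -Z0; exact: perpC.2.
have [E [e [q [injE ses']]]] := chainZc j.
apply: (ext1_shift_syzygy (dual_ses ses extC) _ ses'); first exact: dual_row_projective.
  exact: ext1_injective.
by apply: IH => //; rewrite addnS.
Qed.

(* With F1 -> F -> C -> 0 a presentation, evaluation at v in F induces a functional on *)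
(* the dual of the first syzygy K; as Ext^1 of the dual of the second syzygy vanishes, *)
(* it extends to the dual of F1, so v comes from F1. *)
Lemma fg_ext_perp_torsionless C c :
  fg_ext_perp C -> (forall f : {linear C -> R^o}, f c = 0) -> c = 0.
Proof.
move=> perpC fc0.
have [m [K [k [p [ses perpK]]]]] := fg_ext_perp_cover perpC.
have [m1 [K1 [k1 [p1 [ses1 perpK1]]]]] := fg_ext_perp_cover perpK.
have extR (M : lmodType R) : fg_ext_perp M -> ext1 M (R^o : lmodType R).
  by rewrite -Z0 => -[_]; apply.
have [_ _ /(_ c)[v vE]] := ses.
have [|phi phiE] := short_exact_descend (f := eval v) (dual_ses ses (extR _ perpC)).
  by move=> f; rewrite -[LHS]/(app f (p v)) vE; exact: fc0.
have extK1 : ext1 (dual K1) (R^c^o : lmodType R^c).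
  by rewrite -Zc0; exact: fg_ext_perp_dual.
have [psi psiE] := extK1 _ _ _ _ phi (dual_ses ses1 (extR _ perpK)).
have [w wE] := dual_row_reflexive psi.
rewrite -vE; have -> : v = k (p1 w).
  apply/rowP => j; rewrite -!app_coord -[LHS]/(eval v (coord j)) -phiE -psiE wE.
  by rewrite !app_dual_map.
exact: ses_comp ses.
Qed.

(** The approximation is injective because [C] is torsionless; its extension property gives
    Ext^1(C', R) = 0, and the later cosyzygies follow by shifting. *)
Lemma fg_ext_perp_embed C : fg_ext_perp C ->
  exists m C' (k : {linear C -> 'rV[R]_m}) (p : {linear 'rV[R]_m -> C'}),
    short_exact k p /\ fg_ext_perp C'.
Proof.
move=> perpC; have [m [phi phiP]] := left_approximation noethRc perpC.1.
have phi_inj : injective phi.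
  apply/inj0P => c phic; apply: fg_ext_perp_torsionless perpC _ => f.
  by have [g <-] := phiP _ f (@regular_projective R); rewrite phic linear0.
have [C' [p ses]] := coker_exists phi_inj; have [_ _ ps] := ses.
exists m, C', phi, p; split=> //; split; first exact: fin_gen_surj ps (fin_gen_row _ _).
case=> [|j].
  apply: (ext1_ses ses) => [|f]; first exact: row_projective.
  by apply: phiP; rewrite Z0; exact: regular_projective.
have [E [e [q [injE ses']]]] := chainZ j.
apply: (ext1_shift_cosyzygy ses _ ses'); first exact: row_projective.
  exact: ext1_injective.
exact: perpC.2.
Qed.

Lemma fg_ext_perp_gproj C : fg_ext_perp C -> gorenstein_projective C.
Proof.
apply: gorenstein_projective_coind => {C} [C perpC|C perpC|C Q perpC prQ].
- have [m [C' [k [p [ses perpC']]]]] := fg_ext_perp_embed perpC.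
  by exists 'rV[R]_m, C', k, p; split=> //; exact: row_projective.
- have [m [K [k [p [ses perpK]]]]] := fg_ext_perp_cover perpC.
  by exists 'rV[R]_m, K, k, p; split=> //; exact: row_projective.
- apply: ext1_fin_gen_projective => //; first exact: perpC.1.
  by rewrite -Z0; exact: perpC.2.
Qed.

End TorsionlessSyzygies.

(** * Finitely generated Gorenstein-projective modules *)

Section FinGenGorensteinProjective.
Variable R : pzRingType.
Implicit Types (A B C D E K L M N P Q X Y U V W : lmodType R).

Definition fg_gproj M : Prop := fin_gen M /\ gorenstein_projective M.

(** From index [n] on the cosyzygies of the left module R are injective, so dimension shifting gives
    Ext^1(K, Z j) = 0 for every j. *)
Lemma gorenstein_ring_syzygy : gorenstein_ring R ->
  exists n, forall N K, syzygy n K N -> fin_gen K -> gorenstein_projective K.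
Proof.
move=> [noethR noethRc /finite_injective_dimension_chain[n [Z [Z0 chainZ injZ]]]
  /finite_injective_dimension_chain[nc [Zc [Zc0 chainZc injZc]]]].
exists n => N K sK fgK.
apply: (fg_ext_perp_gproj noethR noethRc Z0 chainZ Zc0 chainZc injZc); split=> // j.
by apply: ext1_syzygy chainZ sK _; apply/ext1_injective/injZ; exact: leq_addr.
Qed.

Hypothesis gorR : gorenstein_ring R.

Let noethR : left_noetherian R. Proof. by case: gorR. Qed.
Let noethRc : left_noetherian R^c. Proof. by case: gorR. Qed.

Lemma fg_gproj_cover M : fg_gproj M ->
  exists m K (k : {linear K -> 'rV[R]_m}) (p : {linear 'rV[R]_m -> M}),
    short_exact k p /\ fg_gproj K.
Proof.
move=> [fgM gM]; have [m [K [k [p [ses fgK]]]]] := fin_gen_cover noethR fgM.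
exists m, K, k, p; split=> //; split=> //.
by apply: gorenstein_projective_kernel ses _ gM; apply/projective_gproj/row_projective.
Qed.

(** An embedding of [M] in a projective module factors through the approximation [phi], which is
    therefore injective; its extension property makes the cokernel Gorenstein-projective. *)
Lemma fg_gproj_embed M : fg_gproj M ->
  exists m M' (k : {linear M -> 'rV[R]_m}) (p : {linear 'rV[R]_m -> M'}),
    short_exact k p /\ fg_gproj M'.
Proof.
move=> [fgM gM]; have [m [phi phiP]] := left_approximation noethRc fgM.
have [P [Z [s [r [prP _ [si _ _]]]]]] := gorenstein_projective_embed gM.
have phi_inj : injective phi.
  apply/inj0P => c phic; apply: si; have [g gE] := phiP _ s prP.
  by rewrite -gE phic !linear0.
have [M' [p ses]] := coker_exists phi_inj; have [_ _ ps] := ses.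
exists m, M', phi, p; split=> //; split; first exact: fin_gen_surj ps (fin_gen_row _ _).
apply: gorenstein_projective_coker ses gM _ phiP.
by apply/projective_gproj/row_projective.
Qed.

(** The last clause is Ext^(j+1)(M, B) = 0 computed on this resolution, in the form used by
    [ext_succ_vanishes]. *)
Lemma fg_gproj_resolution M : fg_gproj M ->
  exists (Q : nat -> lmodType R) (d : forall n, {linear Q n.+1 -> Q n})
         (e : {linear Q 0%N -> M}),
    [/\ left_resolution d e, forall n, fg_projective (Q n)
      & forall B, projective B -> forall j (f : {linear Q j.+1 -> B}),
          (forall x, f (d j.+1 x) = 0) ->
          exists g : {linear Q j -> B}, forall x, f x = g (d j x)].
Proof.
move=> gM; pose st := {M : lmodType R | fg_gproj M}.
pose rel (s t : st) := exists m (k : {linear sval t -> 'rV[R]_m})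
  (p : {linear 'rV[R]_m -> sval s}), short_exact k p.
have [F FE] : exists F : st -> st, forall s, rel s (F s).
  apply: (@dependent_choice _ _ rel) => -[X gX].
  have [m [K [k [p [ses gK]]]]] := fg_gproj_cover gX.
  by exists (exist _ K gK), m, k, p.
pose S n := iter n F (exist _ M gM); pose Z n := sval (S n).
have [m /dependent_choice[k /dependent_choice[p ses]]] :=
  dependent_choice (fun n => FE (S n)).
pose Q n : lmodType R := 'rV[R]_(m n).
pose d n : {linear Q n.+1 -> Q n} := lin_comp (k n) (p n.+1).
have dex n : exact_at (d n) (p n).
  have [_ ex _] := ses n; have [_ _ ps] := ses n.+1.
  move=> y; split=> [/ex[x <-]|[x <-]]; last by rewrite /= (ses_comp _ (ses n)).
  by have [z <-] := ps x; exists z.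
exists Q, d, (p 0%N); split=> [|n|B prB j f fd].
- split=> [||n]; [by have [] := ses 0%N|exact: dex|].
  move=> y; split=> [/= dy|/dex py]; last by rewrite /= py linear0.
  by apply/dex; have [ki _ _] := ses n; apply: ki; rewrite dy linear0.
- exact: row_fg_projective.
- have [|g gE] := short_exact_descend (f := f) (ses j.+1).
    move=> x; have [_ _ /(_ x)[z <-]] := ses j.+2; exact: fd.
  have [h hE] := gorenstein_projective_ext1 (svalP (S j)).2 prB g (ses j).
  by exists h => x; rewrite -gE -hE.
Qed.

Lemma fg_gproj_coker_ext A B C (f : {linear A -> B}) (q : {linear B -> C}) :
  surjective q -> exact_at f q -> fg_gproj C -> coker_ext_vanishes f.
Proof.
move=> qs fq gC; exists C, q; split=> // P [prP _] j.
have [Q [d [e [res prQ ext]]]] := fg_gproj_resolution gC.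
by exists Q, d, e; split=> // [n|]; [have [] := prQ n | exact: ext].
Qed.

Lemma fg_gprojP M : fg_gproj M -> fg_gorenstein_projective M.
Proof.
move=> gM; split.
  by have [Q [d [e [res fgQ _]]]] := fg_gproj_resolution gM; exists Q, d, e.
pose st := {M : lmodType R | fg_gproj M}.
pose rel (s t : st) := exists m (k : {linear sval s -> 'rV[R]_m})
  (p : {linear 'rV[R]_m -> sval t}), short_exact k p.
have [F FE] : exists F : st -> st, forall s, rel s (F s).
  apply: (@dependent_choice _ _ rel) => -[X gX].
  have [m [K [k [p [ses gK]]]]] := fg_gproj_embed gX.
  by exists (exist _ K gK), m, k, p.
pose S n := iter n F (exist _ M gM); pose Z n := sval (S n).
have [m /dependent_choice[k /dependent_choice[p ses]]] :=
  dependent_choice (fun n => FE (S n)).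
pose P n : lmodType R := 'rV[R]_(m n).
pose d n : {linear P n -> P n.+1} := lin_comp (k n.+1) (p n).
have kd n : exact_at (k n) (d n).
  have [_ ex _] := ses n; have [ki _ _] := ses n.+1.
  move=> y; split=> [/= dy|/ex py]; last by rewrite /= py linear0.
  by apply/ex/ki; rewrite dy linear0.
exists P, (k 0%N), d; split=> [|n||n].
- split=> [||n]; [by have [] := ses 0%N|exact: kd|].
  move=> y; have [_ _ ps] := ses n; split=> [/kd[x <-]|[x <-]].
    by have [z <-] := ps x; exists z.
  by rewrite /= (ses_comp _ (ses n.+1)) linear0.
- exact: row_fg_projective.
- have [_ ex ps] := ses 0%N.
  exact: fg_gproj_coker_ext ps ex (svalP (S 1%N)).
- have [_ ex ps] := ses n.+1; have [_ _ ps'] := ses n.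
  apply: fg_gproj_coker_ext ps _ (svalP (S n.+2)) => y.
  split=> [/ex[x <-]|[x <-]]; last by rewrite /= (ses_comp _ (ses n.+1)).
  by have [z <-] := ps' x; exists z.
Qed.

Lemma fg_gorenstein_projective_fin_gen M : fg_gorenstein_projective M -> fin_gen M.
Proof.
move=> [[Q [d [e [[es _ _] fgQ]]]] _]; have [_ fgQ0] := fgQ 0%N.
exact: fin_gen_surj es fgQ0.
Qed.

Lemma fg_gproj_extension A B C (i : {linear A -> B}) (p : {linear B -> C}) :
  short_exact i p -> fg_gproj A -> fg_gproj C -> fg_gproj B.
Proof.
move=> ses [fgA gA] [fgC gC]; split; first exact: fin_gen_extension ses fgA fgC.
exact: gorenstein_projective_extension ses gA gC.
Qed.

End FinGenGorensteinProjective.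

(** * Injective modules and detection of projectivity *)


Section InjectiveModules.
Variable R : pzRingType.
Implicit Types (A B C D E K L M N P Q W X Y Z : lmodType R).

Lemma baer_criterion M :
  (forall C (q : {linear R^o -> C}), surjective q -> ext1 C M) -> injective_module M.
Proof.
move=> baer A B i f ii.
pose good (G : set (B * M)) := [/\ forall a, G (i a, f a),
  forall c u v, G u -> G v -> G (c *: u + v) & forall m, G (0, m) -> m = 0].
pose P (G : set (B * M)) := (exists u, G u) -> good G.
have [F FP Ftot|G [PG maxG]] := @Zorn_bigcup _ P.
  move=> [u [X FX Xu]].
  have goodE (S : set (B * M)) v : F S -> S v -> good S by move=> /FP PS Sv; apply: PS; exists v.
  split=> [a|c v w [S FS Sv] [T FT Tw]|m [S FS Sm]].
  - by exists X => //; have [+ _ _] := goodE _ _ FX Xu; apply.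
  - have [_ lS _] := goodE _ _ FS Sv; have [_ lT _] := goodE _ _ FT Tw.
    have [ST|TS] := Ftot _ _ FS FT.
      by exists T => //; apply: lT => //; exact: ST.
    by exists S => //; apply: lS => //; exact: TS.
  - by have [_ _ +] := goodE _ _ FS Sm; apply.
have [Gf Glin G0] : good G.
  apply: PG; apply: contrapT => G0.
  refine (maxG (fun u : B * M => exists a, u = (i a, f a)) _ _).
    split=> [u Gu|h]; first by case: G0; exists u.
    by case: G0; exists (i 0, f 0); apply: h; exists 0.
  move=> _; split=> [a|c u v [a ->] [b ->]|m [a [e ->]]]; first by exists a.
    by exists (c *: a + b); rewrite !linearP.
  by rewrite (_ : a = 0) ?linear0 //; apply: ii; rewrite linear0.
have G00 : G 0 by have := Gf 0; rewrite !linear0.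
have GZ c u : G u -> G (c *: u) by move=> Gu; rewrite -[_ *: _]addr0; exact: Glin.
have GD u v : G u -> G v -> G (u + v) by move=> Gu Gv; rewrite -[u]scale1r; exact: Glin.
have GB u v : G u -> G v -> G (u - v).
  by move=> Gu Gv; rewrite addrC -scaleN1r; exact: Glin.
have Gfun b m m' : G (b, m) -> G (b, m') -> m = m'.
  move=> Gm Gm'; apply/eqP; rewrite -subr_eq0; apply/eqP/G0.
  have := GB _ _ Gm Gm'; congr (G _); congr (_, _) => /=; exact: subrr.
have dom b : exists m, G (b, m).
  (* For the ideal of all r with r b in the domain of [G], the partial map r |-> G(r b) extends to R
     by hypothesis; its value at 1 serves as the image of [b]. *)
  have [||C [q [qs qE]]] := @quotient_exists R R^o (fun r => exists m, G ((r : R) *: b, m)).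
  - by exists 0; rewrite scale0r.
  - move=> c r s [m Gm] [n Gn]; exists (c *: m + n).
    have := Glin c _ _ Gm Gn; congr (G _); congr (_, _).
    by rewrite /= scalerDl -scalerA.
  have [|||g gE] := @lin_relP R (ker_mod q) M (fun r m => G ((ker_incl q r : R) *: b, m)).
  - by move=> r; apply/qE/ker_inclP; exists r.
  - by move=> r m m'; exact: Gfun.
  - move=> c r r' m m' Gm Gm'; have := Glin c _ _ Gm Gm'; congr (G _); congr (_, _).
    by rewrite linearP /= scalerDl -scalerA.
  have [h hE] := baer C q qs _ _ (ker_incl q) q g (ker_ses qs).
  have ext r m : G (r *: b, m) -> m = r *: h (1 : R^o).
    move=> Gr; have /ker_inclP[z zE] : q (r : R^o) = 0 by apply/qE; exists m.
    have := gE z; rewrite -hE zE => /(Gfun _ _ _ Gr) ->.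
    by rewrite -linearZ; congr (h _); exact: esym (mulr1 _).
  pose G' : set (B * M) := fun u => exists v r, G v /\ u = v + (r *: b, r *: h (1 : R^o)).
  apply: contrapT => nb; refine (maxG G' _ _).
    split=> [u Gu|h']; first by exists u, 0; rewrite !scale0r; split=> //; rewrite addr0.
    apply: nb; exists (h (1 : R^o)); apply: h'; exists 0, 1.
    by rewrite !scale1r add0r.
  move=> _; split=> [a|c _ _ [u [r [Gu ->]]] [v [s [Gv ->]]]|m [[x y] [r [Gu]]]].
  - by exists (i a, f a), 0; rewrite !scale0r; split=> //; rewrite addr0.
  - exists (c *: u + v), (c * r + s); split; first exact: Glin.
    rewrite scalerDr addrACA; congr (_ + _); congr (_, _);
      by rewrite /= scalerDl scalerA.
  - move=> [e1 e2]; have e : - x = r *: b by apply/eqP; rewrite eq_sym -addr_eq0 addrC -e1.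
    have /ext yE : G (r *: b, - y).
      by rewrite -e; have := GZ (-1) _ Gu; rewrite scaleN1r.
    by rewrite e2 -yE subrr.
have [|||g gE] := @lin_relP R B M (fun b m => G (b, m)) => //.
  by move=> c b b' m m' Gm Gm'; exact: Glin c _ _ Gm Gm'.
by exists g => a; apply: Gfun (gE _) (Gf a).
Qed.

Lemma fin_gen_regular : fin_gen (R^o : lmodType R).
Proof.
exists 1%N, (fun _ => 1 : R^o) => x; exists (fun _ => x).
by rewrite big_ord1; exact: esym (mulr1 _).
Qed.

(** A left ideal is finitely generated, so a map from it to the direct sum meets finitely many
    summands, and Baer's criterion applies. *)
Lemma dsum_injective (I : small) (E : I -> lmodType R) : left_noetherian R ->
  (forall i, injective_module (E i)) -> injective_module (dsum E).
Proof.
move=> noeth injE; apply: baer_criterion => C q qs.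
apply: (ext1_ses (ker_ses qs)) => [|f]; first exact: regular_projective.
have fgK : fin_gen (ker_mod q).
  apply: (@fin_gen_sub _ noeth _ _ (ker_incl q)); [exact: val_inj | exact: fin_gen_regular].
have [s sP] := fin_gen_lands_dsum f fgK.
(* Taking zero outside [s] keeps the family of extensions finitely supported. *)
have /dependent_choice[g gE] (i : I) : exists g : {linear R^o -> E i},
    (forall x, g (ker_incl q x) = dproj i (f x)) /\
    ((i : {classic I}) \notin s -> forall x, g x = 0).
  have [si|si] := boolP ((i : {classic I}) \in s).
    by have [g gE] := injE i _ _ (ker_incl q) (lin_comp (dproj i) f) val_inj; exists g.
  by exists lin_zero; split=> // x; rewrite sP.
have [|h hE] := @dsum_tuple _ _ _ R^o g.
  by move=> w; exists s => i /(gE i).2.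
by exists h => x; apply: dsum_ext => i; rewrite hE (gE i).1.
Qed.

Lemma pair_injective E1 E2 :
  injective_module E1 -> injective_module E2 -> injective_module (E1 * E2)%type.
Proof.
move=> inj1 inj2 A B i f ii.
have [g gE] := inj1 _ _ i (lin_comp (lin_fst _ _) f) ii.
have [h hE] := inj2 _ _ i (lin_comp (lin_snd _ _) f) ii.
by exists (lin_pair g h) => x; rewrite /= gE hE /=; case: (f x).
Qed.

(** Such coresolutions are carried over from R to Gorenstein-projective modules by direct sums,
    complements and conflations; only finitely many steps are ever requested. *)
Fixpoint injective_coresolvable n M : Prop :=
  if n is n'.+1 then exists E Z (i : {linear M -> E}) (q : {linear E -> Z}),
    [/\ injective_module E, short_exact i q & injective_coresolvable n' Z]
  else True.
Local Notation cores := injective_coresolvable.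

Lemma cores_chain (Z : nat -> lmodType R) n j : cosyzygy_chain Z -> cores n (Z j).
Proof.
move=> chainZ; elim: n j => //= n IH j; have [E [i [q [injE ses]]]] := chainZ j.
by exists E, (Z j.+1), i, q.
Qed.

Lemma cores_extension n A B C (i : {linear A -> B}) (p : {linear B -> C}) :
  short_exact i p -> cores n A -> cores n C -> cores n B.
Proof.
elim: n A B C i p => //= n IH A B C i p ses.
move=> [EA [ZA [e [q [injA sesA cA]]]]] [EC [ZC [e' [q' [injC sesC cC]]]]].
have [ii _ _] := ses; have [F FE] := injA _ _ i e ii.
have [Z [c [a [b [ses1 ses2]]]]] := horseshoe_embed ses sesA sesC FE.
exists (EA * EC)%type, Z, (lin_pair F (lin_comp e' p)), c; split=> //.
  exact: pair_injective.
exact: IH ses2 cA cC.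
Qed.

(** [A] embeds in the injective module chosen for [B], with cokernel an extension of [Z] by [C]. *)
Lemma cores_sub n A B C (i : {linear A -> B}) (p : {linear B -> C}) :
  short_exact i p -> cores n.+1 B -> cores n C -> cores n.+1 A.
Proof.
move=> ses [E [Z [e [q [injE ses' cZ]]]]] cC.
have [W [c [a [b [ses1 ses2]]]]] := ses_third ses ses'.
by exists E, W, (lin_comp e i), c; split=> //; exact: cores_extension ses2 cC cZ.
Qed.

Lemma cores_dsum n (I : small) (X : I -> lmodType R) : left_noetherian R ->
  (forall i, cores n (X i)) -> cores n (dsum X).
Proof.
move=> noeth; elim: n X => //= n IH X cX.
have [E /dependent_choice[Z /dependent_choice[i /dependent_choice[q qE]]]] :=
  dependent_choice cX.
have [|m [p [ses _ _ _ _]]] := @dsum_ses _ _ _ _ _ i q; first by move=> j; have [] := qE j.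
exists (dsum E), (dsum Z), m, p; split=> //.
  by apply: dsum_injective => // j; have [] := qE j.
by apply: IH => j; have [] := qE j.
Qed.

Lemma retract_projective P Q (s : {linear P -> Q}) (r : {linear Q -> P}) :
  (forall x, r (s x) = x) -> projective Q -> projective P.
Proof.
move=> rs prQ A B p f ps; have [g gE] := prQ _ _ p (lin_comp f r) ps.
by exists (lin_comp g s) => x; rewrite /= gE /= rs.
Qed.

(** [P] has a projective complement in a free module, and the complement needs one step less. *)
Lemma cores_projective n P : left_noetherian R -> cores n (R^o : lmodType R) ->
  projective P -> cores n P.
Proof.
move=> noeth; elim: n P => // n IH P cR prP.
have cR' : cores n (R^o : lmodType R).
  elim: n (R^o : lmodType R) cR {IH prP P} => // n IH M [E [Z [i [q [injE ses cZ]]]]].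
  by exists E, Z, i, q; split=> //; exact: IH.
have [I [s [r rs]]] := projective_retract_free prP.
have [|p pE] := @factor_inj _ _ _ (free_mod R I) (ker_incl r) (lin_id _ - lin_comp s r) val_inj.
  by move=> x; apply/ker_inclP; rewrite lin_subE linearB /= rs subrr.
have rker x : r (ker_incl r x) = 0 by apply/ker_inclP; exists x.
have pK x : p (ker_incl r x) = x.
  apply: val_inj; rewrite -[LHS]/(ker_incl r (p _)) pE lin_subE /= -/(ker_incl r x).
  by rewrite -[val x]/(ker_incl r x) rker linear0 subr0.
apply: (@cores_sub n P (free_mod R I) (ker_mod r) s p); last 2 first.
- exact: cores_dsum.
- by apply: IH => //; apply: retract_projective pK _; exact: free_mod_projective.
split=> [x y e|x|y]; last by exists (ker_incl r y).
  by rewrite -(rs x) e rs.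
split=> [px|[y <-]].
  have := pE x; rewrite px linear0 lin_subE /= => /esym/eqP; rewrite subr_eq0 => /eqP xE.
  by exists (r x).
by apply: val_inj; rewrite -[LHS]/(ker_incl r (p _)) pE lin_subE /= rs subrr.
Qed.

Lemma cores_gproj n M : left_noetherian R -> (forall k, cores k (R^o : lmodType R)) ->
  gorenstein_projective M -> cores n M.
Proof.
move=> noeth cR; elim: n M => // n IH M gM.
have [P [Y [i [p [prP gY ses]]]]] := gorenstein_projective_embed gM.
by apply: cores_sub ses _ _; [exact: cores_projective | exact: IH].
Qed.

(* Dimension shifting moves Ext^1 of n-th syzygies to Ext^1 into the n-th cosyzygy, which *)
(* Baer's criterion shows to be injective. *)
Lemma ext1_syzygy_cyclic n M : left_noetherian R -> cores n M ->
  (forall C (q : {linear R^o -> C}) K, surjective q -> syzygy n K C -> fin_gen K ->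
    ext1 K M) ->
  forall W K, syzygy n K W -> ext1 K M.
Proof.
move=> noeth; elim: n M => [|n IH] M.
  move=> _ hM W K ->; apply/ext1_injective/baer_criterion => C q qs.
  exact: hM qs erefl (fin_gen_surj qs fin_gen_regular).
move=> [E [Z [i [q [injE ses cZ]]]]] hM W K [K' [P [k [p [prP ses' sK']]]]].
apply: (ext1_shift_syzygy ses' prP ses); first exact: ext1_injective.
apply: IH sK' => // C r L rs sL fgL.
have [m [K1 [k1 [p1 [ses1 fgK1]]]]] := fin_gen_cover noeth fgL.
apply: (ext1_shift_cosyzygy ses1 _ ses); first exact: row_projective.
  exact: ext1_injective.
apply: hM rs _ fgK1; exists L, 'rV[R]_m, k1, p1; split=> //; exact: row_projective.
Qed.

Lemma gorenstein_projective_syzygy n M : gorenstein_projective M -> exists W, syzygy n M W.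
Proof.
elim: n M => [|n IH] M gM; first by exists M.
have [P [Y [i [p [prP gY ses]]]]] := gorenstein_projective_embed gM.
by have [W sW] := IH Y gY; exists W, Y, P, i, p.
Qed.

(** Ext^1(Y, M) = 0 splits [M] off the projective [P]. To obtain it, [Y] is regarded as an n-th
    syzygy, with n such that finitely generated n-th syzygies are Gorenstein-projective. *)
Lemma gproj_null_projective M : gorenstein_ring R -> gorenstein_projective M ->
  (forall C (f : {linear C -> M}), fg_gproj C -> factors_through_projective f) ->
  projective M.
Proof.
move=> gorR gM null; have [n nP] := gorenstein_ring_syzygy gorR.
have [noeth _ /finite_injective_dimension_chain[_ [Z [Z0 chainZ _]]] _] := gorR.
have cR k : cores k (R^o : lmodType R) by rewrite -Z0; exact: cores_chain.
have [P [Y [i [p [prP gY ses]]]]] := gorenstein_projective_embed gM.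
have [W sW] := gorenstein_projective_syzygy n gY.
have extM : ext1 Y M.
  apply: ext1_syzygy_cyclic sW => //; first exact: cores_gproj.
  move=> C q K qs sK fgK; have gK := nP _ _ sK fgK.
  (* A map from [K1] to [M] is null by hypothesis, and its first factor extends over the free module
     because [K] has no Ext^1 into projectives. *)
  have [m [K1 [k [r [ses1 gK1]]]]] := fg_gproj_cover gorR (conj fgK gK).
  apply: (ext1_ses ses1) => [|f]; first exact: row_projective.
  have [Q [a [b [prQ ->]]]] := null _ f gK1.
  have [g gE] := gorenstein_projective_ext1 gK prQ a ses1.
  by exists (lin_comp b g) => x; rewrite /= gE.
have [g gE] := extM _ _ i p (lin_id M) ses.
exact: retract_projective gE prP.
Qed.

End InjectiveModules.

(** * Cellular approximation *)


Section CellularApproximation.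
Variable R : pzRingType.
Implicit Types (A B C D E K L M N P Q W X Y Z T : lmodType R).

(* A finitely generated module is a quotient of some R^n, so the submodules of the R^n *)
(* index the isomorphism classes. *)
Lemma fg_gproj_generators : exists (I : small) (G : I -> lmodType R),
  (forall j, fg_gproj (G j)) /\
  forall C, fg_gproj C -> exists j (f : {linear C -> G j}) (g : {linear G j -> C}),
    (forall x, g (f x) = x) /\ forall x, f (g x) = x.
Proof.
pose ok (u : {n : nat & 'rV[R]_n -> bool}) C (q : {linear 'rV[R]_(projT1 u) -> C}) :=
  [/\ surjective q, forall x, q x = 0 <-> projT2 u x & fg_gproj C].
pose I : small := {u : {n : nat & 'rV[R]_n -> bool} | exists C q, @ok u C q}.
have [G /dependent_choice[q qE]] :=
  dependent_choice (fun j : I => svalP j).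
exists I, G; split=> [j|C gC]; first by have [] := qE j.
have [n [p ps]] := (fin_gen_rowP C).1 gC.1.
have okC : exists C' r, @ok (existT _ n (fun x => p x == 0)) C' r.
  by exists C, p; split=> //= x; split=> /eqP.
pose j : I := exist _ _ okC; have [qs qk _] := qE j.
have sesp : short_exact (ker_incl p) p by exact: ker_ses.
have sesq : short_exact (ker_incl (q j)) (q j) by exact: ker_ses.
have [|f fE] := short_exact_descend (f := q j) sesp.
  by move=> x; apply/qk/eqP; apply/ker_inclP; exists x.
have [|g gE] := short_exact_descend (f := p) sesq.
  by move=> x; apply/eqP; apply/(qk (ker_incl (q j) x)); apply/ker_inclP; exists x.
exists j, f, g; split=> x.
  by have [y <-] := ps x; rewrite fE gE.
by have [y <-] := qs x; rewrite gE fE.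
Qed.

Hypothesis gorR : gorenstein_ring R.

Section Step.
Variables (T P : lmodType R) (pi : {linear P -> T}).
Hypothesis prP : projective P.

(** A compatible pair [(h1, h2)] is a map from [C] to the pullback of [Y] and [P] over [T]; the last
    clause makes it null in the pullback formed with [Y']. *)
Definition cell_attachment Y Y' (w : {linear Y -> T}) (w' : {linear Y' -> T})
    (a : {linear Y -> Y'}) : Prop :=
  [/\ exists (I : small) (D : I -> lmodType R) (q : {linear Y' -> dsum D}),
        short_exact a q /\ forall i, fg_gproj (D i),
      forall y, w' (a y) = w y
    & forall C (h1 : {linear C -> Y}) (h2 : {linear C -> P}), fg_gproj C ->
        (forall x, w (h1 x) = pi (h2 x)) ->
        exists Q (c : {linear C -> Q}) (H1 : {linear Q -> Y'}) (H2 : {linear Q -> P}),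
          [/\ projective Q, forall x, H1 (c x) = a (h1 x), forall x, H2 (c x) = h2 x
            & forall x, w' (H1 x) = pi (H2 x)]].

Lemma cell_attachment_exists Y (w : {linear Y -> T}) :
  exists Y' (w' : {linear Y' -> T}) (a : {linear Y -> Y'}), cell_attachment w w' a.
Proof.
have [I [G [gG allG]]] := fg_gproj_generators.
pose J : small := {j : I & {h : {linear G j -> Y} * {linear G j -> P} |
  forall x, w (h.1 x) = pi (h.2 x)}}.
pose C (u : J) := G (projT1 u).
pose h1 (u : J) : {linear C u -> Y} := (sval (projT2 u)).1.
pose h2 (u : J) : {linear C u -> P} := (sval (projT2 u)).2.
have h12 u x : w (h1 u x) = pi (h2 u x) by exact: (svalP (projT2 u)).
have [m /dependent_choice[D /dependent_choice[k /dependent_choice[p pE]]]] :=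
  dependent_choice (fun u : J => fg_gproj_embed gorR (gG (projT1 u))).
(* [h2] extends over each cell because the cokernel of the cell is Gorenstein-projective; on the
   cell, [w'] is then defined as [pi] after [H2]. *)
have [H2 H2E] := dependent_choice (fun u =>
  gorenstein_projective_ext1 (pE u).2.2 prP (h2 u) (pE u).1).
have [|M [q [ses ME _ _ _]]] := @dsum_ses _ _ _ _ _ k p; first by move=> u; have [] := pE u.
have [f fE] := dsum_copair h1.
have [V [a [b [r [sesV ab rb VE univ]]]]] := pushout f ses.
have [v vE] := dsum_copair (fun u => lin_comp pi (H2 u)).
have [|w' [w'a w'b]] := univ T w v.
  apply: (@dsum_lin_ext _ _ _ _ (lin_comp v M) (lin_comp w f)) => u x /=.
  by rewrite ME fE vE /= H2E h12.
exists V, w', a; split=> //; first by exists J, D, r; split=> // u; have [] := pE u.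
move=> C' g1 g2 gC' g12; have [j [f0 [g0 [gf fg]]]] := allG C' gC'.
have g12' x : w (lin_comp g1 g0 x) = pi (lin_comp g2 g0 x) by exact: g12.
pose u : J := existT _ j (exist _ (lin_comp g1 g0, lin_comp g2 g0) g12').
exists 'rV[R]_(m u), (lin_comp (k u) f0), (lin_comp b (dinj u)), (H2 u); split.
- exact: row_projective.
- move=> x; rewrite -[LHS]/(b (dinj u (k u (f0 x)))) -ME ab fE.
  by rewrite -[h1 u _]/(g1 (g0 (f0 x))) gf.
- by move=> x; rewrite /= H2E -[h2 u _]/(g2 (g0 (f0 x))) gf.
- by move=> x; rewrite -[lin_comp b _ x]/(b (dinj u x)) w'b vE.
Qed.

End Step.

Definition cellular (Y : nat -> lmodType R) (a : forall n, {linear Y n -> Y n.+1}) : Prop :=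
  (forall x : Y 0%N, x = 0) /\
  forall n, exists (I : small) (D : I -> lmodType R) (q : {linear Y n.+1 -> dsum D}),
    short_exact (a n) q /\ forall i, fg_gproj (D i).

Lemma cellular_inj (Y : nat -> lmodType R) a : @cellular Y a -> forall n, injective (a n).
Proof. by move=> [_ cell] n; have [I [D [q [[]]]]] := cell n. Qed.

Lemma cellular_gproj (Y : nat -> lmodType R) a : @cellular Y a -> forall n, gorenstein_projective (Y n).
Proof.
move=> [Y0 cell]; elim=> [|n IH].
  apply: projective_gproj => A B p f _; exists lin_zero => x.
  by rewrite (Y0 x) !linear0.
have [I [D [q [ses gD]]]] := cell n.
by apply: gorenstein_projective_extension ses IH _; apply: gorenstein_projective_dsum => i;
  exact: (gD i).2.
Qed.

Lemma cellular_gproj_lim (Y : nat -> lmodType R) (a : forall n, {linear Y n -> Y n.+1}) (t : telescope a) : @cellular Y a ->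
  gorenstein_projective (tele_lim t).
Proof.
move=> cell; apply: gorenstein_projective_telescope => n; first exact: cellular_gproj cell n.
have [I [D [q [ses gD]]]] := cell.2 n; exists (dsum D), q; split=> //.
by apply: gorenstein_projective_dsum => i; exact: (gD i).2.
Qed.

Lemma cellular_approximation T P (pi : {linear P -> T}) :
  gorenstein_projective T -> projective P -> surjective pi ->
  exists (Y : nat -> lmodType R) (a : forall n, {linear Y n -> Y n.+1}) (t : telescope a)
         (w : {linear tele_lim t -> T}),
    cellular a /\ projective (ker_mod (lin_copair w (- pi))).
Proof.
move=> gT prP pis.
pose st := {Y : lmodType R & {linear Y -> T}}.
have [F FE] : exists F : st -> st, forall s : st, exists a : {linear projT1 s -> projT1 (F s)},
    cell_attachment pi (projT2 s) (projT2 (F s)) a.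
  apply: (@dependent_choice _ _ (fun s s' : st => exists a : {linear projT1 s -> projT1 s'},
    cell_attachment pi (projT2 s) (projT2 s') a)) => -[Y w].
  have [Y' [w' [a cell]]] := cell_attachment_exists pi prP w.
  by exists (existT _ Y' w'), a.
pose s0 : st := existT (fun Y => {linear Y -> T}) ('rV[R]_0 : lmodType R) lin_zero.
pose S n : st := iter n F s0.
pose Y n := projT1 (S n); pose w n : {linear Y n -> T} := projT2 (S n).
have [a aE] := dependent_choice (fun n => FE (S n)).
have cell : @cellular Y a.
  by split=> [x|n]; [apply/rowP; case | have [] := aE n].
have inj_a := cellular_inj cell.
have [t _] := @telescope_exists R Y a.
have [|v vE] := @tele_copair _ _ _ t T w; first by move=> n y; have [_ + _] := aE n; apply.
exists Y, a, t, v; split=> //.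
(* The kernel of [d] is the pullback [E] of the limit and [P] over [T]. *)
pose d := lin_copair v (- pi); have dE x : d x = v x.1 - pi x.2 by [].
have ds : surjective d.
  move=> x; have [y yE] := pis (- x); exists (0, y).
  by rewrite dE /= linear0 yE opprK add0r.
apply: gproj_null_projective => //.
  apply: gorenstein_projective_kernel (ker_ses ds) _ gT.
  apply: gorenstein_projective_pair; first exact: cellular_gproj_lim.
  exact: projective_gproj.
move=> C f gC.
(* The component in the limit already lives at some stage n, and stage n + 1 makes the pair null. *)
have [n [h1 h1E]] := fin_gen_lands_tele inj_a
  (lin_comp (lin_fst _ _) (lin_comp (ker_incl d) f)) gC.1.
pose h2 := lin_comp (lin_snd _ _) (lin_comp (ker_incl d) f).
have h12 x : w n (h1 x) = pi (h2 x).
  rewrite -vE h1E; have : d (ker_incl d (f x)) = 0 by apply/ker_inclP; exists (f x).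
  by rewrite dE => /eqP; rewrite subr_eq0 => /eqP.
have [_ _ ext] := aE n; have [Q [c [H1 [H2 [prQ H1E H2E H12]]]]] := ext C h1 h2 gC h12.
have [|g gE] := @factor_inj _ _ _ Q (ker_incl d)
    (lin_pair (lin_comp (tele_in t n.+1) H1) H2) val_inj.
  by move=> x; apply/ker_inclP; rewrite dE -[_.1]/(tele_in t n.+1 (H1 x)) vE H12 subrr.
exists Q, c, g; split=> //; apply: linear_ext => x; apply: val_inj.
rewrite -[RHS]/(ker_incl d (g (c x))) gE -[RHS]/(tele_in t n.+1 (H1 (c x)), H2 (c x)).
rewrite H1E H2E tele_inS h1E /= -[val (f x)]/(ker_incl d (f x)).
by case: (ker_incl d (f x)).
Qed.

End CellularApproximation.

(** * The stable category *)


Section Generic.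
Variable T : triangulated_data.
Implicit Types X Y Z : T.

Lemma mcompm0 X Y Z (g : mor Y Z) : mcomp g (0 : mor X Y) = 0.
Proof. by apply: (addrI (mcomp g 0)); rewrite -mcompDr !addr0. Qed.

Lemma mcomp0m X Y Z (f : mor X Y) : mcomp (0 : mor Y Z) f = 0.
Proof. by apply: (addrI (mcomp 0 f)); rewrite -mcompDl !addr0. Qed.

Lemma mcomp_sumr X Y Z (g : mor Y Z) I (r : seq I) (F : I -> mor X Y) :
  mcomp g (\sum_(i <- r) F i) = \sum_(i <- r) mcomp g (F i).
Proof.
by elim: r => [|i r IH]; rewrite ?big_nil ?mcompm0 // !big_cons mcompDr IH.
Qed.

Lemma mcomp_suml X Y Z (f : mor X Y) I (r : seq I) (F : I -> mor Y Z) :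
  mcomp (\sum_(i <- r) F i) f = \sum_(i <- r) mcomp (F i) f.
Proof.
by elim: r => [|i r IH]; rewrite ?big_nil ?mcomp0m // !big_cons mcompDl IH.
Qed.

Definition finite_hom (I : small) (X : I -> T) Z (f : forall j, mor Z (X j)) : Prop :=
  finite_set (fun j => f j <> 0).

Lemma finite_hom_sum (I : small) (X : I -> T) Y Z (i : forall j, mor (X j) Y)
    (f : forall j, mor Z (X j)) : finite_hom f ->
  exists2 s : seq {classic I}, uniq s & (forall j : {classic I}, j \notin s -> f j = 0) /\
    \sum_(j \in [set: {classic I}]) mcomp (i j) (f j) = \sum_(j <- s) mcomp (i j) (f j).
Proof.
move=> ff; have /finite_seqP[s sE] : finite_set ((fun j => f j <> 0) : set {classic I}).
  exact: ff.
have f0 j : j \notin undup s -> f j = 0.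
  move=> js; apply: contrapT => fj; move: js; rewrite mem_undup => /negP; apply.
  by suff : [set` s]%classic j by []; rewrite -sE.
exists (undup s); first exact: undup_uniq.
split=> //; apply: fsumE; first exact: undup_uniq.
by move=> j /f0 ->; rewrite mcompm0.
Qed.

Lemma finite_homP (I : small) (X : I -> T) Z (f : forall j, mor Z (X j))
    (s : seq {classic I}) :
  (forall j : {classic I}, j \notin s -> f j = 0) -> finite_hom f.
Proof.
move=> f0; apply: (@sub_finite_set {classic I} _ (fun j => j \in s)).
  by move=> j /= fj; apply: contrapT => js; apply: fj; apply: f0; apply/negP.
by apply/finite_seqP; exists s.
Qed.

(** Families of components for [X] and for [Y] are exchanged by composing with [i] and [p]; since p
    i is the identity, existence and uniqueness carry over. *)
Lemma compact_summand X Y : direct_summand X Y -> compact_object Y -> compact_object X.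
Proof.
move=> [_ [i [_ [p [_ [pi _ _ _ _]]]]]] cY I Z W e cop h.
have [f [[ff fE] fU]] := cY I Z W e cop (mcomp h p).
exists (fun j => mcomp (f j) i); split.
  have [s us [s0 sE]] := finite_hom_sum e ff.
  have s0' (j : {classic I}) : j \notin s -> mcomp (f j) i = 0.
    by move=> /s0 ->; rewrite mcomp0m.
  split; first exact: finite_homP s0'.
  rewrite (fsumE us) => [|j /s0' ->]; last by rewrite mcompm0.
  under eq_bigr do rewrite mcompA.
  by rewrite -mcomp_suml -sE fE -mcompA pi mcompm1.
move=> g [fg gE]; have [s us [s0 sE]] := finite_hom_sum e fg.
have s0' (j : {classic I}) : j \notin s -> mcomp (g j) p = 0.
  by move=> /s0 ->; rewrite mcomp0m.
rewrite (fU (fun j => mcomp (g j) p)).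
  apply: functional_extensionality_dep => j.
  by rewrite -mcompA pi mcompm1.
split; first exact: finite_homP s0'.
rewrite (fsumE us) => [|j /s0' ->]; last by rewrite mcompm0.
under eq_bigr do rewrite mcompA.
by rewrite -mcomp_suml -sE gE.
Qed.

End Generic.

Section StableModules.
Variable R : pzRingType.
Implicit Types (A B C D E K L M N P Q W Z : lmodType R).
Implicit Types X Y : gproj R.

Local Notation null := factors_through_projective.

Lemma null_zero A B : null (0 : {linear A -> B}).
Proof.
exists 'rV[R]_0, lin_zero, lin_zero; split; first exact: zero_projective.
exact: linear_ext.
Qed.

Lemma null_opp A B (f : {linear A -> B}) : null f -> null (- f).
Proof.
move=> [P [a [b [prP ->]]]]; exists P, a, (- b); split=> //; exact: linear_ext.
Qed.

Lemma null_sum A B I (r : seq I) (F : I -> {linear A -> B}) :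
  (forall i, null (F i)) -> null (\sum_(i <- r) F i).
Proof.
move=> nF; elim: r => [|i r IH]; rewrite ?big_nil ?big_cons; first exact: null_zero.
exact: null_add.
Qed.

Lemma null_ext A B (f g : {linear A -> B}) : (forall x, f x = g x) -> null f -> null g.
Proof. by move=> /linear_ext ->. Qed.

Lemma stable0 A B : stable (0 : {linear A -> B}) = 0.
Proof. by apply: (addrI (stable 0)); rewrite -stableD !addr0. Qed.

Lemma stable_eq0 A B (f : {linear A -> B}) : stable f = 0 <-> null f.
Proof. by rewrite -stable0 stable_eqP subr0. Qed.

Lemma stable_sum A B I (r : seq I) (F : I -> {linear A -> B}) :
  stable (\sum_(i <- r) F i) = \sum_(i <- r) stable (F i).
Proof. by elim: r => [|i r IH]; rewrite ?big_nil ?stable0 // !big_cons stableD IH. Qed.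

(** A direct sum of projectives is projective, so the factorizations assemble. This yields
    uniqueness in the coproducts of the stable category. *)
Lemma null_dsum (I : small) (Z : I -> lmodType R) W (f : {linear dsum Z -> W}) :
  (forall i, null (lin_comp f (dinj i))) -> null f.
Proof.
move=> /dependent_choice[Q /dependent_choice[a /dependent_choice[b abE]]].
have [m [mi _]] := dsum_map a; have [h hE] := dsum_copair b.
exists (dsum Q), m, h; split; first by apply: dsum_projective => i; have [] := abE i.
apply: linear_ext => x; apply: (@dsum_lin_ext _ _ _ _ f (lin_comp h m)) => i y /=.
have [_ e] := abE i; rewrite mi hE -[RHS]/(lin_comp (b i) (a i) y) -e.
by [].
Qed.

(** The two embeddings of [A] extend along each other. The composite of the extensions differs from
    the identity by a map that kills [A], hence descends to the cosyzygy and lifts its error to a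
    projective. *)
Lemma cosyzygies_stable_iso A C C' P P' (i : {linear A -> P}) (p : {linear P -> C})
    (i' : {linear A -> P'}) (p' : {linear P' -> C'}) :
  short_exact i p -> short_exact i' p' -> projective P -> projective P' ->
  gorenstein_projective C -> gorenstein_projective C' ->
  exists (f : {linear C -> C'}) (g : {linear C' -> C}),
    null (lin_comp g f - lin_id C) /\ null (lin_comp f g - lin_id C').
Proof.
move=> ses ses' prP prP' gC gC'.
have [F FE] := gorenstein_projective_ext1 gC prP' i' ses.
have [G GE] := gorenstein_projective_ext1 gC' prP i ses'.
have [|f fE] := short_exact_descend (f := lin_comp p' F) ses.
  by move=> x; rewrite /= FE (ses_comp _ ses').
have [|g gE] := short_exact_descend (f := lin_comp p G) ses'.
  by move=> x; rewrite /= GE (ses_comp _ ses).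
have [|h hE] := short_exact_descend (f := lin_comp G F - lin_id P) ses.
  by move=> x; rewrite lin_subE /= FE GE subrr.
have [|h' hE'] := short_exact_descend (f := lin_comp F G - lin_id P') ses'.
  by move=> x; rewrite lin_subE /= GE FE subrr.
exists f, g; split.
  exists P, h, p; split=> //; apply: linear_ext => y.
  have [_ _ /(_ y)[x <-]] := ses; rewrite lin_subE /= fE gE hE lin_subE linearB.
  by [].
exists P', h', p'; split=> //; apply: linear_ext => y.
have [_ _ /(_ y)[x <-]] := ses'; rewrite lin_subE /= gE fE hE' lin_subE linearB.
by [].
Qed.

(** * Localizing subcategories in terms of modules *)

Section Localizing.
Variable S : stable_GProj R -> Prop.
Hypotheses (triS : triangulated_subcategory S) (copS : closed_under_coproducts S).

(** Membership for bare modules; [mem_subP] shows that the choice of the proof of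
    Gorenstein-projectivity is immaterial. *)
Definition mem_sub M : Prop := exists gM : gorenstein_projective M, S (GProj gM).
Local Notation inS := mem_sub.

Lemma mem_subP X : S X <-> inS X.
Proof.
case: X => M gM; split=> [SM|[gM' SM]]; first by exists gM.
by rewrite (Prop_irrelevance gM gM').
Qed.

Lemma mem_sub_gproj M : inS M -> gorenstein_projective M.
Proof. by case. Qed.

Lemma mem_sub_projective P : projective P -> inS P.
Proof.
move=> prP; have gP := projective_gproj prP; exists gP.
have [zS _ _ _] := triS; apply: zS; apply/(@stable_eq0 P P).
by exists P, (lin_id P), (lin_id P); split=> //; exact: linear_ext.
Qed.

Lemma mem_sub_stable_iso A B (f : {linear A -> B}) (g : {linear B -> A}) :
  null (lin_comp g f - lin_id A) -> null (lin_comp f g - lin_id B) ->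
  gorenstein_projective B -> inS A -> inS B.
Proof.
move=> ngf nfg gB [gA SA]; exists gB; have [_ isoS _ _] := triS.
apply: (isoS (GProj gA) (GProj gB) (stable f)) SA.
exists (stable g); split.
  by rewrite /= stable_compE; apply/stable_eqP.
by rewrite /= stable_compE; apply/stable_eqP.
Qed.

Lemma mem_sub_iso A B (f : {linear A -> B}) (g : {linear B -> A}) :
  (forall x, g (f x) = x) -> (forall x, f (g x) = x) -> inS A -> inS B.
Proof.
move=> gf fg iA.
apply: (@mem_sub_stable_iso A B f g) => //.
- by apply: null_ext (null_zero A A) => x; rewrite lin_subE /= gf subrr.
- by apply: null_ext (null_zero B B) => x; rewrite lin_subE /= fg subrr.
- exact: gorenstein_projective_iso gf fg (mem_sub_gproj iA).
Qed.

Lemma mem_sub_coker A B C (i : {linear A -> B}) (p : {linear B -> C}) :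
  short_exact i p -> gorenstein_projective C -> inS A -> inS B -> inS C.
Proof.
move=> ses gC [gA SA] [gB SB]; exists gC; have [_ _ _ trS] := triS.
pose XA := GProj gA; pose XB := GProj gB; pose XC := GProj gC.
have [F FE] := gorenstein_projective_ext1 gC (@susp_projP _ _ (susp XA))
  (susp_in (susp XA) : {linear A -> _}) ses.
have [|e eE] := short_exact_descend (f := lin_comp (susp_out (susp XA)) F) ses.
  by move=> x; rewrite /= FE (ses_comp _ (susp_exact _)).
apply: (trS XA XB XC (stable i) (stable p) (stable e)) SA SB.
have iso_id X : stable_iso (stable_id X).
  by exists (stable_id X); rewrite !stable_comp1m.
exists XA, XB, XC, (stable i), (stable p), (stable e),
  (stable_id A), (stable_id B), (stable_id C); split; split.
- by exists i, p, F, e.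
- exact: (iso_id XA).
- exact: (iso_id XB).
- exact: (iso_id XC).
- by rewrite stable_comp1m stable_compm1.
- by rewrite stable_comp1m stable_compm1.
- by rewrite (stable_shift1 XA) stable_comp1m stable_compm1.
Qed.

(** [C] is stably isomorphic to the suspension of [A], and [S] is closed under desuspension. *)
Lemma mem_sub_cosyzygy A P C (i : {linear A -> P}) (p : {linear P -> C}) :
  short_exact i p -> projective P -> gorenstein_projective A -> gorenstein_projective C ->
  inS C -> inS A.
Proof.
move=> ses prP gA gC iC; exists gA; have [_ _ shS _] := triS; apply/shS.
pose s := susp (GProj gA); apply/mem_subP.
have [f [g [gf fg]]] := cosyzygies_stable_iso ses (susp_exact s) prP (@susp_projP _ _ s) gC
  (gprojP _).
exact: mem_sub_stable_iso gf fg (gprojP _) iC.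
Qed.

Lemma mem_sub_pair A P : projective P -> inS A -> inS (A * P)%type.
Proof.
move=> prP iA.
apply: (@mem_sub_stable_iso A (A * P)%type (lin_inl A P) (lin_fst A P)) (iA).
- by apply: null_ext (null_zero A A) => x; rewrite lin_subE /= subrr.
- exists P, (lin_snd A P), (- lin_inr A P); split=> //; apply: linear_ext => -[x y].
  by rewrite lin_subE; congr (_, _) => /=; rewrite ?subrr ?sub0r ?oppr0.
- by apply: gorenstein_projective_pair (mem_sub_gproj iA) _; exact: projective_gproj.
Qed.

(** The conflation is rotated to reach a cone: a cosyzygy [Z] of [A] is the cone of a map from [B]
    to C + P. *)
Lemma mem_sub_kernel A B C (i : {linear A -> B}) (p : {linear B -> C}) :
  short_exact i p -> inS B -> inS C -> inS A.
Proof.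
move=> ses iB iC; have gB := mem_sub_gproj iB; have gC := mem_sub_gproj iC.
have gA := gorenstein_projective_kernel ses gB gC.
have [P [Z [s [r [prP gZ ses1]]]]] := gorenstein_projective_embed gA.
have [m [q ses2]] := rotate_embed ses ses1 (gorenstein_projective_ext1 gC prP).
apply: (mem_sub_cosyzygy ses1 prP gA gZ).
by apply: mem_sub_coker ses2 gZ iB _; exact: mem_sub_pair.
Qed.

Lemma mem_sub_extension A B C (i : {linear A -> B}) (p : {linear B -> C}) :
  short_exact i p -> inS A -> inS C -> inS B.
Proof.
move=> ses iA iC; have gA := mem_sub_gproj iA; have gC := mem_sub_gproj iC.
have gB := gorenstein_projective_extension ses gA gC.
have [P [K [k [r [prP gK ses1]]]]] := gorenstein_projective_cover gC.
have [m [q ses2]] := rotate_cover ses ses1 prP.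
apply: mem_sub_coker ses2 gB _ (mem_sub_pair prP iA).
exact: mem_sub_cosyzygy ses1 prP gK gC iC.
Qed.

End Localizing.

Definition dsum_gproj (I : small) (X : I -> gproj R) : gproj R :=
  GProj (gorenstein_projective_dsum (fun i => gprojP (X i))).

Lemma dsum_coproduct (I : small) (X : I -> gproj R) :
  @is_coproduct (stable_GProj R) I X (dsum_gproj X)
    (fun j => stable (@dinj R I (fun i => gproj_mod (X i)) j)).
Proof.
move=> Z f; have [g gE] := dsum_copair (fun j => stable_repr (f j)).
exists (stable g); split=> [j|g' g'E].
  rewrite /= stable_compE -[RHS]stable_reprK; congr stable.
  by apply: linear_ext => x; exact: gE.
rewrite -(stable_reprK g'); apply/stable_eqP; apply: null_dsum => j.
have : stable (lin_comp g (dinj j)) = stable (lin_comp (stable_repr g') (dinj j)).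
  rewrite -!stable_compE stable_reprK -[RHS]/(mcomp g' _) g'E -[RHS]stable_reprK.
  by rewrite stable_compE; congr stable; apply: linear_ext => x; exact: gE.
by move=> /stable_eqP; apply: null_ext.
Qed.

Lemma stable_has_coproducts : has_coproducts (stable_GProj R).
Proof.
move=> I X; exists (dsum_gproj X).
by exists (fun j => stable (@dinj R I (fun i => gproj_mod (X i)) j)); exact: dsum_coproduct.
Qed.

Lemma mem_sub_dsum (S : stable_GProj R -> Prop) (I : small) (Z : I -> lmodType R) :
  closed_under_coproducts S -> (forall i, mem_sub S (Z i)) -> mem_sub S (dsum Z).
Proof.
move=> copS /dependent_choice[gZ SZ]; pose X i := GProj (gZ i).
apply: ((mem_subP S (dsum_gproj X)).1 _); exact: (copS I X (dsum_gproj X) _ (dsum_coproduct (X:=X)) SZ).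
Qed.

Lemma fin_gen_compact X : fin_gen X -> @compact_object (stable_GProj R) X.
Proof.
move=> fgX I Z Y i cop h; pose D := dsum_gproj Z.
pose e j : @mor (stable_GProj R) (Z j) D := stable (@dinj R I (fun j => gproj_mod (Z j)) j).
(* The given coproduct is compared with the direct sum; it suffices that [Y] is a retract of [D]. *)
have [phi [phiE _]] := cop D e.
have [psi [psiE _]] := dsum_coproduct i.
have psiphi : mcomp psi phi = idm Y.
  have [u [_ uU]] := cop Y i; rewrite -(uU (mcomp psi phi)); first apply: uU => j.
    exact: mcomp1m.
  by move=> j; rewrite -mcompA phiE; exact: psiE.
pose pr j : @mor (stable_GProj R) D (Z j) :=
  stable (@dproj R I (fun j => gproj_mod (Z j)) j).
have pre_id j : mcomp (pr j) (e j) = idm (Z j).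
  rewrite /= stable_compE; congr stable; apply: linear_ext => x; exact: dproj_dinj.
have pre_0 j k : j <> k -> mcomp (pr k) (e j) = 0.
  move=> jk; rewrite /= stable_compE; apply/stable_eq0.
  apply: null_ext (null_zero _ _) => x; apply: esym; exact: dproj_dinj_neq.
(* The projections of the direct sum recover the components from [h], hence uniqueness. *)
have coordE f : finite_hom f -> \sum_(j \in [set: {classic I}]) mcomp (i j) (f j) = h ->
    f = (fun j => mcomp (pr j) (mcomp phi h)).
  move=> ff fE; have [s us [s0 sE]] := finite_hom_sum i ff.
  apply: functional_extensionality_dep => k.
  rewrite -fE sE !mcomp_sumr.
  under eq_bigr do rewrite (mcompA phi) phiE mcompA.
  have [sk|sk] := boolP ((k : {classic I}) \in s).
    rewrite (bigD1_seq (k : {classic I})) // big1; last first.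
      by move=> j /eqP jk; rewrite pre_0 // mcomp0m.
    by rewrite Monoid.mulm1 pre_id mcomp1m.
  rewrite s0 // big_seq big1 // => j sj.
  rewrite pre_0 ?mcomp0m // => jk; by move: sk; rewrite -jk sj.
pose u : {linear X -> dsum (fun j => gproj_mod (Z j))} := stable_repr (mcomp phi h).
have uE : stable u = mcomp phi h by exact: stable_reprK.
have [s sP] := fin_gen_lands_dsum u fgX.
pose f j : @mor (stable_GProj R) X (Z j) := stable (lin_comp (dproj j) u).
have f0 (j : {classic I}) : j \notin s -> f j = 0.
  move=> js; apply/stable_eq0; apply: null_ext (null_zero _ _) => x.
  by apply: esym; exact: sP.
have f0' (j : {classic I}) : j \notin undup s -> f j = 0 by rewrite mem_undup; exact: f0.
have fE : \sum_(j \in [set: {classic I}]) mcomp (i j) (f j) = h.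
  rewrite (fsumE (undup_uniq s)) => [|j /f0' ->]; last by rewrite mcompm0.
  rewrite -[RHS]mcomp1m -psiphi -mcompA -uE.
  have -> : stable u = \sum_(j <- undup s) mcomp (e j) (f j).
    rewrite /= ; under [RHS]eq_bigr do rewrite stable_compE.
    rewrite -stable_sum; congr stable; apply: linear_ext => x.
    have sumE (r : seq {classic I}) : (\sum_(j <- r) lin_comp (dinj j) (lin_comp (dproj j) u)) x
        = \sum_(j <- r) dinj j (dproj j (u x)).
      by elim: r => [|j r IH]; rewrite ?big_nil // !big_cons lin_addE IH.
    rewrite sumE; apply: dsum_sum; first exact: undup_uniq.
    by move=> j; rewrite mem_undup => /sP.
  rewrite mcomp_sumr; apply: eq_bigr => j _.
  by rewrite mcompA; congr mcomp; exact: esym (psiE j).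
exists f; split=> [|g [fg gE]]; first by split=> //; exact: finite_homP f0.
by rewrite (coordE g fg gE) (coordE f (finite_homP f0) fE).
Qed.

End StableModules.

(** * Compact objects *)


Section Small.
Variable R : pzRingType.
Implicit Types (A B C D E F K L M N P Q W Z : lmodType R).
Implicit Types X : gproj R.

Local Notation null := factors_through_projective.

(* Up to null maps, every K -> dsum Z is supported on finitely many indices. *)
Definition small_module K : Prop :=
  forall (I : small) (Z : I -> lmodType R) (f : {linear K -> dsum Z}),
    (forall i, gorenstein_projective (Z i)) ->
    exists s : seq {classic I}, forall W (m : {linear dsum Z -> W}),
      (forall i : I, (i : {classic I}) \in s -> forall x, m (dinj i x) = 0) ->
      null (lin_comp m f).

(** Compactness makes [f] stably a finite sum of maps through single summands, and [m] kills all of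
    these. *)
Lemma compact_small X : @compact_object (stable_GProj R) X -> small_module X.
Proof.
move=> cX I Z f gZ; pose Z' i := GProj (gZ i).
have [g [[fg gE] _]] := cX I Z' _ _ (dsum_coproduct (X:=Z')) (stable f).
have [s us [s0 sE]] := finite_hom_sum
  (T := stable_GProj R) (Y := dsum_gproj Z')
  (fun j => stable (@dinj R I (fun i => gproj_mod (Z' i)) j)) fg.
exists s => W m m0.
have fE : null (f - \sum_(j <- s) lin_comp (dinj j) (stable_repr (g j))).
  apply/stable_eqP; rewrite stable_sum -[LHS]gE sE; apply: eq_bigr => j _.
  by rewrite -stable_compE stable_reprK.
have := null_compl m fE; apply: null_ext => x; rewrite /= linearB.
suff -> : m ((\sum_(j <- s) lin_comp (dinj j) (stable_repr (g j))) x) = 0 by rewrite subr0.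
have sumE (r : seq {classic I}) :
    (\sum_(j <- r) lin_comp (dinj j) (stable_repr (g j))) x
      = \sum_(j <- r) dinj j (stable_repr (g j) x).
  by elim: r => [|j r IH]; rewrite ?big_nil // !big_cons lin_addE IH.
by rewrite sumE linear_sum big_seq big1 // => j js; exact: m0.
Qed.

Lemma small_pair K P : projective P -> small_module K -> small_module (K * P)%type.
Proof.
move=> prP smK I Z f gZ; have [s sP] := smK I Z (lin_comp f (lin_inl K P)) gZ.
exists s => W m m0; have n1 := null_compr (lin_fst K P) (sP W m m0).
have n2 : null (lin_comp (lin_comp m (lin_comp f (lin_inr K P))) (lin_snd K P)).
  by exists P, (lin_snd K P), (lin_comp m (lin_comp f (lin_inr K P))).
apply: null_ext (null_add n1 n2) => -[x y]; rewrite lin_addE /= -!linearD.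
by congr (m (f _)); congr (_, _); rewrite /= ?addr0 ?add0r.
Qed.

(** [f] induces a map [e] from [F] to the sum of the cosyzygies [V j]. As [F] is finitely generated,
    [e] has finite support [s1]; away from [s1] there is no obstruction to extending [f] to [B],
    where smallness applies. *)
Lemma small_kernel A B F (i : {linear A -> B}) (p : {linear B -> F}) :
  short_exact i p -> small_module B -> fg_gproj F -> small_module A.
Proof.
move=> ses smB [fgF gF] I Z f gZ.
have [Q /dependent_choice[V /dependent_choice[k /dependent_choice[r krE]]]] :=
  dependent_choice (fun j => gorenstein_projective_embed (gZ j)).
have [|M [q [sesM ME qE Mp qp]]] := @dsum_ses _ _ _ _ _ k r.
  by move=> j; have [] := krE j.
have prQ : projective (dsum Q) by apply: dsum_projective => j; have [] := krE j.
have [G GE] := gorenstein_projective_ext1 gF prQ (lin_comp M f) ses.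
have [|e eE] := short_exact_descend (f := lin_comp q G) ses.
  by move=> x; rewrite /= GE (ses_comp _ sesM).
have [s1 s1P] := fin_gen_lands_dsum e fgF.
have [mu [mu1 mu0]] := dsum_mask Z (fun j => (j : {classic I}) \notin s1).
have [muQ [muQ1 muQ0]] := dsum_mask Q (fun j => (j : {classic I}) \notin s1).
have [Mi Mex _] := sesM.
have [|g gE] := @factor_inj _ _ _ B M (lin_comp muQ G) Mi.
  move=> x; apply/Mex; apply: dsum_ext => j; rewrite linear0 qp.
  have [sj|/negP sj] := boolP ((j : {classic I}) \notin s1).
    by rewrite muQ1 // -qp -[q (G x)]/(lin_comp q G x) -eE s1P.
  by rewrite muQ0 // linear0.
have gi x : g (i x) = mu (f x).
  apply: Mi; rewrite gE /= GE; apply: dsum_ext => j /=.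
  rewrite -![sval _ j]/(dproj j _) [RHS]Mp.
  have [sj|/negP sj] := boolP ((j : {classic I}) \notin s1).
    by rewrite muQ1 // mu1 // Mp.
  by rewrite muQ0 // mu0 // linear0.
have [s2 s2P] := smB I Z g gZ; exists (s1 ++ s2) => W m m0.
have mmu x : m (mu x) = m x.
  apply: (@dsum_lin_ext _ _ _ _ (lin_comp m mu) m) => j y /=.
  have [sj|sj] := boolP ((j : {classic I}) \in s1).
    rewrite [in RHS]m0 ?mem_cat ?sj // (_ : mu _ = 0) ?linear0 //.
    apply: dsum_ext => l; rewrite linear0.
    have [sl|/negP sl] := boolP ((l : {classic I}) \notin s1); last by rewrite mu0.
    by rewrite mu1 // dproj_dinj_neq // => jl; rewrite -jl sj in sl.
  congr (m _); apply: dsum_ext => l.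
  have [sl|/negP sl] := boolP ((l : {classic I}) \notin s1); first by rewrite mu1.
  rewrite mu0 // dproj_dinj_neq // => jl; apply: sl; by rewrite -jl.
have n : null (lin_comp m g) by apply: s2P => j js; apply: m0; rewrite mem_cat js orbT.
by apply: null_ext (null_compr i n) => x; rewrite /= gi mmu.
Qed.

Lemma dsum_finite_part (I : small) (D : I -> lmodType R) (s : seq {classic I}) :
  (forall i, fg_gproj (D i)) ->
  exists F (iota : {linear F -> dsum D}) (tau : {linear dsum D -> F}),
    fg_gproj F /\
    forall i : I, (i : {classic I}) \in s -> forall x, iota (tau (dinj i x)) = dinj i x.
Proof.
move=> gD; elim: s => [|j s [F [iota [tau [gF itE]]]]].
  exists 'rV[R]_0, lin_zero, lin_zero; split=> //; split; first exact: fin_gen_row.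
  by apply: projective_gproj; exact: zero_projective.
(* The list may repeat an index, so the [j]-component is removed before [tau] is applied. *)
exists (D j * F)%type, (lin_copair (dinj j) iota),
  (lin_pair (dproj j) (lin_comp tau (lin_id _ - lin_comp (dinj j) (dproj j)))).
split; first exact: fg_gproj_extension (prod_ses (D j) F) (gD j) gF.
move=> i; rewrite inE => /orP[/eqP ->|si] x.
  rewrite -[LHS]/(dinj j (dproj j (dinj j x)) +
    iota (tau (dinj j x - dinj j (dproj j (dinj j x))))) dproj_dinj.
  by rewrite subrr !linear0 addr0.
rewrite -[LHS]/(dinj j (dproj j (dinj i x)) +
  iota (tau (dinj i x - dinj j (dproj j (dinj i x))))).
have [ij|ij] := pselect (i = j); last first.
  by rewrite dproj_dinj_neq // linear0 subr0 add0r itE.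
by move: x; rewrite ij => x; rewrite dproj_dinj subrr !linear0 addr0.
Qed.

(** Smallness leaves finitely many coordinates, and a finite sum of null maps is null. *)
Lemma null_coord (I : small) (Z : I -> lmodType R) K (f : {linear K -> dsum Z}) :
  small_module K -> (forall i, gorenstein_projective (Z i)) ->
  (forall i, null (lin_comp (dproj i) f)) -> null f.
Proof.
move=> smK gZ nf; have [s sP] := smK I Z f gZ.
pose S := \sum_(j <- undup s) lin_comp (@dinj R I Z j) (dproj j).
have SE x : S x = \sum_(j <- undup s) dinj j (dproj j x).
  by rewrite /S; elim: (undup s) => [|j r IH]; rewrite ?big_nil // !big_cons lin_addE IH.
have n1 : null (lin_comp (lin_id _ - S) f).
  apply: sP => i si x; rewrite lin_subE SE -(@dsum_sum _ _ _ _ (undup s)) ?subrr ?undup_uniq //.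
  move=> j; rewrite mem_undup => js; apply: dproj_dinj_neq => ij.
  by move: js; rewrite -ij si.
have n2 : null (\sum_(j <- undup s) lin_comp (@dinj R I Z j) (lin_comp (dproj j) f)).
  by apply: null_sum => j; apply: null_compl.
apply: null_ext (null_add n1 n2) => x.
have -> : (\sum_(j <- undup s) lin_comp (@dinj R I Z j) (lin_comp (dproj j) f)) = lin_comp S f.
  apply: linear_ext => y; rewrite -[RHS]/(S (f y)) SE.
  by elim: (undup s) => [|j r IH]; rewrite ?big_nil // !big_cons lin_addE IH.
by rewrite lin_addE -[lin_comp (_ - _) f x]/((lin_id _ - S) (f x)) lin_subE /= subrK.
Qed.

Hypothesis gorR : gorenstein_ring R.

Lemma small_cellular_factor (Y : nat -> lmodType R) (a : forall n, {linear Y n -> Y n.+1}) n K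
    (f : {linear K -> Y n}) :
  cellular a -> small_module K -> gorenstein_projective K ->
  exists D (alpha : {linear K -> D}) (beta : {linear D -> Y n}),
    fg_gproj D /\ null (f - lin_comp beta alpha).
Proof.
move=> cell; elim: n K f => [|n IH] K f smK gK.
  exists 'rV[R]_0, lin_zero, lin_zero; split.
    split; first exact: fin_gen_row.
    by apply: projective_gproj; exact: zero_projective.
  by apply: null_ext (null_zero _ _) => x; exact: etrans (cell.1 _) (esym (cell.1 _)).
have [I [D [q [ses gD]]]] := cell.2 n; have [ai aex qs] := ses.
have [s sP] := smK I D (lin_comp q f) (fun i => (gD i).2).
have [F [iota [tau [gF itE]]]] := dsum_finite_part s gD.
(* Outside the finite part [F] of the cells, [q f] factors through [Q0]; lifting [b0] along [q] and
   subtracting leaves [f1] with q f1 = iota phi exactly. *)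
have [|Q0 [a0 [b0 [prQ0 b0E]]]] := sP _ (lin_id _ - lin_comp iota tau).
  by move=> i si x; rewrite lin_subE -[lin_comp _ _ _]/(iota (tau (dinj i x))) itE // subrr.
have [b1 b1E] := prQ0 _ _ q b0 qs.
pose phi := lin_comp tau (lin_comp q f); pose f1 : {linear K -> Y n.+1} := f - lin_comp b1 a0.
have qf1 x : q (f1 x) = iota (phi x).
  have := congr1 (fun g : {linear K -> dsum D} => g x) b0E.
  rewrite -[LHS]/((lin_id _ - lin_comp iota tau) (q (f x))) lin_subE /= -b1E => e.
  by rewrite linearB -e opprB addrC subrK.
have [m [KF [k [r [sesF gKF]]]]] := fg_gproj_cover gorR gF.
have [_ _ rs] := sesF.
have [l lE] := row_projective (lin_comp iota r) qs.
(* The free cover [r] makes this map onto. Its kernel is the fibre of [phi] up to a projective, and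
   there f1 - l lands in [Y n]. *)
pose d := lin_copair phi (- r); have dE x : d x = phi x.1 - r x.2 by [].
have ds : surjective d.
  move=> y; have [x xE] := rs (- y); exists (0, x).
  by rewrite dE linear0 xE opprK add0r.
have sesd := ker_ses ds.
pose h := lin_copair f1 (- l); have hE x : h x = f1 x.1 - l x.2 by [].
have d0 x : d (ker_incl d x) = 0 by apply/ker_inclP; exists x.
have [|g gE] := @factor_inj _ _ _ (ker_mod d) (a n) (lin_comp h (ker_incl d)) ai.
  move=> x; apply/aex; rewrite /= -[val x]/(ker_incl d x) -[_ + _]/(h (ker_incl d x)) hE.
  by rewrite linearB qf1 lE -linearB -dE d0 linear0.
have gKP : gorenstein_projective (K * 'rV[R]_m)%type.
  by apply: gorenstein_projective_pair => //; apply/projective_gproj/row_projective.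
have gK1 := gorenstein_projective_kernel sesd gKP gF.2.
have smK1 : small_module (ker_mod d).
  by apply: small_kernel sesd _ gF; apply: small_pair => //; exact: row_projective.
have [D1 [al [be [gD1 [Q2 [a2 [b2 [prQ2 abE]]]]]]]] := IH _ g smK1 gK1.
(* The null error in the factorization of [g] extends from the fibre to K + R^m, so it can be
   subtracted before the pushout. *)
have [A2 A2E] := gorenstein_projective_ext1 gF.2 prQ2 a2 sesd.
(* The pushout replaces the fibre by [D1]: [V] is an extension of [F] by [D1], hence finitely
   generated and Gorenstein-projective. *)
have [V [c [b [p [sesV bc pb VE univ]]]]] := pushout al sesd.
have [|gam [gamc gamb]] := univ _ (lin_comp (a n) be) (h - lin_comp (a n) (lin_comp b2 A2)).
  move=> x; rewrite lin_subE -[h _]/(lin_comp h (ker_incl d) x) -gE /= A2E -linearB.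
  congr (a n _); have := congr1 (fun u : {linear ker_mod d -> Y n} => u x) abE.
  by rewrite lin_subE /= => <-; rewrite opprB addrC subrK.
exists V, (lin_comp b (lin_inl _ _)), gam; split; first exact: fg_gproj_extension sesV gD1 gF.
have n1 : null (lin_comp b1 a0) by exists Q0, a0, b1.
have n2 : null (lin_comp (lin_comp (a n) b2) (lin_comp A2 (lin_inl K 'rV[R]_m))).
  by exists Q2, (lin_comp A2 (lin_inl K 'rV[R]_m)), (lin_comp (a n) b2).
apply: null_ext (null_add n1 n2) => x; rewrite lin_addE lin_subE.
rewrite -[lin_comp gam _ x]/(gam (b (x, 0))) gamb lin_subE hE linear0 subr0.
by rewrite [f1 x]lin_subE /= !opprB [RHS]addrC -addrA subrK addrC.
Qed.

(** The connecting map [e], from the limit to the sum of the cosyzygies [V n], is null after [s].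
    Hence [s] lifts to [dsum Y], and smallness confines the lift to finitely many stages up to a
    null map. *)
Lemma small_telescope_factor (Y : nat -> lmodType R) (a : forall n, {linear Y n -> Y n.+1})
    (t : telescope a) K (s : {linear K -> tele_lim t}) :
  cellular a -> small_module K ->
  exists n (u : {linear K -> Y n}), null (s - lin_comp (tele_in t n) u).
Proof.
move=> cell smK; have gY := cellular_gproj cell; have gL := cellular_gproj_lim t cell.
have [Q /dependent_choice[V /dependent_choice[k /dependent_choice[r krE]]]] :=
  dependent_choice (fun n => gorenstein_projective_embed (gY n)).
have prQ n : projective (Q n) by have [] := krE n.
have gV n : gorenstein_projective (V n) by have [] := krE n.
have ses n : short_exact (k n) (r n) by have [] := krE n.
have [M [q [sesM ME qE Mp qp]]] := dsum_ses ses; have [Mi Mex qs] := sesM.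
have [A AE] := dependent_choice (fun n =>
  gorenstein_projective_ext1 (gV n) (prQ n.+1) (lin_comp (k n.+1) (a n)) (ses n)).
have /dependent_choice[z zE] n : exists z : {linear V n -> V n.+1},
    forall x, z (r n x) = r n.+1 (A n x).
  apply: (short_exact_descend (f := lin_comp (r n.+1) (A n)) (ses n)) => x.
  by rewrite /= AE (ses_comp _ (ses n.+1)).
have sesT := tele_ses t; have [_ Tex Ts] := sesT.
have [F FE] := gorenstein_projective_ext1 gL (dsum_projective prQ) M sesT.
have [|e eE] := short_exact_descend (f := lin_comp q F) sesT.
  by move=> x; rewrite /= FE (ses_comp _ sesM).
have coordE n y : dproj n (e (tele_proj t y)) = r n (dproj n (F y)).
  by rewrite eE -qp.
(* The connecting map followed by the suspension of [tele_shift] is null. In coordinates: e_0 is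
   null, and e_(n+1) agrees with [z n] after e_n up to a null map. *)
have nulle n : null (lin_comp (dproj n) e).
  elim: n => [|n IH].
    have [|g gE] := short_exact_descend
        (f := lin_comp (dproj 0%N) F - lin_comp (k 0%N) (dproj 0%N)) sesT.
      move=> y; rewrite lin_subE /= -![sval _ 0%N]/(dproj 0%N _) FE Mp.
      by rewrite (tele_shift0 t) subrr.
    exists (Q 0%N), g, (r 0%N); split=> //; apply: linear_ext => x.
    have [y <-] := Ts x; rewrite -[LHS]/(dproj 0%N _) coordE /= gE lin_subE linearB.
    by rewrite (ses_comp _ (ses 0%N)) subr0.
  have [|g gE] := short_exact_descend (f := lin_comp (dproj n.+1) F
      - lin_comp (A n) (lin_comp (dproj n) F) - lin_comp (k n.+1) (dproj n.+1)) sesT.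
    move=> y; rewrite !lin_subE.
    rewrite -[lin_comp (dproj n.+1) F _]/(dproj n.+1 (F (tele_shift t y))).
    rewrite -[lin_comp (A n) _ _]/(A n (dproj n (F (tele_shift t y)))).
    rewrite -[lin_comp (k n.+1) _ _]/(k n.+1 (dproj n.+1 (tele_shift t y))).
    by rewrite FE !Mp AE (tele_shiftS t) linearB subrr.
  have n1 : null (lin_comp (r n.+1) g) by exists (Q n.+1), g, (r n.+1).
  apply: null_ext (null_add n1 (null_compl (z n) IH)) => x.
  have [y <-] := Ts x; rewrite lin_addE.
  rewrite -[lin_comp (z n) _ _]/(z n (dproj n (e (tele_proj t y)))) coordE zE.
  rewrite -[RHS]/(dproj n.+1 (e (tele_proj t y))) coordE /= gE !lin_subE !linearB.
  rewrite -[lin_comp (k n.+1) _ _]/(k n.+1 (dproj n.+1 y)) (ses_comp _ (ses n.+1)) subr0.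
  by rewrite subrK.
have [P0 [a0 [b0 [prP0 b0E]]]] : null (lin_comp e s).
  apply: null_coord => // n.
  by apply: null_ext (null_compr s (nulle n)) => x.
have [b1 b1E] := prP0 _ _ q b0 qs.
(* These two maps exhibit [dsum Y] as the pullback of [e] and [q]; [s] and [b1] after [a0] agree in
   [dsum V], so they define the lift. *)
have ji : injective (lin_pair (tele_proj t) F).
  apply/inj0P => y [/Tex[y' <-]]; rewrite FE -[0](linear0 M) => /Mi ->.
  by rewrite linear0.
have [|st stE] := @factor_inj _ _ _ K _ (lin_pair s (lin_comp b1 a0)) ji.
  move=> x; have [y yE] := Ts (s x).
  have /Mex[y' y'E] : q (b1 (a0 x) - F y) = 0.
    rewrite linearB b1E -[b0 _]/(lin_comp b0 a0 x) -b0E /= -yE eE /=.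
    by rewrite subrr.
  exists (y + tele_shift t y'); rewrite /= !linearD (ses_comp _ sesT) addr0 yE FE y'E.
  by rewrite addrC subrK.
have [S SP] := smK nat Y st gY.
pose N := \max_(i <- (S : seq nat)) i; have [u uE] := tele_bounded t N.
exists N, (lin_comp u st).
have n1 : null (lin_comp (tele_proj t - lin_comp (tele_in t N) u) st).
  apply: SP => i iS x; rewrite lin_subE -[lin_comp _ _ _]/(tele_in t N (u (dinj i x))) uE ?subrr //.
  move=> j Nj; apply: dproj_dinj_neq => ij.
  have := @leq_bigmax_seq {classic nat} S xpredT (fun i => i) i iS isT.
  by rewrite leqNgt ij Nj.
apply: null_ext n1 => x.
rewrite -[LHS]/((tele_proj t - lin_comp (tele_in t N) u) (st x)) !lin_subE.
by have /(congr1 fst) := stE x => /= <-.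
Qed.

(** If r i - id = b a through [Q], then (i, a) and r - b make [X] an honest retract of D + Q, which
    is stably [D]; the complement is the kernel of r - b. *)
Lemma stable_retract_summand X D (gD : gorenstein_projective D)
    (i : {linear X -> D}) (r : {linear D -> X}) :
  null (lin_comp r i - lin_id X) -> @direct_summand (stable_GProj R) X (GProj gD).
Proof.
move=> [Q [a [b [prQ abE]]]].
pose i' := lin_pair i a; pose r' := lin_copair r (- b).
have r'E z : r' z = r z.1 - b z.2 by [].
have ri x : r' (i' x) = x.
  have e : r (i x) - x = b (a x) by have /(congr1 (fun u : {linear X -> X} => u x)) := abE.
  by rewrite r'E /= -e opprB addrC subrK.
have rs : surjective r' by move=> x; exists (i' x).
have gK : gorenstein_projective (ker_mod r').
  apply: gorenstein_projective_kernel (ker_ses rs) _ (gprojP X).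
  by apply: gorenstein_projective_pair => //; exact: projective_gproj.
have [|p pE] := @factor_inj _ _ _ (D * Q)%type (ker_incl r') (lin_id _ - lin_comp i' r') val_inj.
  by move=> x; apply/ker_inclP; rewrite lin_subE linearB [X in _ - X]ri subrr.
have r'0 x : r' (ker_incl r' x) = 0 by apply/ker_inclP; exists x.
have pk x : p (ker_incl r' x) = x.
  apply: val_inj; rewrite -[LHS]/(ker_incl r' (p _)) pE lin_subE.
  by rewrite -[lin_comp i' _ _]/(i' (r' (ker_incl r' x))) r'0 linear0 subr0.
have pi x : p (i' x) = 0.
  apply: val_inj; rewrite -[LHS]/(ker_incl r' (p _)) pE lin_subE.
  by rewrite -[lin_comp i' _ _]/(i' (r' (i' x))) ri subrr.
have inlE x : lin_inl D Q x.1 = x - lin_inr D Q x.2.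
  by case: x => y z; congr (_, _); rewrite /= ?subr0 ?subrr.
exists (GProj gK), (stable i), (stable (lin_comp (lin_fst D Q) (ker_incl r'))), (stable r),
  (stable (lin_comp p (lin_inl D Q))).
split; rewrite /= !stable_compE.
- by apply/stable_eqP; exists Q, a, b.
- apply/stable_eqP.
  exists Q, (lin_comp (lin_snd D Q) (ker_incl r')), (- lin_comp p (lin_inr D Q)).
  split=> //; apply: linear_ext => x; rewrite lin_subE.
  rewrite -[lin_comp _ _ x]/(p (lin_inl D Q (ker_incl r' x).1)) inlE linearB pk.
  by rewrite -[lin_id _ x]/x addrAC subrr add0r.
- apply/stable_eq0; exists Q, a, (- lin_comp p (lin_inr D Q)); split=> //.
  apply: linear_ext => x; rewrite -[LHS]/(p (lin_inl D Q (i' x).1)) inlE linearB pi.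
  by rewrite sub0r.
- apply/stable_eq0; exists Q, (lin_comp (lin_snd D Q) (ker_incl r')), b; split=> //.
  apply: linear_ext => x; apply/eqP; rewrite -subr_eq0.
  by rewrite -[X in X == 0]/(r' (ker_incl r' x)) r'0.
- rewrite -stableD; congr stable; apply: linear_ext => y; rewrite lin_addE.
  rewrite -[lin_comp (lin_comp _ _) _ y]/((ker_incl r' (p (lin_inl D Q y))).1) pE.
  rewrite lin_subE -[(_ - _).1]/(y - i (r' (lin_inl D Q y))) r'E linear0 subr0.
  by rewrite addrC subrK.
Qed.

Lemma compact_retract X : @compact_object (stable_GProj R) X ->
  exists D (i : {linear X -> D}) (r : {linear D -> X}),
    fg_gproj D /\ null (lin_comp r i - lin_id X).
Proof.
move=> /compact_small smX.
have [P [pi [prP pis]]] := projective_cover_exists X.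
have [Y [a [t [w [cell prE]]]]] := cellular_approximation gorR (gprojP X) prP pis.
pose d := lin_copair w (- pi); have dE x : d x = w x.1 - pi x.2 by [].
have ds : surjective d.
  move=> x; have [y yE] := pis (- x); exists (0, y).
  by rewrite dE linear0 yE opprK add0r.
(* The kernel of [d] is projective, so the surjection from L + P to [X] splits. *)
have [s sE] := ext1_section (ker_ses ds) (gorenstein_projective_ext1 (gprojP X) prE).
have [n [u nu]] := small_telescope_factor (lin_comp (lin_fst _ _) s) cell smX.
have [D [al [be [gD nab]]]] := small_cellular_factor u cell smX (gprojP X).
exists D, al, (lin_comp w (lin_comp (tele_in t n) be)); split=> //.
pose v := lin_comp w (tele_in t n).
have n3 : null (lin_comp pi (lin_comp (lin_snd _ _) s)).
  by exists P, (lin_comp (lin_snd _ _) s), pi.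
(* The identity of [X] is w s_1 - pi s_2. The term through [P] is null, and s_1 is replaced by a map
   through [D] in two null steps. *)
apply: null_ext (null_add (null_opp (null_add (null_compl v nab) (null_compl w nu))) n3) => x.
have e : w (s x).1 - pi (s x).2 = x by exact: sE.
rewrite !lin_addE -[V in V + _]/(- (v (u x - be (al x)) + w ((s x).1 - tele_in t n (u x)))).
rewrite [v _]linearB [w (_ - _)]linearB -[w (tele_in t n (u x))]/(v (u x)).
have -> (p q r : X) : p - q + (r - p) = r - q by rewrite addrC subrKA.
rewrite -[(- lin_id X) x]/(- x) -[X in _ = _ - X]e !opprB.
by rewrite addrA addrAC.
Qed.

End Small.

(** * Compact generation *)


Lemma mem_sub_telescope (R : pzRingType) (S : stable_GProj R -> Prop)
    (Y : nat -> lmodType R) (a : forall n, {linear Y n -> Y n.+1}) (t : telescope a) :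
  triangulated_subcategory S -> closed_under_coproducts S ->
  (forall C, fg_gproj C -> mem_sub S C) -> cellular a -> mem_sub S (tele_lim t).
Proof.
move=> triS copS fgS cell.
have SY n : mem_sub S (Y n).
  elim: n => [|n IH].
    apply: mem_sub_projective => // A B p f _; exists lin_zero => x.
    by rewrite (cell.1 x) !linear0.
  have [I [D [q [ses gD]]]] := cell.2 n.
  apply: mem_sub_extension ses IH _ => //.
  by apply: mem_sub_dsum => // i; exact: fgS.
have SdY : mem_sub S (dsum Y) by exact: mem_sub_dsum.
by apply: (mem_sub_coker triS (tele_ses t) _ SdY SdY); exact: cellular_gproj_lim.
Qed.

Lemma stable_GProj_generation (R : pzRingType) (S : stable_GProj R -> Prop) :
  gorenstein_ring R -> triangulated_subcategory S -> closed_under_coproducts S ->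
  (forall C, fg_gproj C -> mem_sub S C) -> forall X, S X.
Proof.
move=> gorR triS copS fgS X; pose s := susp X.
have [_ _ pis] := susp_exact s.
have [Y [a [t [w [cell prE]]]]] := cellular_approximation gorR (gprojP (susp_obj s))
  (@susp_projP _ _ s) pis.
have [k [r [ses _ _ _]]] := pullback_ses w (susp_exact s).
have SX : mem_sub S X.
  apply: (mem_sub_kernel triS ses); first exact: mem_sub_projective.
  exact: mem_sub_telescope.
exact: (mem_subP S X).2 SX.
Qed.

Theorem theorem4p1 (R : pzRingType) (hR : gorenstein_ring R) :
  compactly_generated (stable_GProj R) /\
  forall X : stable_GProj R,
    compact_object X <->
    exists Y : gproj R, fg_gorenstein_projective Y /\ @direct_summand (stable_GProj R) X Y.
Proof.
split; last first.
  move=> X; split=> [/(compact_retract hR)[D [i [r [gD nri]]]]|[Y [fgY sumXY]]].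
    exists (GProj gD.2); split; first exact: fg_gprojP.
    exact: stable_retract_summand nri.
  apply: compact_summand sumXY _; apply: fin_gen_compact.
  exact: fg_gorenstein_projective_fin_gen.
split; first exact: stable_has_coproducts.
have [I [G [gG allG]]] := fg_gproj_generators R.
exists I, (fun j => GProj (gG j).2); split=> [j|S triS copS SG X].
  exact: (fin_gen_compact (X := GProj (gG j).2) (gG j).1).
apply: stable_GProj_generation => // C gC; have [j [f [g [gf fg]]]] := allG C gC.
by apply: (mem_sub_iso triS fg gf); exists (gG j).2; exact: SG.
Qed.
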